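(* Let $d\ge1$ and let $(M,\nu,T)$ be the $\mathbb Z^d$-extension of a probability preserving dynamical system $(\bar M,\bar\mu,\bar T)$ by $\kappa:\bar M\to\mathbb Z^d$. Assume the spectral hypotheses (A) and the asymptotic hypotheses (B) stated in the context. Let $f,g:M\to\mathbb C$ be such that $$\sum_{\ell\in\mathbb Z^d}\Vert f(\cdot,\ell)\Vert<\infty\qquad\text{and}\qquad\sum_{\ell\in\mathbb Z^d}\Vert g(\cdot,\ell)\Vert_{\mathcal B_0'}<\infty .$$ Then, as $n\to+\infty$, $$\int_M f\cdot g\circ T^n\,d\nu=\frac{\Phi(0)}{|\det\Theta_n|}\left(\int_M f\,d\nu\int_M g\,d\nu+o(1)\right).$$
   Context: $\mathbb Z^d$-extension: $M=\bar M\times\mathbb Z^d$, $\nu=\bar\mu\otimes\mathfrak m_d$ with $\mathfrak m_d$ the counting measure on $\mathbb Z^d$, and $T(x,\ell)=(\bar T(x),\ell+\kappa(x))$. Let $P$ be the transfer operator of $\bar T$, i.e. the dual operator of $f\mapsto f\circ\bar T$, and for $t\in[-\pi,\pi]^d$ let $P_t:=P(e^{it*\kappa}\,\cdot)$, where $t*x$ denotes the standard bilinear product $\sum_i t_ix_i$. Hypotheses (A). There exist two complex Banach spaces $(\mathcal B,\Vert\cdot\Vert)$ and $(\mathcal B_0,\Vert\cdot\Vert_0)$ such that: $\mathcal B\hookrightarrow\mathcal B_0\hookrightarrow L^1(\bar M,\bar\mu)$ (continuous embeddings) and $\mathbf 1_{\bar M}\in\mathcal B$; there exist constants $b\in(0,\pi]$,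 $C>0$, $\vartheta\in(0,1)$ and functions $\lambda_\cdot:[-b,b]^d\to\mathbb C$ and $\Pi_\cdot,R_\cdot:[-b,b]^d\to\mathcal L(\mathcal B,\mathcal B)$ such that $\lim_{t\to0}\lambda_t=1$, $\lim_{t\to0}\Vert\Pi_t-\mathbb E_{\bar\mu}[\cdot]\mathbf 1_{\bar M}\Vert_{\mathcal L(\mathcal B,\mathcal B_0)}=0$; in $\mathcal L(\mathcal B,\mathcal B)$, for all $u\in[-b,b]^d$, $P_u=\lambda_u\Pi_u+R_u$, $\Pi_uR_u=R_u\Pi_u=0$, $\Pi_u^2=\Pi_u$; and for every integer $k$, $\sup_{u\in[-b,b]^d}\Vert R_u^k\Vert_{\mathcal L(\mathcal B,\mathcal B_0)}\le C\vartheta^k$ and $\sup_{u\in[-\pi,\pi]^d\setminus[-b,b]^d}\Vert P_u^k\Vert_{\mathcal L(\mathcal B,\mathcal B_0)}\le C\vartheta^k$. Hypotheses (B). $Y$ is an $\mathbb R^d$-valued random variable with integrable characteristic function $a_\cdot=e^{-\psi(\cdot)}$ and with (continuous) density function $\Phi$. There is a sequence of invertible matrices $(\Theta_n)_n$ with $\lim_{n\to+\infty}\Theta_n^{-1}=0$ such that, for every $u\in\mathbb R^d$, $\lambda_{{}^t\Theta_n^{-1}u}^n\sim e^{-\psi(u)}=a_u$ as $n\to+\infty$ (${}^t\Theta_n^{-1}$ being the transpose of $\Theta_n^{-1}$), and for every $n$ and every $u\in[-b,b]^d$, $|\lambda_u^n|\le2\left|e^{-\psi({}^t\Theta_n u)}\right|$.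 Dual norm: for $u:\bar M\to\mathbb C$, $\Vert u\Vert_{\mathcal B_0'}:=\sup_{h\in\mathcal B_0,\ \Vert h\Vert_0\le1}|\mathbb E_{\bar\mu}[u\,h]|$.
   Formalization: Added to (A): the norms of Π_u in L(B,B_0) are bounded uniformly over u in [-b,b]^d (the claim fails without it). If Φ(0)=0 the conclusion reads |det Θ_n| ∫ f·g∘T^n dν → 0. The integrals of g·h (h in B_0), g and f·g∘T^n (n≥1) are assumed to exist. *)

(* Defs.v *)
From HB Require Import structures.
From mathcomp Require Import all_boot all_order all_algebra complex.
From mathcomp Require Import all_classical all_reals all_analysis.

Set Implicit Arguments.
Unset Strict Implicit.
Unset Printing Implicit Defensive.

Import Order.TTheory GRing.Theory Num.Theory.
Import numFieldNormedType.Exports.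

Local Open Scope classical_set_scope.
Local Open Scope ring_scope.

Definition Zd (d : nat) : Type := 'cV[int]_d.
HB.instance Definition _ d := GRing.Zmodule.on (Zd d).
HB.instance Definition _ d := Countable.on (Zd d).
HB.instance Definition _ d := isPointed.Build (Zd d) 0.

Section discrete_Zd.
Variable d : nat.
Let zd0 : @discrete_measurable (Zd d) set0. Proof. by []. Qed.
Let zdC (A : set (Zd d)) : discrete_measurable A -> discrete_measurable (~` A).
Proof. by []. Qed.
Let zdU (F : (set (Zd d))^nat) : (forall i, discrete_measurable (F i)) ->
  discrete_measurable (\bigcup_i F i).
Proof. by []. Qed.
HB.instance Definition _ := @isMeasurable.Build default_measure_display (Zd d)
  discrete_measurable zd0 zdC zdU.
End discrete_Zd.

(* A copy of counting: the library attaches the sigma-finite structure of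
   counting to nat only. *)
Definition counting_Zd (R : realType) (d : nat) : set (Zd d) -> \bar R := counting.
HB.instance Definition _ (R : realType) (d : nat) :=
  Measure.copy (@counting_Zd R d) (@counting (Zd d) R).

Lemma sigma_finite_counting_Zd (R : realType) (d : nat) :
  sigma_finite [set: Zd d] (@counting_Zd R d).
Proof.
have F_fin n : finite_set [set x : Zd d | (pickle x < n)%N].
  apply: (@finite_preimage _ _ `I_n (@pickle (Zd d))); last exact: finite_II.
  by move=> x y _ _; exact: (pcan_inj pickleK).
exists (fun n => [set x : Zd d | (pickle x < n)%N]).
  by apply/seteqP; split => // x _; exists (pickle x).+1 => //=.
by move=> n; split => //; rewrite /counting_Zd /counting asboolT// ltry.
Qed.
HB.instance Definition _ (R : realType) (d : nat) :=
  @Measure_isSigmaFinite.Build _ _ _ (@counting_Zd R d) (sigma_finite_counting_Zd R d).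

(* The Borel sigma-algebra of matrices with real entries, generated by the
   coordinate maps. *)
Definition mx_display : measure_display. Proof. exact: default_measure_display. Qed.

Section measurable_matrix.
Variables (R : realType) (m n : nat).

Definition mx_cylinders : set (set 'M[R]_(m, n)) :=
  [set A | exists i j (B : set R), measurable B /\
           A = [set M : 'M[R]_(m, n) | B (M i j)]].

Let mx0 : <<s mx_cylinders >> set0. Proof. exact: sigma_algebra0. Qed.
Let mxC A : <<s mx_cylinders >> A -> <<s mx_cylinders >> (~` A).
Proof. exact: sigma_algebraC. Qed.
Let mxU (F : _^nat) : (forall i, <<s mx_cylinders >> (F i)) ->
  <<s mx_cylinders >> (\bigcup_i (F i)).
Proof. exact: sigma_algebra_bigcup. Qed.

HB.instance Definition _ := @isMeasurable.Build mx_display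
  'M[R]_(m, n) <<s mx_cylinders >> mx0 mxC mxU.

Lemma measurable_mx_coord i j :
  measurable_fun setT (fun M : 'M[R]_(m, n) => M i j).
Proof.
move=> _ B mB; rewrite setTI; apply: sub_sigma_algebra.
by exists i, j, B.
Qed.

Lemma measurable_fun_mxP dT (T : measurableType dT) (f : T -> 'M[R]_(m, n)) :
  (forall i j, measurable_fun setT (fun x => f x i j)) -> measurable_fun setT f.
Proof.
move=> mf; apply: (@measurability _ _ _ _ _ _ mx_cylinders) => //.
move=> _ [_ [i [j [B [mB ->]]]] <-].
exact: mf.
Qed.

End measurable_matrix.

Section lebesgue_Rd.
Variable R : realType.
Local Open Scope ereal_scope.

(* Lebesgue measure on R^n, by iterated integration over the coordinates. *)
Fixpoint lebesgue_Rd (n : nat) : set 'cV[R]_n -> \bar R :=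
  match n with
  | 0%N => fun A => \d_(0%R : 'cV[R]_0) A
  | k.+1 => fun A => \int[lebesgue_measure]_(x in [set: R])
      @lebesgue_Rd k [set y | A (col_mx (x%:M : 'M[R]_1) y : 'cV[R]_(1 + k))]
  end.

Let cons_cV k (p : measurableTypeR R * 'cV[R]_k) : 'cV[R]_k.+1 :=
  (col_mx (p.1%:M : 'M[R]_1) p.2 : 'cV[R]_(1 + k)).

Let uncons_cV k (x : 'cV[R]_k.+1) : measurableTypeR R * 'cV[R]_k :=
  (x ord0 ord0, dsubmx (x : 'cV[R]_(1 + k))).

Let measurable_cons_cV k : measurable_fun setT (@cons_cV k).
Proof.
apply: measurable_fun_mxP => i j; rewrite /cons_cV.
case: (split_ordP (i : 'I_(1 + k))) => i' iE.
  rewrite (_ : (fun _ => _) = fst).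
    exact: measurable_fst.
  by apply/funext => p; rewrite iE (col_mxEu (p.1%:M : 'M[R]_1) p.2) !ord1 mxE eqxx mulr1n.
rewrite (_ : (fun _ => _) = (fun M : 'cV[R]_k => M i' j) \o snd).
  apply: measurableT_comp; first exact: measurable_mx_coord.
  exact: measurable_snd.
by apply/funext => p /=; rewrite iE (col_mxEd (p.1%:M : 'M[R]_1) p.2).
Qed.

Let measurable_uncons_cV k : measurable_fun setT (@uncons_cV k).
Proof.
apply/measurable_fun_pairP; split; first exact: measurable_mx_coord.
apply: measurable_fun_mxP => i j.
rewrite (_ : (fun _ => _) = fun M : 'cV[R]_(1 + k) => M (rshift 1 i) j).
  exact: measurable_mx_coord.
by apply/funext => x; rewrite /= mxE.
Qed.

Let cons_cVK k : cancel (@cons_cV k) (@uncons_cV k).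
Proof.
move=> [x y]; rewrite /cons_cV /uncons_cV /=; congr pair.
  rewrite (_ : ord0 = lshift k (ord0 : 'I_1)); last exact/val_inj.
  by rewrite (col_mxEu (x%:M : 'M[R]_1) y) mxE eqxx mulr1n.
exact: col_mxKd.
Qed.

Section step.
Variables (k : nat) (m : {sigma_finite_measure set 'cV[R]_k -> \bar R}).
Let leb : {sigma_finite_measure set (measurableTypeR R) -> \bar R} :=
  lebesgue_measure.
Let pm : {measure set (measurableTypeR R * 'cV[R]_k)%type -> \bar R} := (leb \x m)%E.
Definition lebesgue_Rd_succ : set 'cV[R]_k.+1 -> \bar R :=
  pushforward pm (@cons_cV k).
Local Notation pf := lebesgue_Rd_succ.

HB.instance Definition _ := Measure.copy pf
  (measure_function_pushforward__canonical__measure_function_Measure pm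
    (@measurable_cons_cV k)).

Let pf_sigma_finite : sigma_finite setT pf.
Proof.
have /sigma_finiteP[F [FT ndF Foo]] := sigma_finiteT leb.
have /sigma_finiteP[G [GT ndG Goo]] := sigma_finiteT m.
have [mF mG] : (forall i, measurable (F i)) /\ (forall i, measurable (G i)).
  by split=> i; [have [] := Foo i|have [] := Goo i].
exists (fun i => @uncons_cV k @^-1` (F i `*` G i)).
  apply/esym/seteqP; split => // x _.
  have [[i _ Fi] [j _ Gj]] : (\bigcup_i F i) (uncons_cV x).1 /\
      (\bigcup_i G i) (uncons_cV x).2 by rewrite -FT -GT.
  exists (maxn i j) => //; split.
    by move: Fi; exact/subsetPset/ndF/leq_maxl.
  by move: Gj; exact/subsetPset/ndG/leq_maxr.
move=> i; split.
  rewrite -[X in measurable X]setTI; apply: measurable_uncons_cV => //.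
  exact: measurableX.
rewrite /lebesgue_Rd_succ /pushforward -comp_preimage (_ : _ \o _ = id) ?preimage_id; last first.
  by apply/funext => p /=; rewrite cons_cVK.
rewrite /pm /= product_measure1E// lte_mul_pinfty//.
  by rewrite ge0_fin_numE//; have [] := Foo i.
by have [] := Goo i.
Qed.

HB.instance Definition _ := Measure_isSigmaFinite.Build _ _ _ pf pf_sigma_finite.

Lemma lebesgue_Rd_step : @lebesgue_Rd k = m ->
  exists m' : {sigma_finite_measure set 'cV[R]_k.+1 -> \bar R},
    @lebesgue_Rd k.+1 = m'.
Proof.
move=> mE; exists pf; apply/funext => A /=.
rewrite /lebesgue_Rd_succ /pushforward /pm /= /product_measure1; apply: eq_integral => x _ /=.
rewrite mE; congr (m _); apply/seteqP; split => y /=.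
  by move=> Ay; apply/xsectionP.
by move=> /xsectionP.
Qed.

End step.

Lemma lebesgue_Rd_measure n :
  exists m : {sigma_finite_measure set 'cV[R]_n -> \bar R}, @lebesgue_Rd n = m.
Proof.
elim: n => [|k [m mE]]; last exact: lebesgue_Rd_step mE.
by exists (\d_(0%R : 'cV[R]_0)).
Qed.

Section instances.
Variable n : nat.
Let leb0 : @lebesgue_Rd n set0 = 0.
Proof. by have [m ->] := lebesgue_Rd_measure n; rewrite measure0. Qed.
Let leb_ge0 A : 0 <= @lebesgue_Rd n A.
Proof. by have [m ->] := lebesgue_Rd_measure n. Qed.
Let leb_sigma_additive : semi_sigma_additive (@lebesgue_Rd n).
Proof.
by have [m ->] := lebesgue_Rd_measure n; exact: measure_semi_sigma_additive.
Qed.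
HB.instance Definition _ := isMeasure.Build _ _ _ (@lebesgue_Rd n)
  leb0 leb_ge0 leb_sigma_additive.
Let leb_sigma_finite : sigma_finite setT (@lebesgue_Rd n).
Proof. by have [m ->] := lebesgue_Rd_measure n; exact: sigma_finiteT. Qed.
HB.instance Definition _ :=
  @Measure_isSigmaFinite.Build _ _ _ (@lebesgue_Rd n) leb_sigma_finite.
End instances.

End lebesgue_Rd.

Section complex_valued.
Variable R : realType.

(* Complex moduli and norms are elements of R[i]; rnorm is the same number
   as an element of R. *)
Definition rnorm (V : normedZmodType R[i]) (v : V) : R := complex.Re `|v|.

Definition expi (s : R) : R[i] := Complex (cos s) (sin s).

Definition cexp (z : R[i]) : R[i] :=
  (expR (complex.Re z))%:C%C * expi (complex.Im z).

Definition cmeasurable dX (X : measurableType dX) (f : X -> R[i]) : Prop :=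
  measurable_fun setT (fun x => complex.Re (f x)) /\
  measurable_fun setT (fun x => complex.Im (f x)).

Definition cintegrable dX (X : measurableType dX) (mu : {measure set X -> \bar R})
    (f : X -> R[i]) : Prop :=
  mu.-integrable setT (fun x => (complex.Re (f x))%:E) /\
  mu.-integrable setT (fun x => (complex.Im (f x))%:E).

Definition cintegral dX (X : measurableType dX) (mu : {measure set X -> \bar R})
    (f : X -> R[i]) : R[i] :=
  Complex (\int[mu]_x complex.Re (f x)) (\int[mu]_x complex.Im (f x)).

Definition dot d (u v : 'cV[R]_d) : R := \sum_(i < d) u i ord0 * v i ord0.

Definition Zd_to_Rd d (l : Zd d) : 'cV[R]_d := \col_i ((l : 'cV[int]_d) i ord0)%:~R.

Definition cube d (r : R) : set 'cV[R]_d := [set u | forall i, `|u i ord0| <= r].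

End complex_valued.

Section banach_spaces_in_L1.
Context (R : realType) dX (X : measurableType dX) (mu : {measure set X -> \bar R}).

(* A continuous embedding V -> L^1(mu): [e v] is a representative of the
   class of integrable functions associated with v. *)
Record L1_embedding (V : normedModType R[i]) (e : V -> X -> R[i]) : Prop := {
  L1_emb_integrable : forall v, cintegrable mu (e v) ;
  L1_emb_linear : forall (a : R[i]) (v w : V),
    ae_eq mu setT (e (a *: v + w)) (fun x => a * e v x + e w x) ;
  L1_emb_injective : forall v, ae_eq mu setT (e v) (fun=> 0) -> v = 0 ;
  L1_emb_bounded : exists K : R, forall v,
    (\int[mu]_x (rnorm (e v x))%:E <= (K * rnorm v)%:E)%E }.

(* The norm of the element of V represented by the function f, and +oo if f
   represents no element of V (the infimum is over at most one element). *)
Definition space_norm (V : normedModType R[i]) (e : V -> X -> R[i])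
    (f : X -> R[i]) : \bar R :=
  ereal_inf [set (rnorm v)%:E | v in [set v : V | ae_eq mu setT (e v) f]].

(* The norm in L(V, W) of an operator whose values are given as functions
   on X, for W embedded in L^1(mu) by e. *)
Definition op_norm (V W : normedModType R[i]) (e : W -> X -> R[i])
    (A : V -> X -> R[i]) : \bar R :=
  ereal_sup [set space_norm e (A v) | v in [set v : V | rnorm v <= 1]].

Definition dual_norm (V : normedModType R[i]) (e : V -> X -> R[i])
    (f : X -> R[i]) : \bar R :=
  ereal_sup [set (rnorm (cintegral mu (fun x => f x * e v x)))%:E
            | v in [set v : V | rnorm v <= 1]].

End banach_spaces_in_L1.

Section Zd_extension.
Context (R : realType) dX (X : measurableType dX) (d : nat).

Definition preserves (mu : {measure set X -> \bar R}) (T : X -> X) : Prop :=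
  measurable_fun setT T /\
  forall A, measurable A -> mu (T @^-1` A) = mu A.

Definition extension_measure (mu : {measure set X -> \bar R}) :
  {measure set (X * Zd d)%type -> \bar R} := (mu \x @counting_Zd R d)%E.

Definition extension_map (T : X -> X) (kappa : X -> Zd d) (p : X * Zd d) :
  X * Zd d := (T p.1, p.2 + kappa p.1).

(* P is the operator on L^1(mu) dual to the composition by T on L^oo(mu)
   (acting on representatives, hence determined up to null sets). *)
Definition transfer_operator (mu : {measure set X -> \bar R}) (T : X -> X)
    (P : (X -> R[i]) -> X -> R[i]) : Prop :=
  forall f, cintegrable mu f ->
    cintegrable mu (P f) /\
    forall phi : X -> R[i], cmeasurable phi ->
      (exists K : R, forall x, rnorm (phi x) <= K) ->
      cintegral mu (fun x => P f x * phi x) =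
      cintegral mu (fun x => f x * phi (T x)).

Definition twisted (P : (X -> R[i]) -> X -> R[i]) (kappa : X -> Zd d)
    (t : 'cV[R]_d) (f : X -> R[i]) : X -> R[i] :=
  P (fun x => expi (dot t (Zd_to_Rd R (kappa x))) * f x).

Record spectral_hypotheses (mu : {measure set X -> \bar R})
    (P : (X -> R[i]) -> X -> R[i]) (kappa : X -> Zd d)
    (B B0 : completeNormedModType R[i]) (inc : {linear B -> B0})
    (emb : B0 -> X -> R[i]) (b C theta : R)
    (lam : 'cV[R]_d -> R[i]) (Pi Rem : 'cV[R]_d -> {linear B -> B}) : Prop := {
  inc_injective : injective inc ;
  inc_continuous : continuous inc ;
  emb_L1 : L1_embedding mu emb ;
  one_in_B : exists h : B, ae_eq mu setT (emb (inc h)) (fun=> 1) ;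
  b_range : 0 < b <= pi ;
  C_gt0 : 0 < C ;
  theta_range : 0 < theta < 1 ;
  Pi_continuous : forall u, cube b u -> continuous (Pi u) ;
  Rem_continuous : forall u, cube b u -> continuous (Rem u) ;
  lam_cvg : (lam : 'cV[R]_d -> R[i]^o) @ (0 : 'cV[R]_d)^' --> (1 : R[i]^o) ;
  Pi_cvg : (fun t => op_norm mu emb (fun (h : B) x =>
      emb (inc (Pi t h)) x - cintegral mu (emb (inc h))))
    @ (0 : 'cV[R]_d)^' --> 0%E ;
  spectral_decomposition : forall u, cube b u -> forall h : B,
    ae_eq mu setT (twisted P kappa u (emb (inc h)))
      (emb (inc (lam u *: Pi u h + Rem u h))) ;
  Pi_Rem : forall u, cube b u -> forall h : B, Pi u (Rem u h) = 0 ;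
  Rem_Pi : forall u, cube b u -> forall h : B, Rem u (Pi u h) = 0 ;
  Pi_idempotent : forall u, cube b u -> forall h : B, Pi u (Pi u h) = Pi u h ;
  Rem_bound : forall (k : nat) u, cube b u ->
    (op_norm mu emb (fun (h : B) => emb (inc (iter k (Rem u) h)))
      <= (C * theta ^+ k)%:E)%E ;
  twisted_bound : forall (k : nat) u, (cube pi `\` cube b) u ->
    (op_norm mu emb (fun (h : B) => iter k (twisted P kappa u) (emb (inc h)))
      <= (C * theta ^+ k)%:E)%E }.

Record asymptotic_hypotheses (b : R) (lam : 'cV[R]_d -> R[i])
    (dO : measure_display) (Omega : measurableType dO) (Q : probability Omega R)
    (Y : {mfun Omega >-> 'cV[R]_d}) (psi : 'cV[R]_d -> R[i])
    (Phi : 'cV[R]_d -> R) (Theta : nat -> 'M[R]_d) : Prop := {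
  charfun : forall u,
    cintegral Q (fun w => expi (dot u (Y w))) = cexp (- psi u) ;
  charfun_integrable : cintegrable (@lebesgue_Rd R d) (fun u => cexp (- psi u)) ;
  Phi_continuous : continuous Phi ;
  Phi_ge0 : forall y, 0 <= Phi y ;
  Phi_density : forall A, measurable A ->
    distribution Q Y A = (\int[@lebesgue_Rd R d]_(y in A) (Phi y)%:E)%E ;
  Theta_unit : forall n, (0 < n)%N -> Theta n \in unitmx ;
  Theta_inv_cvg : (fun n => invmx (Theta n)) @ \oo --> (0 : 'M[R]_d) ;
  lam_equiv : forall u,
    (fun n => lam ((invmx (Theta n))^T *m u) ^+ n : R[i]^o)
      ~_\oo (fun=> cexp (- psi u) : R[i]^o) ;
  lam_bound : forall n u, (0 < n)%N -> cube b u ->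
    rnorm (lam u ^+ n) <= 2 * rnorm (cexp (- psi ((Theta n)^T *m u))) }.

End Zd_extension.

(* Main.v *)
Require Import Defs.
From HB Require Import structures.
From mathcomp Require Import all_boot all_order all_algebra complex.
From mathcomp Require Import all_classical all_reals all_analysis.
From mathcomp Require Import measurable_realfun.
From mathcomp Require Import ring lra.

(** The integral of [f * (g \o T ^ n)] splits over pairs of fibres: the part that
    starts in the fibre [l] and ends in the fibre [l'] is the expectation of
    [f_l * (g_l' \o T ^ n)] on the event that the Birkhoff sum of [kappa] is
    [l' - l] ([correlation_sum]).  Each of these coefficients is treated by a
    local limit theorem, and the limits are summed by dominated convergence.

    For one coefficient, Fourier inversion on the torus writes the indicator of
    the event as an average of characters, so that the coefficient becomes an
    integral over the twists [t] of the pairings of [g_l'] with the [n]-th iterate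
    of the twisted transfer operator at [f_l] ([pairing_fourier]).  By the
    spectral decomposition such a pairing is [lam t ^+ n] times the pairing of
    [g_l'] with the projection of [f_l], up to an error of order [theta ^+ n]
    ([pairing_inside], [pairing_le]).  The substitution of the inverse transpose
    of [Theta n] ([transports_linear]) brings out the factor 1 / |det (Theta n)|.
    After it the integrand converges to the characteristic function [a] of [Y]
    times the two expectations, and is bounded by a multiple of [a] up to terms of
    total mass of order |det (Theta n)| [theta ^+ n].  Since the integral of [a] is
    [(2 * pi) ^+ d * Phi 0] ([fourier_inversion0]), the coefficient times the
    determinant tends to [Phi 0] times the product of the expectations
    ([coefficient_cvg]).

    Two points are less direct.  First, |det (Theta n)| [theta ^+ n] tends to 0
    ([det_bound]): near the origin |lam| exceeds some number larger than [theta],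
    so the hypothesis bounding the powers of [lam] by [a] makes the integral of
    |a| at scale [Theta n], which is inversely proportional to the determinant,
    decay more slowly than [theta ^+ n].  Secondly, the exchange of integrals
    behind [pairing_fourier] needs the products of [g_l'] with the iterates to be
    bounded in L^1 uniformly in the twist; the dual norm only controls their
    integrals, but the principle of uniform boundedness applied to truncations of
    [g_l'] gives the bound ([pairing_bounded]).

    The resulting estimate of the coefficients by a constant times the product of
    the norms of [f_l] and [g_l'] ([coefficient_le]) is summable over the pairs. *)

Set Implicit Arguments.
Unset Strict Implicit.
Unset Printing Implicit Defensive.

Import Order.TTheory GRing.Theory Num.Theory.
Import numFieldNormedType.Exports.

Local Open Scope classical_set_scope.
Local Open Scope ring_scope.

(** * Moduli of complex numbers as real numbers *)

Section rnorm_theory.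
Variable R : realType.
Implicit Types (z w : R[i]).

Lemma normE_rnorm (V : normedZmodType R[i]) (v : V) : `|v| = (rnorm v)%:C%C.
Proof.
rewrite /rnorm; have := normr_ge0 v; case: (`|v|) => a b.
by rewrite lecE /= => /andP[/eqP -> _].
Qed.

Lemma rnorm_ge0 (V : normedZmodType R[i]) (v : V) : 0 <= rnorm v.
Proof. by rewrite -ler0c -normE_rnorm. Qed.

Lemma rnorm0 (V : normedZmodType R[i]) : rnorm (0 : V) = 0.
Proof. by rewrite /rnorm normr0. Qed.

Lemma rnorm_eq0 (V : normedZmodType R[i]) (v : V) : rnorm v = 0 -> v = 0.
Proof. by move=> v0; apply/normr0_eq0; rewrite normE_rnorm v0. Qed.

Lemma rnormD (V : normedZmodType R[i]) (v w : V) : rnorm (v + w) <= rnorm v + rnorm w.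
Proof. by rewrite -lecR rmorphD /= -!normE_rnorm ler_normD. Qed.

Lemma rnormN (V : normedZmodType R[i]) (v : V) : rnorm (- v) = rnorm v.
Proof. by rewrite /rnorm normrN. Qed.

Lemma rnormBC (V : normedZmodType R[i]) (v w : V) : rnorm (v - w) = rnorm (w - v).
Proof. by rewrite /rnorm distrC. Qed.

Lemma rnormB_le (V : normedZmodType R[i]) (v w : V) : rnorm (v - w) <= rnorm v + rnorm w.
Proof. by rewrite (le_trans (rnormD _ _))// rnormN. Qed.

Lemma rnorm_dist (V : normedZmodType R[i]) (v w : V) : rnorm v <= rnorm w + rnorm (v - w).
Proof. by rewrite -{1}(subrK w v) addrC rnormD. Qed.

Lemma rnormM z w : rnorm (z * w) = rnorm z * rnorm w.
Proof. by apply: complexI; rewrite rmorphM /= -!normE_rnorm normrM. Qed.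

Lemma rnormZ (V : normedModType R[i]) z (v : V) : rnorm (z *: v) = rnorm z * rnorm v.
Proof. by apply: complexI; rewrite rmorphM /= -!normE_rnorm normrZ. Qed.

Lemma rnorm1 : rnorm (1 : R[i]) = 1.
Proof. by rewrite /rnorm normr1. Qed.

Lemma rnormX z n : rnorm (z ^+ n) = rnorm z ^+ n.
Proof. by elim: n => [|n IH]; rewrite ?expr0 ?rnorm1// !exprS rnormM IH. Qed.

Lemma rnormE z : rnorm z = Num.sqrt (complex.Re z ^+ 2 + complex.Im z ^+ 2).
Proof. by rewrite /rnorm normc_def. Qed.

Lemma rnorm_real (x : R) : rnorm (x%:C%C : R[i]) = `|x|.
Proof. by rewrite rnormE /= expr0n addr0 sqrtr_sqr. Qed.

Lemma rnorm_expi (s : R) : rnorm (expi s) = 1.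
Proof. by rewrite rnormE /= cos2Dsin2 sqrtr1. Qed.

Lemma Re_le_rnorm z : `|complex.Re z| <= rnorm z.
Proof. by rewrite rnormE -sqrtr_sqr ler_wsqrtr// lerDl sqr_ge0. Qed.

Lemma Im_le_rnorm z : `|complex.Im z| <= rnorm z.
Proof. by rewrite rnormE -sqrtr_sqr ler_wsqrtr// lerDr sqr_ge0. Qed.

Lemma rnorm_le_ReIm z : rnorm z <= `|complex.Re z| + `|complex.Im z|.
Proof.
rewrite rnormE -[leRHS]ger0_norm ?addr_ge0// -sqrtr_sqr ler_wsqrtr//.
rewrite sqrrD !real_normK ?num_real// -addrA [in leRHS]addrCA lerDr.
by rewrite mulrn_wge0// mulr_ge0.
Qed.

Lemma ReD z w : complex.Re (z + w) = complex.Re z + complex.Re w.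
Proof. by case: z; case: w. Qed.
Lemma ImD z w : complex.Im (z + w) = complex.Im z + complex.Im w.
Proof. by case: z; case: w. Qed.
Lemma ReN z : complex.Re (- z) = - complex.Re z.
Proof. by case: z. Qed.
Lemma ImN z : complex.Im (- z) = - complex.Im z.
Proof. by case: z. Qed.
Lemma ReM z w : complex.Re (z * w) =
  complex.Re z * complex.Re w - complex.Im z * complex.Im w.
Proof. by case: z; case: w. Qed.
Lemma ImM z w : complex.Im (z * w) =
  complex.Re z * complex.Im w + complex.Im z * complex.Re w.
Proof. by case: z; case: w. Qed.

Lemma complex_ext z w :
  complex.Re z = complex.Re w -> complex.Im z = complex.Im w -> z = w.
Proof. by case: z => a b; case: w => c e /= -> ->. Qed.

Lemma expiD (s t : R) : expi (s + t) = expi s * expi t.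
Proof.
apply: complex_ext; rewrite ?ReM ?ImM /=; first by rewrite cosD.
by rewrite sinD addrC.
Qed.

Lemma expi0 : expi (0 : R) = 1.
Proof. by rewrite /expi cos0 sin0. Qed.

Lemma expi_sum (I : Type) (r : seq I) (P : pred I) (F : I -> R) :
  expi (\sum_(i <- r | P i) F i) = \prod_(i <- r | P i) expi (F i).
Proof. by apply: (big_morph _ expiD expi0). Qed.

End rnorm_theory.

(** * Integrals of complex functions *)

Section cmeasurable_theory.
Context (R : realType) dX (X : measurableType dX).
Implicit Types (f g : X -> R[i]).

Lemma cmeasurableD f g : cmeasurable f -> cmeasurable g ->
  cmeasurable (fun x => f x + g x).
Proof.
move=> [fr fi] [gr gi]; split.
  by under eq_fun do rewrite ReD; exact: measurable_funD.
by under eq_fun do rewrite ImD; exact: measurable_funD.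
Qed.

Lemma cmeasurableN f : cmeasurable f -> cmeasurable (fun x => - f x).
Proof.
move=> [fr fi]; split.
  by under eq_fun do rewrite ReN; exact: measurableT_comp.
by under eq_fun do rewrite ImN; exact: measurableT_comp.
Qed.

Lemma cmeasurableB f g : cmeasurable f -> cmeasurable g ->
  cmeasurable (fun x => f x - g x).
Proof. by move=> mf mg; apply: cmeasurableD => //; exact: cmeasurableN. Qed.

Lemma cmeasurableM f g : cmeasurable f -> cmeasurable g ->
  cmeasurable (fun x => f x * g x).
Proof.
move=> [fr fi] [gr gi]; split.
  by under eq_fun do rewrite ReM; apply: measurable_funB; exact: measurable_funM.
by under eq_fun do rewrite ImM; apply: measurable_funD; exact: measurable_funM.
Qed.

Lemma cmeasurable_cst (c : R[i]) : cmeasurable (fun _ : X => c).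
Proof. by split; exact: measurable_cst. Qed.

Lemma cmeasurable_real (h : X -> R) : measurable_fun setT h ->
  cmeasurable (fun x => (h x)%:C%C).
Proof. by move=> mh; split => //=. Qed.

Lemma cmeasurable_expi (h : X -> R) : measurable_fun setT h ->
  cmeasurable (fun x => expi (h x)).
Proof.
move=> mh; split; rewrite /expi /=.
  apply: (@measurableT_comp _ _ _ _ _ _ (@cos R)) => //.
  by apply: continuous_measurable_fun; exact: continuous_cos.
apply: (@measurableT_comp _ _ _ _ _ _ (@sin R)) => //.
by apply: continuous_measurable_fun; exact: continuous_sin.
Qed.

Lemma cmeasurable_comp dY (Y : measurableType dY) (h : Y -> X) f :
  measurable_fun setT h -> cmeasurable f -> cmeasurable (fun y => f (h y)).
Proof.
by move=> mh [fr fi]; split; [apply: (measurableT_comp fr)|apply: (measurableT_comp fi)].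
Qed.

Lemma cmeasurable_indic (A : set X) : measurable A ->
  cmeasurable (fun x => (\1_A x)%:C%C : R[i]).
Proof. by move=> mA; apply: cmeasurable_real; exact: measurable_indic. Qed.

Lemma measurable_rnorm f : cmeasurable f -> measurable_fun setT (fun x => rnorm (f x)).
Proof.
move=> [fr fi]; under eq_fun do rewrite rnormE.
apply: (@measurableT_comp _ _ _ _ _ _ (@Num.sqrt R)).
  exact: continuous_measurable_fun (@sqrt_continuous R).
by apply: measurable_funD; exact: measurable_funX.
Qed.

End cmeasurable_theory.

Section cintegral_theory.
Context (R : realType) dX (X : measurableType dX) (mu : {measure set X -> \bar R}).
Implicit Types (f g : X -> R[i]).

Lemma cintegrable_measurable f : cintegrable mu f -> cmeasurable f.
Proof.
move=> [fr fi]; split.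
  by have /measurable_EFinP := measurable_int _ fr.
by have /measurable_EFinP := measurable_int _ fi.
Qed.

Lemma integrable_dominated (h k : X -> R) : measurable_fun setT k ->
  mu.-integrable setT (EFin \o h) -> (forall x, `|k x| <= h x) ->
  mu.-integrable setT (EFin \o k).
Proof.
move=> mk ih kh; apply: (le_integrable measurableT _ _ ih).
  exact/measurable_EFinP.
by move=> x _ /=; rewrite lee_fin (le_trans (kh x))// ler_norm.
Qed.

Lemma integrable_scaled (c : R) (h : X -> R) : mu.-integrable setT (EFin \o h) ->
  mu.-integrable setT (EFin \o (fun x => c * h x)).
Proof. by move=> ih; under [EFin \o _]eq_fun do rewrite /= EFinM; exact: integrableZl. Qed.

Lemma cintegrable_dominated f (h : X -> R) : cmeasurable f ->
  mu.-integrable setT (EFin \o h) -> (forall x, rnorm (f x) <= h x) ->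
  cintegrable mu f.
Proof.
move=> [fr fi] ih fh; split.
  apply: (integrable_dominated fr ih) => x.
  by rewrite (le_trans (Re_le_rnorm _)).
apply: (integrable_dominated fi ih) => x.
by rewrite (le_trans (Im_le_rnorm _)).
Qed.

Lemma integrable_rnorm f : cintegrable mu f ->
  mu.-integrable setT (EFin \o (fun x => rnorm (f x))).
Proof.
move=> cf; have [fr fi] := cf.
apply: (@integrable_dominated
  (fun x => `|complex.Re (f x)| + `|complex.Im (f x)|)).
- exact/measurable_rnorm/cintegrable_measurable/cf.
- rewrite (_ : _ \o _ = (EFin \o (fun x => `|complex.Re (f x)|)) \+
    (EFin \o (fun x => `|complex.Im (f x)|))); last by apply/funext.
  by apply: integrableD => //; [exact: (integrable_norm fr)|exact: (integrable_norm fi)].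
- by move=> x; rewrite ger0_norm ?rnorm_ge0// rnorm_le_ReIm.
Qed.

Lemma cintegrableP f : cmeasurable f ->
  (\int[mu]_x (rnorm (f x))%:E < +oo)%E -> cintegrable mu f.
Proof.
move=> mf foo; apply: (@cintegrable_dominated f (fun x => rnorm (f x))) => //.
apply/integrableP; split; first exact/measurable_EFinP/measurable_rnorm.
by under eq_integral do rewrite /= ger0_norm ?rnorm_ge0//.
Qed.

Lemma cintegrable_fin f : cintegrable mu f ->
  (\int[mu]_x (rnorm (f x))%:E < +oo)%E.
Proof.
move=> /integrable_rnorm/integrableP[_].
by under eq_integral do rewrite /= ger0_norm ?rnorm_ge0//.
Qed.

Lemma cintegrableD f g : cintegrable mu f -> cintegrable mu g ->
  cintegrable mu (fun x => f x + g x).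
Proof.
move=> [fr fi] [gr gi]; split.
  by under eq_fun do rewrite ReD EFinD; exact: integrableD.
by under eq_fun do rewrite ImD EFinD; exact: integrableD.
Qed.

Lemma cintegralD f g : cintegrable mu f -> cintegrable mu g ->
  cintegral mu (fun x => f x + g x) = cintegral mu f + cintegral mu g.
Proof.
move=> [fr fi] [gr gi]; apply: complex_ext; rewrite ?ReD ?ImD /=.
  by under eq_Rintegral do rewrite ReD; exact: RintegralD.
by under eq_Rintegral do rewrite ImD; exact: RintegralD.
Qed.

Lemma cintegrable_bounded_mul f g (K : R) : cmeasurable f -> cintegrable mu g ->
  (forall x, rnorm (f x) <= K) -> cintegrable mu (fun x => f x * g x).
Proof.
move=> mf ig fK.
apply: (@cintegrable_dominated _ (fun x => K * rnorm (g x))).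
- by apply: cmeasurableM => //; exact: cintegrable_measurable ig.
- rewrite (_ : _ \o _ = (fun x => K%:E * (EFin \o (fun x => rnorm (g x))) x)%E).
    by apply: integrableZl => //; exact: integrable_rnorm.
  by apply/funext => x /=; rewrite EFinM.
- by move=> x; rewrite rnormM ler_wpM2r// rnorm_ge0.
Qed.

Lemma cintegrableZ (c : R[i]) f : cintegrable mu f -> cintegrable mu (fun x => c * f x).
Proof.
by move=> cf; apply: (@cintegrable_bounded_mul (fun=> c) f (rnorm c)) => //;
  exact: cmeasurable_cst.
Qed.

Lemma cintegralZ (c : R[i]) f : cintegrable mu f ->
  cintegral mu (fun x => c * f x) = c * cintegral mu f.
Proof.
move=> [fr fi]; apply: complex_ext; rewrite ?ReM ?ImM /=.
  under eq_Rintegral do rewrite ReM.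
  by rewrite RintegralB// ?RintegralZl//;
    under [EFin \o _]eq_fun do rewrite /= EFinM; exact: integrableZl.
under eq_Rintegral do rewrite ImM.
by rewrite RintegralD// ?RintegralZl//;
  under [EFin \o _]eq_fun do rewrite /= EFinM; exact: integrableZl.
Qed.

Lemma cintegralZr (c : R[i]) f : cintegrable mu f ->
  cintegral mu (fun x => f x * c) = cintegral mu f * c.
Proof. by move=> cf; rewrite mulrC -cintegralZ//; under eq_fun do rewrite mulrC. Qed.

Lemma cintegrableN f : cintegrable mu f -> cintegrable mu (fun x => - f x).
Proof. by move=> cf; under eq_fun do rewrite -mulN1r; exact: cintegrableZ. Qed.

Lemma cintegralN f : cintegrable mu f ->
  cintegral mu (fun x => - f x) = - cintegral mu f.
Proof.
move=> cf; under [X in cintegral _ X]eq_fun do rewrite -mulN1r.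
by rewrite cintegralZ// mulN1r.
Qed.

Lemma cintegrableB f g : cintegrable mu f -> cintegrable mu g ->
  cintegrable mu (fun x => f x - g x).
Proof. by move=> cf cg; apply: cintegrableD => //; exact: cintegrableN. Qed.

Lemma cintegralB f g : cintegrable mu f -> cintegrable mu g ->
  cintegral mu (fun x => f x - g x) = cintegral mu f - cintegral mu g.
Proof.
by move=> cf cg; rewrite cintegralD// ?cintegralN//; exact: cintegrableN.
Qed.

(** The integral is rotated onto the positive real axis, where it is the
    integral of a real part. *)
Lemma le_rnorm_cintegral f : cintegrable mu f ->
  rnorm (cintegral mu f) <= \int[mu]_x rnorm (f x).
Proof.
move=> cf; set I := cintegral mu f.
have [I0|I0] := eqVneq I 0.
  by rewrite I0 rnorm0; apply: Rintegral_ge0 => x _; exact: rnorm_ge0.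
pose c : R[i] := `|I| / I.
have c1 : rnorm c = 1.
  by rewrite /rnorm normrM normfV normr_id divff// normr_eq0.
have -> : rnorm I = complex.Re (cintegral mu (fun x => c * f x)).
  by rewrite cintegralZ// -/I /c divfK.
apply: le_Rintegral => //.
- by have [] := cintegrableZ c cf.
- exact: integrable_rnorm.
- by move=> x _; rewrite -[rnorm (f x)]mul1r -c1 -rnormM
    (le_trans _ (Re_le_rnorm _))// ler_norm.
Qed.

Lemma le_rnorm_cintegral_bound f (h : X -> R) : cmeasurable f ->
  mu.-integrable setT (EFin \o h) -> (forall x, rnorm (f x) <= h x) ->
  rnorm (cintegral mu f) <= \int[mu]_x h x.
Proof.
move=> mf ih fh; have cf := cintegrable_dominated mf ih fh.
rewrite (le_trans (le_rnorm_cintegral cf))// le_Rintegral//.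
exact: integrable_rnorm.
Qed.

Lemma ae_eq_cintegral f g : cmeasurable f -> cmeasurable g ->
  ae_eq mu setT f g -> cintegral mu f = cintegral mu g.
Proof.
move=> [fr fi] [gr gi] fg; apply: complex_ext => /=; congr fine.
  apply: ae_eq_integral => //; try exact/measurable_EFinP.
  by apply: filterS fg => x /= fg xT; rewrite fg.
apply: ae_eq_integral => //; try exact/measurable_EFinP.
by apply: filterS fg => x /= fg xT; rewrite fg.
Qed.

Lemma ae_eq_cintegrable f g : cmeasurable g ->
  ae_eq mu setT f g -> cintegrable mu f -> cintegrable mu g.
Proof.
move=> mg fg cf; have mf := cintegrable_measurable cf; apply: cintegrableP => //.
rewrite (_ : integral _ _ _ = \int[mu]_x (rnorm (f x))%:E)%E.
  exact: cintegrable_fin.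
apply: ae_eq_integral => //; try exact/measurable_EFinP/measurable_rnorm.
by apply: filterS fg => x /= fg xT; rewrite fg.
Qed.

(** Limits of integrals are stated throughout as the convergence to 0 of a real
    distance, a form shared by real and complex integrands. *)
Lemma dominated_cvg0 (u : nat -> X -> R) (h : X -> R) :
  (forall n, measurable_fun setT (u n)) ->
  mu.-integrable setT (EFin \o h) ->
  (forall n x, `|u n x| <= h x) ->
  {ae mu, forall x, u n x @[n --> \oo] --> 0} ->
  \int[mu]_x `|u n x| @[n --> \oo] --> 0.
Proof.
move=> mu_ ih uh u0.
have := @dominated_convergence _ X R mu setT measurableT
  (fun n x => (u n x)%:E) (fun=> 0%E) (EFin \o h).
case.
- by move=> n; exact/measurable_EFinP.
- exact: measurable_cst.
- by apply: filterS u0 => x xu _; apply: cvg_EFin => //; exact: nearW.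
- exact: ih.
- by apply: nearW => x n _ /=; rewrite lee_fin.
move=> _ H _.
have H' : (fun n => \int[mu]_x (`|u n x|)%:E)%E @ \oo --> (0 : \bar R)%E.
  apply: cvg_trans H; apply: near_eq_cvg; near=> n => /=.
  by apply: eq_integral => x _; rewrite subr0.
exact: (fine_cvg H').
Unshelve. all: by end_near. Qed.

Lemma cdominated_convergence (F : nat -> X -> R[i]) f (h : X -> R) :
  (forall n, cmeasurable (F n)) -> cmeasurable f ->
  mu.-integrable setT (EFin \o h) ->
  (forall n x, rnorm (F n x) <= h x) -> (forall x, rnorm (f x) <= h x) ->
  {ae mu, forall x, rnorm (F n x - f x) @[n --> \oo] --> 0} ->
  rnorm (cintegral mu (F n) - cintegral mu f) @[n --> \oo] --> 0.
Proof.
move=> mF mf ih Fh fh Ff.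
have cF n := cintegrable_dominated (mF n) ih (Fh n).
have cf := cintegrable_dominated mf ih fh.
have := @dominated_cvg0 (fun n x => rnorm (F n x - f x)) (fun x => h x + h x).
move=> /(_ _ _ _ Ff) H.
apply: (@squeeze_cvgr _ _ _ _ (cst 0)
  (fun n => \int[mu]_x `|rnorm (F n x - f x)|)); [|exact: cvg_cst|].
  apply: nearW => n; rewrite rnorm_ge0/= -cintegralB//.
  under eq_Rintegral do rewrite ger0_norm ?rnorm_ge0//.
  by apply: le_rnorm_cintegral; exact: cintegrableB.
apply: H.
- by move=> n; apply: measurable_rnorm; exact: cmeasurableB.
- by under [EFin \o _]eq_fun do rewrite /= EFinD; exact: integrableD.
- move=> n x; rewrite ger0_norm ?rnorm_ge0//.
  by rewrite (le_trans (rnormB_le _ _))// lerD.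
Qed.

End cintegral_theory.

(** * Transport of integrals *)

Section transports.
Context (R : realType) dX dY (X : measurableType dX) (Y : measurableType dY).
Variables (m : {measure set X -> \bar R}) (m' : {measure set Y -> \bar R}).

(** Equivalently, [m'] is [c] times the image of [m] under [phi].  Stated with
    integrals of nonnegative functions, the property composes and extends to
    product measures by Tonelli's theorem, with no appeal to the uniqueness of
    product measures. *)
Definition transports (c : R) (phi : X -> Y) : Prop :=
  [/\ 0 < c, measurable_fun setT phi &
    forall f : Y -> \bar R, measurable_fun setT f -> (forall y, 0 <= f y)%E ->
      (\int[m']_y f y = c%:E * \int[m]_x f (phi x))%E].

Lemma transports_measure (c : R) (phi : X -> Y) : 0 < c ->
  measurable_fun setT phi ->
  (forall A, measurable A -> m' A = c%:E * m (phi @^-1` A))%E ->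
  transports c phi.
Proof.
move=> c0 mphi H; split=> // f mf f0.
pose pf : {measure set Y -> \bar R} :=
  measure_function_pushforward__canonical__measure_function_Measure m mphi.
have cge0 : 0 <= c by exact: ltW.
rewrite (eq_measure_integral (mscale (NngNum cge0) pf)); last first.
  by move=> A mA _; rewrite H.
rewrite ge0_integral_mscale//=; congr (_ * _)%E.
by rewrite ge0_integral_pushforward.
Qed.

Variables (c : R) (phi : X -> Y) (H : transports c phi).

Lemma transports_integrable (f : Y -> R) :
  m'.-integrable setT (EFin \o f) -> m.-integrable setT (EFin \o (f \o phi)).
Proof.
case: H => c0 mphi I /integrableP[mf foo]; apply/integrableP; split.
  exact: (measurableT_comp mf mphi).
have e : (\int[m']_y `|(f y)%:E| = c%:E * \int[m]_x `|(f (phi x))%:E|)%E.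
  by apply: (I (fun y => `|(f y)%:E|)%E) => //; exact: measurableT_comp.
have : (c^-1%:E * (c%:E * \int[m]_x `|(f (phi x))%:E|) < +oo)%E.
  by rewrite -e lte_mul_pinfty// lee_fin invr_ge0 ltW.
by rewrite muleA -EFinM mulVf ?gt_eqF// mul1e.
Qed.

Lemma transports_integrableV (f : Y -> R) : measurable_fun setT f ->
  m.-integrable setT (EFin \o (f \o phi)) -> m'.-integrable setT (EFin \o f).
Proof.
case: H => c0 mphi I mf /integrableP[_ foo]; apply/integrableP; split.
  exact/measurable_EFinP.
have e : (\int[m']_y `|(f y)%:E| = c%:E * \int[m]_x `|(f (phi x))%:E|)%E.
  apply: (I (fun y => `|(f y)%:E|)%E) => //.
  by apply: measurableT_comp => //; exact/measurable_EFinP.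
by rewrite e lte_mul_pinfty// lee_fin ltW.
Qed.

Lemma transports_Rintegral (f : Y -> R) : m'.-integrable setT (EFin \o f) ->
  \int[m']_y f y = c * \int[m]_x f (phi x).
Proof.
move=> intf; have intf' := transports_integrable intf.
case: H => c0 mphi I.
have mf := measurable_int _ intf.
rewrite /Rintegral integralE [in RHS]integralE.
rewrite (I (fun y => (EFin \o f)^\+ y)%E)//; last exact: measurable_funepos.
rewrite (I (fun y => (EFin \o f)^\- y)%E)//; last exact: measurable_funeneg.

have ip := integrable_fin_num measurableT (integrable_funepos measurableT intf').
have im := integrable_fin_num measurableT (integrable_funeneg measurableT intf').
have -> : (\int[m]_x (EFin \o f)^\+ (phi x) =
  \int[m]_x (fun x0 => (f (phi x0))%:E)^\+ x)%E.
  by apply: eq_integral => x _; rewrite !funeposE.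
have -> : (\int[m]_x (EFin \o f)^\- (phi x) =
  \int[m]_x (fun x0 => (f (phi x0))%:E)^\- x)%E.
  by apply: eq_integral => x _; rewrite !funenegE.
rewrite -[X in (_ * X - _)%E](fineK ip) -[X in (_ - _ * X)%E](fineK im).
rewrite -[X in c * fine (X - _)%E](fineK ip) -[X in c * fine (_ - X)%E](fineK im).
by rewrite /= mulrBr.
Qed.

Lemma transports_cintegral (f : Y -> R[i]) : cintegrable m' f ->
  cintegral m' f = c%:C%C * cintegral m (fun x => f (phi x)).
Proof.
move=> [fr fi]; apply: complex_ext; rewrite ?ReM ?ImM /= ?mul0r ?subr0 ?addr0.
  exact: (transports_Rintegral fr).
exact: (transports_Rintegral fi).
Qed.

End transports.

Lemma transports_comp (R : realType) d1 d2 d3 (X1 : measurableType d1)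
  (X2 : measurableType d2) (X3 : measurableType d3)
  (m1 : {measure set X1 -> \bar R}) (m2 : {measure set X2 -> \bar R})
  (m3 : {measure set X3 -> \bar R}) (c c' : R) (phi : X1 -> X2) (psi : X2 -> X3) :
  transports m1 m2 c phi -> transports m2 m3 c' psi ->
  transports m1 m3 (c' * c) (psi \o phi).
Proof.
move=> [c0 mphi I] [c'0 mpsi I']; split.
- exact: mulr_gt0.
- exact: measurableT_comp.
- move=> f mf f0; rewrite I'// (I (f \o psi)) ?EFinM ?muleA//.
  + exact: measurableT_comp.
  + by move=> y /=.
Qed.

(** * Complex Fubini theorem *)

Section cfubini.
Context (R : realType) d1 d2 (T1 : measurableType d1) (T2 : measurableType d2).
Variables (m1 : {sigma_finite_measure set T1 -> \bar R}).
Variables (m2 : {sigma_finite_measure set T2 -> \bar R}).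

Section real.
Variable f : T1 * T2 -> R.
Hypothesis intf : (m1 \x m2)%E.-integrable setT (EFin \o f).

Lemma Rfubini1_integrable :
  m1.-integrable setT (EFin \o (fun x => \int[m2]_y f (x, y))).
Proof.
have iF := integrable_fubini_F intf.
have fF : (EFin \o (fun x => \int[m2]_y f (x, y))) =
    EFin \o (fine \o (fubini_F m2 (EFin \o f))) by [].
rewrite fF; apply: (le_integrable measurableT _ _ iF).
  apply/measurable_EFinP; apply: measurableT_comp => //.
  exact: measurable_int iF.
by move=> x _ /=; case: (fubini_F _ _ _) => //= *; rewrite ?leey ?lexx// normr0.
Qed.

Lemma Rfubini1 : \int[(m1 \x m2)%E]_z f z = \int[m1]_x \int[m2]_y f (x, y).
Proof.
rewrite {1}/Rintegral -integral12_prod_meas1//; congr fine.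
apply: ae_eq_integral => //.
- by have := measurable_int _ (integrable_fubini_F intf).
- by have := measurable_int _ Rfubini1_integrable.
- apply: filterS (ae_integrable1 intf) => x ix _.
  by rewrite /Rintegral fineK//; exact: integrable_fin_num.
Qed.

Lemma integrable_fubini_G : m2.-integrable setT (fubini_G m1 (EFin \o f)).
Proof.
have mf := measurable_int _ intf.
apply/integrableP; split; first by apply: measurable_fubini_G intf.
have H : (\int[m2]_y \int[m1]_x `|(EFin \o f) (x, y)| < +oo)%E.
  by apply/integrable21ltyP.
apply: le_lt_trans H.
apply: ge0_le_integral => //.
- by apply: measurableT_comp => //; apply: measurable_fubini_G intf.
- apply: (measurable_fun_fubini_tonelli_G (abse \o (EFin \o f))) => //=.
  exact: measurableT_comp.
- by move=> y _; apply: le_abse_integral => //; exact: (measurableT_comp mf).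
Qed.

Lemma Rfubini2_integrable :
  m2.-integrable setT (EFin \o (fun y => \int[m1]_x f (x, y))).
Proof.
have iF := integrable_fubini_G.
have fF : (EFin \o (fun y => \int[m1]_x f (x, y))) =
    EFin \o (fine \o (fubini_G m1 (EFin \o f))) by [].
rewrite fF; apply: (le_integrable measurableT _ _ iF).
  apply/measurable_EFinP; apply: measurableT_comp => //.
  exact: measurable_int iF.
by move=> x _ /=; case: (fubini_G _ _ _) => //= *; rewrite ?leey ?lexx// normr0.
Qed.

Lemma Rfubini2 : \int[(m1 \x m2)%E]_z f z = \int[m2]_y \int[m1]_x f (x, y).
Proof.
rewrite {1}/Rintegral -integral21_prod_meas1//; congr fine.
apply: ae_eq_integral => //.
- by have := measurable_int _ integrable_fubini_G.
- by have := measurable_int _ Rfubini2_integrable.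
- apply: filterS (ae_integrable2 intf) => x ix _.
  by rewrite /Rintegral fineK//; exact: integrable_fin_num.
Qed.
End real.

Variable f : T1 * T2 -> R[i].
Hypothesis intf : cintegrable (m1 \x m2)%E f.

Lemma cfubini1_integrable : cintegrable m1 (fun x => cintegral m2 (fun y => f (x, y))).
Proof.
have [fr fi] := intf; split; first exact: (Rfubini1_integrable fr).
exact: (Rfubini1_integrable fi).
Qed.

Lemma cfubini1 :
  cintegral (m1 \x m2)%E f = cintegral m1 (fun x => cintegral m2 (fun y => f (x, y))).
Proof.
have [fr fi] := intf; apply: complex_ext => /=; first exact: (Rfubini1 fr).
exact: (Rfubini1 fi).
Qed.

Lemma cfubini2_integrable : cintegrable m2 (fun y => cintegral m1 (fun x => f (x, y))).
Proof.
have [fr fi] := intf; split; first exact: (Rfubini2_integrable fr).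
exact: (Rfubini2_integrable fi).
Qed.

Lemma cfubini2 :
  cintegral (m1 \x m2)%E f = cintegral m2 (fun y => cintegral m1 (fun x => f (x, y))).
Proof.
have [fr fi] := intf; apply: complex_ext => /=; first exact: (Rfubini2 fr).
exact: (Rfubini2 fi).
Qed.

Lemma cfubini_ae2 : {ae m2, forall y, cintegrable m1 (fun x => f (x, y))}.
Proof.
have [fr fi] := intf.
by apply: filterS2 (ae_integrable2 fr) (ae_integrable2 fi) => x.
Qed.

End cfubini.

Lemma cintegrable_prodP (R : realType) d1 d2 (T1 : measurableType d1)
    (T2 : measurableType d2) (m1 : {sigma_finite_measure set T1 -> \bar R})
    (m2 : {sigma_finite_measure set T2 -> \bar R}) (f : T1 * T2 -> R[i]) :
  cmeasurable f -> (\int[m1]_x \int[m2]_y (rnorm (f (x, y)))%:E < +oo)%E ->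
  cintegrable (m1 \x m2)%E f.
Proof.
move=> mf foo; apply: cintegrableP => //; rewrite fubini_tonelli1//.
  exact/measurable_EFinP/measurable_rnorm.
by move=> z; rewrite lee_fin rnorm_ge0.
Qed.

(** * Lebesgue measure on the space of column vectors *)

Section lebesgue_line.
Variable R : realType.
Local Notation leb := (@lebesgue_measure R).

(** Affine changes of variable on the line: both sides agree on half-open
    intervals. *)
Lemma transports_affine (a c : R) : a != 0 ->
  @transports R _ _ (measurableTypeR R) (measurableTypeR R) leb leb `|a|
    (fun x => a * x + c).
Proof.
move=> a0.
have mphi : @measurable_fun _ _ (measurableTypeR R) (measurableTypeR R) setT
    (fun x => a * x + c).
  by apply: measurable_funD => //; exact: measurable_funM.
apply: transports_measure => //; first by rewrite normr_gt0.
pose pf : {measure set (measurableTypeR R) -> \bar R} :=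
  measure_function_pushforward__canonical__measure_function_Measure leb mphi.
have age0 : 0 <= `|a| by [].
move=> A mA.
have -> : (`|a|%:E * leb ((fun x : measurableTypeR R => a * x + c)%R @^-1` A))%E =
  mscale (NngNum age0) pf A by [].
suff H X : ocitv X -> leb X = mscale (NngNum age0) pf X.
  exact: (lebesgue_measure_unique H).
move: X.
move=> _ [[p q] _ <-] /=; rewrite /mscale/= /pushforward.
have [a_gt0|a_lt0|a_eq0] := ltrgt0P a; last by rewrite a_eq0 eqxx in a0.
- have -> : (fun x => a * x + c) @^-1` `]p, q] = `](p - c) / a, (q - c) / a]%classic.
    apply/seteqP; split => x /=; rewrite !in_itv/= ltr_pdivrMr// ler_pdivlMr//;
      by rewrite ltrBlDr lerBrDr (mulrC x).
  rewrite !lebesgue_measure_itv/= !lte_fin ltr_pM2r ?invr_gt0// ltrD2r.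
  case: ifPn => _; rewrite ?mule0// -!EFinD -EFinM; congr EFin.
  by field.
- have -> : (fun x => a * x + c) @^-1` `]p, q] = `[(q - c) / a, (p - c) / a[%classic.
    apply/seteqP; split => x /=; rewrite !in_itv/= ltr_ndivlMr// ler_ndivrMr//;
      by rewrite ltrBlDr lerBrDr (mulrC x) andbC.
  rewrite !lebesgue_measure_itv/= !lte_fin ltr_nM2r ?invr_lt0// ltrD2r.
  case: ifPn => _; rewrite ?mule0// -!EFinD -EFinM; congr EFin.
  by field.
Qed.

End lebesgue_line.

Lemma transports_id (R : realType) dX (X : measurableType dX)
  (m : {measure set X -> \bar R}) : transports m m 1 id.
Proof. by split=> // f mf f0; rewrite mul1e. Qed.

Lemma eq_transports (R : realType) dX dY (X : measurableType dX)
    (Y : measurableType dY) (m : {measure set X -> \bar R})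
    (m' : {measure set Y -> \bar R}) (c c' : R) (phi phi' : X -> Y) :
  c = c' -> phi =1 phi' -> transports m m' c phi -> transports m m' c' phi'.
Proof. by move=> -> /funext ->. Qed.

(** A substitution that is conjugate to [h] by a measure isomorphism scales the
    measure as [h] does.  Through [cons_cV] this turns maps of a line times
    R^k into maps of R^(k+1). *)
Lemma transports_conj (R : realType) dX dY (X : measurableType dX)
    (Y : measurableType dY) (m : {measure set X -> \bar R})
    (m' : {measure set Y -> \bar R}) (c : R) (phi : X -> Y) (h : X -> X) (h' : Y -> Y) :
  transports m m' 1 phi -> transports m m c h -> measurable_fun setT h' ->
  (forall x, h' (phi x) = phi (h x)) -> transports m' m' c h'.
Proof.
move=> [_ mphi I] [c0 mh J] mh' E; split=> // f mf f0.
rewrite I// mul1e (J (f \o phi)); last 2 first.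
- exact: measurableT_comp.
- by move=> x /=.
rewrite (I (f \o h')); last 2 first.
- exact: measurableT_comp.
- by move=> x /=.
by rewrite mul1e; congr (_ * _)%E; apply: eq_integral => x _ /=; rewrite E.
Qed.

Section transports_fibers.
Context (R : realType) d1 d2 (T1 : measurableType d1) (T2 : measurableType d2).
Variables (m1 : {sigma_finite_measure set T1 -> \bar R}).
Variables (m2 : {sigma_finite_measure set T2 -> \bar R}).

Lemma transports_fiber2 (c : R) (h : T1 -> T2 -> T2) : 0 < c ->
  measurable_fun setT (fun p : T1 * T2 => h p.1 p.2) ->
  (forall x, transports m2 m2 c (h x)) ->
  transports (m1 \x m2)%E (m1 \x m2)%E c (fun p => (p.1, h p.1 p.2)).
Proof.
move=> c0 mh H.
have mH : measurable_fun setT (fun p : T1 * T2 => (p.1, h p.1 p.2)).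
  by apply/measurable_fun_pairP; split => //; exact: measurable_fst.
split=> // f mf f0.
have mfH : measurable_fun setT (f \o (fun p : T1 * T2 => (p.1, h p.1 p.2))).
  exact: measurableT_comp.
have fH0 p : (0 <= (f \o (fun p : T1 * T2 => (p.1, h p.1 p.2))) p)%E by rewrite /=.
rewrite fubini_tonelli1// (fubini_tonelli1 (f \o _) mfH fH0).
rewrite -ge0_integralZl//.
- apply: eq_integral => x _; rewrite /fubini_F; case: (H x) => _ mhx ->//.
  exact: (measurableT_comp mf).
- exact: measurable_fun_fubini_tonelli_F.
- by move=> x _; apply: integral_ge0.
- by rewrite lee_fin ltW.
Qed.

Lemma transports_fiber1 (c : R) (h : T2 -> T1 -> T1) : 0 < c ->
  measurable_fun setT (fun p : T1 * T2 => h p.2 p.1) ->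
  (forall y, transports m1 m1 c (h y)) ->
  transports (m1 \x m2)%E (m1 \x m2)%E c (fun p => (h p.2 p.1, p.2)).
Proof.
move=> c0 mh H.
have mH : measurable_fun setT (fun p : T1 * T2 => (h p.2 p.1, p.2)).
  by apply/measurable_fun_pairP; split => //; exact: measurable_snd.
split=> // f mf f0.
have mfH : measurable_fun setT (f \o (fun p : T1 * T2 => (h p.2 p.1, p.2))).
  exact: measurableT_comp.
have fH0 p : (0 <= (f \o (fun p : T1 * T2 => (h p.2 p.1, p.2))) p)%E by rewrite /=.
rewrite fubini_tonelli2// (fubini_tonelli2 (f \o _) mfH fH0).
rewrite -ge0_integralZl//.
- apply: eq_integral => y _; rewrite /fubini_G; case: (H y) => _ mhy ->//.
  exact: (measurableT_comp mf).
- exact: measurable_fun_fubini_tonelli_G.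
- by move=> x _; apply: integral_ge0.
- by rewrite lee_fin ltW.
Qed.

Lemma cintegrable_prod (a : T1 -> R[i]) (b : T2 -> R[i]) :
  cintegrable m1 a -> cintegrable m2 b ->
  cintegrable (m1 \x m2)%E (fun p => a p.1 * b p.2).
Proof.
move=> ia ib; apply: cintegrable_prodP.
  apply: cmeasurableM.
    exact: cmeasurable_comp measurable_fst (cintegrable_measurable ia).
  exact: cmeasurable_comp measurable_snd (cintegrable_measurable ib).
under eq_integral do under eq_integral do rewrite /= rnormM EFinM.
have b0 y : (0 <= (rnorm (b y))%:E)%E by rewrite lee_fin rnorm_ge0.
have mb : measurable_fun setT (fun y => (rnorm (b y))%:E).
  exact/measurable_EFinP/measurable_rnorm/cintegrable_measurable/ib.
have ma : measurable_fun setT (fun y => (rnorm (a y))%:E).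
  exact/measurable_EFinP/measurable_rnorm/cintegrable_measurable/ia.
under eq_integral do rewrite ge0_integralZl ?lee_fin ?rnorm_ge0//.
rewrite ge0_integralZr//; last 2 first.
- by move=> x _; rewrite lee_fin rnorm_ge0.
- exact: integral_ge0.
have /fineK <- : (\int[m1]_x (rnorm (a x))%:E)%E \is a fin_num.
  rewrite ge0_fin_numE ?cintegrable_fin//.
  by apply: integral_ge0 => x _; rewrite lee_fin rnorm_ge0.
rewrite lte_mul_pinfty ?cintegrable_fin// lee_fin fine_ge0//.
by apply: integral_ge0 => x _; rewrite lee_fin rnorm_ge0.
Qed.

Lemma cintegral_prod (a : T1 -> R[i]) (b : T2 -> R[i]) :
  cintegrable m1 a -> cintegrable m2 b ->
  cintegral (m1 \x m2)%E (fun p => a p.1 * b p.2) =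
  cintegral m1 a * cintegral m2 b.
Proof.
move=> ia ib; rewrite cfubini1; last exact: cintegrable_prod.
under [X in cintegral _ X]eq_fun do rewrite /= cintegralZ//.
by rewrite cintegralZr.
Qed.

End transports_fibers.

Section lebesgue_space.
Variable R : realType.
Local Notation leb := (@lebesgue_measure R : {sigma_finite_measure set (measurableTypeR R) -> \bar R}).
Local Notation lebd := (@lebesgue_Rd R).

Definition cons_cV k (p : measurableTypeR R * 'cV[R]_k) : 'cV[R]_k.+1 :=
  (col_mx (p.1%:M : 'M[R]_1) p.2 : 'cV[R]_(1 + k)).

Lemma cons_cV0 k p : @cons_cV k p ord0 ord0 = p.1.
Proof.
rewrite /cons_cV (_ : ord0 = lshift k (ord0 : 'I_1)); last exact/val_inj.
by rewrite (col_mxEu (p.1%:M : 'M[R]_1) p.2) mxE eqxx mulr1n.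
Qed.

Lemma cons_cVS k p (i : 'I_k) : @cons_cV k p (lift ord0 i) ord0 = p.2 i ord0.
Proof.
rewrite /cons_cV (_ : lift ord0 i = rshift 1 i); last exact/val_inj.
by rewrite (col_mxEd (p.1%:M : 'M[R]_1) p.2).
Qed.

Lemma measurable_cons_cV k : measurable_fun setT (@cons_cV k).
Proof.
apply: measurable_fun_mxP => i j; rewrite ord1.
have [i' ->|->] := unliftP ord0 i.
  under eq_fun do rewrite cons_cVS.
  by apply: (measurableT_comp (measurable_mx_coord _ _)); exact: measurable_snd.
by under eq_fun do rewrite cons_cV0; exact: measurable_fst.
Qed.

Lemma transports_cons_cV k :
  transports (leb \x @lebd k)%E (@lebd k.+1) 1 (@cons_cV k).
Proof.
apply: transports_measure => //; first exact: measurable_cons_cV.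
move=> A mA; rewrite mul1e /= /product_measure1; apply: eq_integral => x _ /=.
congr (@lebesgue_Rd _ _ _); apply/seteqP; split => y /=.
  by move=> Ay; apply/xsectionP.
by move=> /xsectionP.
Qed.

Lemma measurable_mulmx m n (A : 'M[R]_(m, n)) :
  measurable_fun setT (fun u : 'cV[R]_n => A *m u).
Proof.
apply: measurable_fun_mxP => i j; under eq_fun do rewrite mxE.
apply: measurable_sum => l; apply: measurable_funM => //.
exact: measurable_mx_coord.
Qed.

Lemma measurable_cV_add d (Z : measurableType d) n (f g : Z -> 'cV[R]_n) :
  measurable_fun setT f -> measurable_fun setT g ->
  measurable_fun setT (fun z => f z + g z).
Proof.
move=> mf mg; apply: measurable_fun_mxP => i j; under eq_fun do rewrite mxE.
by apply: measurable_funD; exact: (measurableT_comp (measurable_mx_coord _ _)).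
Qed.

Lemma measurable_cV_scale d (Z : measurableType d) n (a : Z -> R) (f : Z -> 'cV[R]_n) :
  measurable_fun setT a -> measurable_fun setT f ->
  measurable_fun setT (fun z => a z *: f z).
Proof.
move=> ma mf; apply: measurable_fun_mxP => i j; under eq_fun do rewrite mxE.
by apply: measurable_funM => //; exact: (measurableT_comp (measurable_mx_coord _ _)).
Qed.

(** A translation moves the first coordinate and the remaining ones in
    succession. *)
Lemma transports_shift n (v : 'cV[R]_n) : transports (@lebd n) (@lebd n) 1 (fun u => u + v).
Proof.
elim: n v => [|n IH] v.
  apply: (eq_transports (erefl _) _ (transports_id _)) => u /=.
  by rewrite [RHS]flatmx0 [LHS]flatmx0.
pose v2 : 'cV[R]_n := \col_i v (lift ord0 i) ord0.
have T1 : transports (leb \x @lebd n)%E (leb \x @lebd n)%E 1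
    (fun p => (p.1, p.2 + v2)).
  apply: (@transports_fiber2 _ _ _ _ _ leb (@lebd n) 1 (fun=> fun y => y + v2)) => //.
  apply: measurable_cV_add => //; exact: measurable_snd.
have T2 : transports (leb \x @lebd n)%E (leb \x @lebd n)%E 1
    (fun p => (p.1 + v ord0 ord0, p.2)).
  apply: (@transports_fiber1 _ _ _ _ _ leb (@lebd n) 1 (fun=> fun x => x + v ord0 ord0)) => //.
    by apply: measurable_funD => //; exact: measurable_fst.
  move=> y; have := @transports_affine R 1 (v ord0 ord0) (oner_neq0 _).
  by apply: eq_transports; [rewrite normr1|move=> x; rewrite mul1r].
have := transports_comp T1 T2; rewrite mulr1 => T.
apply: (transports_conj (transports_cons_cV n) T).
  by apply: measurable_cV_add => //; exact: measurable_cst.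
move=> p; apply/colP => i; rewrite mxE.
have [i' ->|->] := unliftP ord0 i; first by rewrite !cons_cVS /= !mxE.
by rewrite !cons_cV0.
Qed.

Section step.
Variable k : nat.

Lemma block_cons_cV (a : R) (r : 'rV[R]_k) (c : 'cV[R]_k) (D : 'M[R]_k) p :
  (block_mx (a%:M : 'M[R]_1) r c D : 'M[R]_(1 + k)) *m (@cons_cV k p : 'cV[R]_(1 + k)) =
  @cons_cV k (a * p.1 + (r *m p.2) ord0 ord0, D *m p.2 + p.1 *: c) :> 'cV[R]_(1 + k).
Proof.
rewrite /cons_cV mul_block_col /= [_ *m _ + D *m _]addrC mul_mx_scalar.
congr col_mx; last by rewrite mul_mx_scalar.
by apply/matrixP => i j; rewrite !ord1 !mxE !mulr1n mulrC.
Qed.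

(** The remaining coordinates are translated by an amount that depends on the
    first coordinate only. *)
Lemma transports_lower (c : 'cV[R]_k) :
  transports (@lebd k.+1) (@lebd k.+1) 1
    (mulmx (block_mx (1%:M : 'M[R]_1) 0 c 1%:M : 'M[R]_(1 + k))).
Proof.
have mh : measurable_fun [set: measurableTypeR R * 'cV[R]_k] (fun p => p.2 + p.1 *: c).
  apply: measurable_cV_add; first exact: measurable_snd.
  apply: measurable_cV_scale; [exact: measurable_fst|exact: measurable_cst].
apply: (transports_conj (transports_cons_cV k)
  (@transports_fiber2 _ _ _ _ _ leb (@lebd k) 1 (fun x => fun y => y + x *: c) _ mh _)) => //.
- by move=> x; exact: transports_shift.
- exact: (@measurable_mulmx (1 + k) (1 + k)).
- by move=> p; rewrite block_cons_cV /= mul1r mul0mx mxE addr0 mul1mx.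
Qed.

(** The first coordinate is translated by an amount that depends on the
    remaining coordinates only. *)
Lemma transports_upper (r : 'rV[R]_k) :
  transports (@lebd k.+1) (@lebd k.+1) 1
    (mulmx (block_mx (1%:M : 'M[R]_1) r 0 1%:M : 'M[R]_(1 + k))).
Proof.
have mh : measurable_fun [set: measurableTypeR R * 'cV[R]_k]
    (fun p => p.1 + (r *m p.2) ord0 ord0).
  have m1 : measurable_fun [set: measurableTypeR R * 'cV[R]_k] (fun p => p.1 : R).
    exact: measurable_fst.
  apply: (measurable_funD m1).
  apply: (measurableT_comp (measurable_mx_coord _ _)).
  by apply: (measurableT_comp (measurable_mulmx _)); exact: measurable_snd.
apply: (transports_conj (transports_cons_cV k)
  (@transports_fiber1 _ _ _ _ _ leb (@lebd k) 1
     (fun y => fun x => x + (r *m y) ord0 ord0) _ mh _)) => //.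
- move=> y; have := @transports_affine R 1 ((r *m y) ord0 ord0) (oner_neq0 _).
  by apply: eq_transports; [rewrite normr1|move=> x; rewrite mul1r].
- exact: (@measurable_mulmx (1 + k) (1 + k)).
- by move=> p; rewrite block_cons_cV /= mul1r mul1mx scaler0 addr0.
Qed.

Lemma transports_diag (a : R) (D : 'M[R]_k) : a != 0 ->
  transports (@lebd k) (@lebd k) `|\det D| (mulmx D) ->
  transports (@lebd k.+1) (@lebd k.+1) `|a * \det D|
    (mulmx (block_mx (a%:M : 'M[R]_1) 0 0 D : 'M[R]_(1 + k))).
Proof.
move=> a0 HD; have [D0 _ _] := HD.
have T1 : transports (leb \x @lebd k)%E (leb \x @lebd k)%E `|\det D|
    (fun p => (p.1, D *m p.2)).
  apply: (@transports_fiber2 _ _ _ _ _ leb (@lebd k) _ (fun=> mulmx D)) => //.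
  by apply: (measurableT_comp (measurable_mulmx _)); exact: measurable_snd.
have T2 : transports (leb \x @lebd k)%E (leb \x @lebd k)%E `|a|
    (fun p => (a * p.1 + 0, p.2)).
  apply: (@transports_fiber1 _ _ _ _ _ leb (@lebd k) _ (fun=> fun x => a * x + 0)) => //.
  - by rewrite normr_gt0.
  - by apply: measurable_funD => //; apply: measurable_funM => //; exact: measurable_fst.
  - by move=> y; exact: transports_affine.
have := transports_comp T1 T2; rewrite -normrM => T.
apply: (transports_conj (transports_cons_cV k) T).
  exact: (@measurable_mulmx (1 + k) (1 + k)).
by move=> p; rewrite block_cons_cV /= mul0mx mxE scaler0 !addr0.
Qed.

End step.

Lemma transports_mulmx n (A B : 'M[R]_n) :
  transports (@lebd n) (@lebd n) `|\det A| (mulmx A) ->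
  transports (@lebd n) (@lebd n) `|\det B| (mulmx B) ->
  transports (@lebd n) (@lebd n) `|\det (A *m B)| (mulmx (A *m B)).
Proof.
move=> TA TB; apply: eq_transports (transports_comp TB TA).
  by rewrite det_mulmx normrM.
by move=> u /=; rewrite mulmxA.
Qed.

(** Linear change of variables.  With a nonzero pivot, block elimination
    writes the matrix as (lower) * (diagonal) * (upper); the unipotent factors
    act by translations of the fibres.  An invertible matrix with zero pivot
    is brought to that case by adding a multiple of the other rows to the
    first one. *)
Lemma transports_linear n (A : 'M[R]_n) : A \in unitmx ->
  transports (@lebd n) (@lebd n) `|\det A| (mulmx A).
Proof.
elim: n A => [|n IH] A uA.
  rewrite det_mx00 normr1; apply: (eq_transports (erefl _) _ (transports_id _)) => u /=.
  by rewrite [RHS]flatmx0 [LHS]flatmx0.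
have lowdet (c : 'cV[R]_n) :
    \det (block_mx (1%:M : 'M[R]_1) 0 c 1%:M : 'M[R]_(1 + n)) = 1.
  by rewrite det_lblock !det1 mulr1.
have updet (r : 'rV[R]_n) :
    \det (block_mx (1%:M : 'M[R]_1) r 0 1%:M : 'M[R]_(1 + n)) = 1.
  by rewrite det_ublock !det1 mulr1.
have pivot (a : R) (r : 'rV[R]_n) (c : 'cV[R]_n) (D : 'M[R]_n) : a != 0 ->
    (block_mx (a%:M : 'M[R]_1) r c D : 'M[R]_(1 + n)) \in unitmx ->
    transports (@lebd n.+1) (@lebd n.+1)
      `|\det (block_mx (a%:M : 'M[R]_1) r c D : 'M[R]_(1 + n))|
      (mulmx (block_mx (a%:M : 'M[R]_1) r c D : 'M[R]_(1 + n))).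
  move=> a0; pose D' := D - a^-1 *: (c *m r).
  have E : (block_mx (a%:M : 'M[R]_1) r c D : 'M[R]_(1 + n)) =
    (block_mx (1%:M : 'M[R]_1) 0 (a^-1 *: c) 1%:M : 'M[R]_(1 + n)) *m
    ((block_mx (a%:M : 'M[R]_1) 0 0 D' : 'M[R]_(1 + n)) *m
    (block_mx (1%:M : 'M[R]_1) (a^-1 *: r) 0 1%:M : 'M[R]_(1 + n))).
    rewrite !mulmx_block !mul0mx !mulmx0 !mul1mx !mulmx1 !addr0 !add0r.
    rewrite !mul_scalar_mx mul_mx_scalar -!scalemxAl -!scalemxAr !scalerA.
    by rewrite !divff// mulr1 !scale1r /D' addrC subrK.
  rewrite E => u.
  have uD' : D' \in unitmx.
    move: u; rewrite !unitmx_mul => /and3P[_ + _].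
    by rewrite unitmxE det_ublock unitrM => /andP[].
  apply: transports_mulmx; first by rewrite lowdet normr1; exact: transports_lower.
  apply: transports_mulmx; last by rewrite updet normr1; exact: transports_upper.
  have dd : \det (block_mx (a%:M : 'M[R]_1) 0 0 D' : 'M[R]_(1 + n)) = a * \det D'.
    by rewrite det_ublock det_scalar1.
  apply: (eq_transports (congr1 Num.norm (esym dd)) (frefl _)).
  by apply: transports_diag => //; exact: IH.
have AE : A = block_mx ((A ord0 ord0)%:M : 'M[R]_1) (ursubmx (A : 'M[R]_(1 + n)))
    (dlsubmx (A : 'M[R]_(1 + n))) (drsubmx (A : 'M[R]_(1 + n))) :> 'M[R]_(1 + n).
  rewrite -[LHS](@submxK _ 1 n 1 n); congr block_mx.
  apply/matrixP => i j; rewrite !ord1 !mxE eqxx mulr1n.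
  by congr (A _ _); exact/val_inj.
have [a0|a0] := eqVneq (A ord0 ord0) 0; last first.
  by move: uA; rewrite AE; exact: pivot.
move: uA; rewrite AE a0; set r := ursubmx _; set c := dlsubmx _; set D := drsubmx _ => uA.
have [i ci] : exists i, c i ord0 != 0.
  apply: contrapT => /forallNP c0.
  have cz : c = 0 by apply/colP => i; rewrite [RHS]mxE; apply/eqP/negPn/negP; exact: c0.
  have dd : \det (block_mx (0%:M : 'M[R]_1) r 0 D : 'M[R]_(1 + n)) = 0.
    by rewrite det_ublock det_scalar1 mul0r.
  by move: uA; rewrite unitmxE cz dd unitr0.
pose s : 'rV[R]_n := delta_mx ord0 i.
pose U x := (block_mx (1%:M : 'M[R]_1) (x *: s) 0 1%:M : 'M[R]_(1 + n)).
have UU : U (-1) *m U 1 = 1%:M.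
  rewrite /U mulmx_block !mul0mx !mulmx0 !mul1mx !mulmx1 !addr0 !add0r.
  by rewrite scaleN1r scale1r subrr -scalar_mx_block.
have UA : U 1 *m block_mx (0%:M : 'M[R]_1) r c D =
    block_mx ((c i ord0)%:M : 'M[R]_1) (r + s *m D) c D.
  rewrite /U mulmx_block !mul0mx !mul1mx !add0r scale1r; congr block_mx.
  apply/matrixP => x y; rewrite !ord1 !mxE eqxx mul0rn add0r mulr1n.
  rewrite (bigD1 i)//= !mxE !eqxx mul1r big1 ?addr0// => j ji.
  by rewrite mxE (negbTE ji) andbF mul0r.
rewrite -[block_mx _ _ _ _]mul1mx -UU -mulmxA UA.
apply: transports_mulmx; first by rewrite updet normr1; exact: transports_upper.
apply: pivot => //; rewrite -UA unitmx_mul uA andbT unitmxE updet; exact: unitr1.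
Qed.

(** Fubini's theorem, one coordinate at a time. *)
Lemma cintegrable_prod_coord n (h : 'I_n -> R -> R[i]) :
  (forall i, cintegrable leb (h i)) ->
  cintegrable (@lebd n) (fun u => \prod_i h i (u i ord0)) /\
  cintegral (@lebd n) (fun u => \prod_i h i (u i ord0)) =
  \prod_i cintegral leb (h i).
Proof.
elim: n h => [|n IH] h ih.
  rewrite big_ord0; under eq_fun do rewrite big_ord0.
  split.
    split=> /=; apply/integrableP; split=> //; rewrite /= integral_dirac//;
      by rewrite diracT mul1e ltry.
  by apply: complex_ext => /=; rewrite /Rintegral integral_dirac// diracT mul1e.
have [iP eP] := IH (fun i => h (lift ord0 i)) (fun i => ih _).
have E p : \prod_(i < n.+1) h i (@cons_cV n p i ord0) =
    h ord0 p.1 * \prod_(i < n) h (lift ord0 i) (p.2 i ord0).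
  by rewrite big_ord_recl cons_cV0; congr (_ * _); apply: eq_bigr => i _; rewrite cons_cVS.
have T := transports_cons_cV n.
have iPn : cintegrable (leb \x @lebd n)%E
    (fun p => \prod_(i < n.+1) h i (@cons_cV n p i ord0)).
  by under eq_fun do rewrite E; exact: (cintegrable_prod (ih ord0) iP).
have mprod : cmeasurable (fun u : 'cV[R]_n.+1 => \prod_(i < n.+1) h i (u i ord0)).
  rewrite (_ : (fun _ => _) = \prod_(i < n.+1) (fun u : 'cV[R]_n.+1 => h i (u i ord0))).
    elim/big_ind : _ => [|f g mf mg|i _]; first exact: cmeasurable_cst.
      exact: cmeasurableM.
    apply: (cmeasurable_comp (measurable_mx_coord _ _)).
    exact: cintegrable_measurable (ih i).
  by apply/funext => u; rewrite fct_prodE.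
have iPn1 : cintegrable (@lebd n.+1) (fun u => \prod_i h i (u i ord0)).
  have [mr mi] := mprod; have [ir ii] := iPn; split.
    exact: (transports_integrableV T).
  exact: (transports_integrableV T).
split=> //.
rewrite (transports_cintegral T)// mul1r.
under [X in cintegral _ X]eq_fun do rewrite E.
by rewrite big_ord_recl -eP -(cintegral_prod (ih ord0) iP).
Qed.

End lebesgue_space.

(** * Explicit Fourier integrals on the line *)

Section one_dimensional_integrals.
Variable R : realType.
Local Notation leb := (@lebesgue_measure R : {sigma_finite_measure set (measurableTypeR R) -> \bar R}).

Lemma is_derive_continuous (f df : R -> R) :
  (forall x : R, is_derive x 1 f (df x)) -> continuous f.
Proof.
move=> D x; apply: differentiable_continuous; apply/derivable1_diffP.
by case: (D x).
Qed.

Lemma Rintegral_FTC (f F : R -> R) (a b : R) : a < b -> continuous f ->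
  (forall x : R, is_derive x 1 F (f x)) ->
  \int[leb]_(x in `[a, b]) f x = F b - F a.
Proof.
move=> ab cf dF.
have cF := is_derive_continuous dF.
rewrite /Rintegral (@continuous_FTC2 R f F a b ab).
- by rewrite -EFinB.
- exact: continuous_subspaceT.
- split.
  + by move=> x _; case: (dF x).
  + exact: cvg_at_right_filter (cF a).
  + exact: cvg_at_left_filter (cF b).
- by move=> x _; rewrite derive1E; case: (dF x).
Qed.

Lemma sin_int_pi (k : int) : sin (k%:~R * pi) = 0 :> R.
Proof.
have sn n : sin (n%:R * pi) = 0 :> R.
  elim: n => [|n IH]; first by rewrite mul0r sin0.
  by rewrite -natr1 mulrDl mul1r sinDpi IH oppr0.
by case: k => n; rewrite ?NegzE ?mulrNz -?pmulrn ?mulNr ?sinN sn ?oppr0.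
Qed.

Lemma Rintegral_indicM (A : set R) (f : R -> R) : 
  \int[leb]_x (\1_A x * f x) = \int[leb]_(x in A) f x.
Proof.
rewrite [RHS]Rintegral_mkcond; apply: eq_Rintegral => x _.
by rewrite indicE /patch; case: ifP => _; rewrite ?mul1r ?mul0r.
Qed.

Lemma is_derive_mulr (k x : R) : is_derive x 1 (fun s : R => s * k) k.
Proof.
have H := is_deriveM (is_derive_id x (1 : R)) (is_derive_cst k x (1 : R)).
by apply: (is_derive_eq H); rewrite /= scaler0 add0r /GRing.scale/= mulr1.
Qed.

Lemma is_derive_sin_mulr (k x : R) :
  is_derive x 1 (fun s : R => sin (s * k)) (cos (x * k) * k).
Proof.
exact: (@is_derive1_comp R (@sin R) (fun s => s * k) x _ _
  (is_derive_sin (x * k)) (is_derive_mulr k x)).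
Qed.

Lemma is_derive_cos_mulr (k x : R) :
  is_derive x 1 (fun s : R => cos (s * k)) (- sin (x * k) * k).
Proof.
exact: (@is_derive1_comp R (@cos R) (fun s => s * k) x _ _
  (is_derive_cos (x * k)) (is_derive_mulr k x)).
Qed.

Lemma cintegral_character (k : int) :
  cintegral leb (fun s : R => (\1_(`[- pi, pi] : set R) s)%:C%C * expi (s * k%:~R)) =
  (if k == 0 then 2 * pi else 0)%:C%C.
Proof.
have pipi : - pi < pi :> R by rewrite -subr_gt0 opprK addr_gt0 ?pi_gt0.
apply: complex_ext => /=.
- under eq_Rintegral do rewrite mul0r subr0.
  rewrite Rintegral_indicM; have [->|k0] := eqVneq k 0.
    under eq_Rintegral do rewrite mulr0 cos0.
    rewrite (@Rintegral_FTC _ id)//; first by rewrite opprK mulrDl mul1r.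
    exact: cst_continuous.
  have k0' : k%:~R != 0 :> R by rewrite intr_eq0.
  have D (x : R) : is_derive x 1 (fun s => k%:~R^-1 * sin (s * k%:~R)) (cos (x * k%:~R)).
    apply: (is_derive_eq (is_deriveZ (k%:~R^-1) (is_derive_sin_mulr k%:~R x))).
    by rewrite /GRing.scale/= mulrCA mulVf// mulr1.
  have C := is_derive_continuous (is_derive_cos_mulr k%:~R).
  by rewrite (Rintegral_FTC pipi C D) mulNr sinN !(mulrC pi) !sin_int_pi oppr0 subrr.
- under eq_Rintegral do rewrite mul0r addr0.
  rewrite Rintegral_indicM; have [->|k0] := eqVneq k 0.
    under eq_Rintegral do rewrite mulr0 sin0.
    by rewrite Rintegral_cst//= mul0r.
  have k0' : k%:~R != 0 :> R by rewrite intr_eq0.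
  have D (x : R) : is_derive x 1 (fun s => - k%:~R^-1 * cos (s * k%:~R)) (sin (x * k%:~R)).
    apply: (is_derive_eq (is_deriveZ (- k%:~R^-1) (is_derive_cos_mulr k%:~R x))).
    by rewrite /GRing.scale/= mulNr mulNr mulrN opprK mulrCA mulVf// mulr1.
  have C := is_derive_continuous (is_derive_sin_mulr k%:~R).
  by rewrite (Rintegral_FTC pipi C D) !mulNr cosN subrr.
Qed.

Lemma ge0_Rintegral_half_line (f F : R -> R) (l : R) :
  (forall x, 0 <= f x) -> continuous f -> f =1 f \o -%R ->
  (forall x : R, 0 <= x -> is_derive x 1 F (f x)) -> F x @[x --> +oo] --> l ->
  leb.-integrable setT (EFin \o f) /\ \int[leb]_x f x = 2 * (l - F 0).
Proof.
move=> f0 cf ev dF Fl.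
have E : (\int[leb]_x (f x)%:E = (2 * (l - F 0))%:E)%E.
  rewrite ge0_symfun_integralT// -set_itvcy (@ge0_continuous_FTC2y R f F 0 l)//.
  - by apply: continuous_subspaceT.
  - by move=> x x0; case: (dF x (ltW x0)).
  - apply: cvg_at_right_filter; apply: differentiable_continuous.
    by apply/derivable1_diffP; case: (dF 0 (lexx _)).
  - by move=> x; rewrite in_itv/= andbT => x0; rewrite derive1E; case: (dF x (ltW x0)).
split; last by rewrite /Rintegral E.
apply/integrableP; split.
  by apply/measurable_EFinP; exact: continuous_measurable_fun.
by under eq_integral do rewrite /= ger0_norm//; rewrite E ltry.
Qed.

(** The primitive [2 * atan] has the limit [pi] at infinity, and the integrand is
    even. *)
Lemma integral_cauchy :
  leb.-integrable setT (EFin \o (fun x : R => 2 * (1 + x ^+ 2)^-1)) /\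
  \int[leb]_x (2 * (1 + x ^+ 2)^-1) = 2 * pi.
Proof.
have pos (x : R) : 0 < 1 + x ^+ 2 by rewrite ltr_pwDl// sqr_ge0.
have H := @ge0_Rintegral_half_line (fun x => 2 * (1 + x ^+ 2)^-1) (fun x => 2 * atan x)
  (2 * (pi / 2)).
have e : 2 * (2 * (pi / 2) - 2 * atan 0) = 2 * pi :> R by rewrite atan0; field.
rewrite -e; apply: H.
- by move=> x; rewrite divr_ge0// ltW.
- by move=> x; apply: cvgM; [exact: cvg_cst|exact: continuous_oneDsqrV].
- by move=> x /=; rewrite sqrrN.

- by apply: cvgM; [exact: cvg_cst|exact: cvgy_atan].
Qed.

Section laplace.
Variable y : R.

Let posy : 0 < 1 + y ^+ 2. Proof. by rewrite ltr_pwDl// sqr_ge0. Qed.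

Let is_derive_expN (x : R) : is_derive x 1 (fun s : R => expR (- s)) (- expR (- x)).
Proof.
have H := is_derive1_comp (is_derive_expR (- x)) (is_deriveNid x (1 : R)).
by apply: (is_derive_eq H); rewrite mulrN mulr1.
Qed.

Let primitive (x : R) := - expR (- x) +
  (1 + y ^+ 2)^-1 * (expR (- x) * (y * sin (x * y) - cos (x * y))).

Let is_derive_primitive (x : R) :
  is_derive x 1 primitive (expR (- x) * (1 + cos (x * y))).
Proof.
have H1 := is_deriveB (is_deriveZ y (is_derive_sin_mulr y x)) (is_derive_cos_mulr y x).
have H2 := is_deriveD (is_deriveN (is_derive_expN x))
  (is_deriveZ ((1 + y ^+ 2)^-1) (is_deriveM (is_derive_expN x) H1)).
apply: (is_derive_eq H2); rewrite !fctE /GRing.scale/=.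
rewrite (_ : y *: sin (x * y) = y * sin (x * y))//.
by field; rewrite gt_eqF.
Qed.

Let cvg_primitive : primitive x @[x --> +oo] --> 0.
Proof.
apply/cvgr0Pnorm_le => e e0.
have c : 0 < 2 + `|y| by rewrite ltr_pwDl.
have := @cvgr_expR R; move=> /cvgr0Pnorm_le /(_ (e / (2 + `|y|))).
rewrite divr_gt0// => /(_ isT); apply: filterS => x.
rewrite ger0_norm ?expR_ge0// ler_pdivlMr// => H.
apply: le_trans H; rewrite /primitive (le_trans (ler_normD _ _))// normrN !normrM.
rewrite (ger0_norm (expR_ge0 _)) [leRHS]mulrDr mulr2n mulrDr mulr1 -addrA lerD2l.
rewrite mulrCA -[X in _ <= X + _]mulr1 -mulrDr ler_wpM2l ?expR_ge0//.
apply: (@le_trans _ _ (1 * (`|y| + 1))); last by rewrite mul1r addrC.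
apply: ler_pM => //.
  by rewrite normfV gtr0_norm// invf_le1// lerDl sqr_ge0.
rewrite (le_trans (ler_normB _ _))// lerD//; last first.
  by rewrite ler_norml cos_geN1 cos_le1.
by rewrite normrM ler_piMr// ler_norml sin_geN1 sin_le1.
Qed.

(** The summand 1 makes the integrand nonnegative, so that an improper integral
    can be evaluated by a primitive without a prior proof of integrability. *)
Lemma integral_exp_norm_cos :
  leb.-integrable setT (EFin \o (fun x : R => expR (- `|x|) * (1 + cos (x * y)))) /\
  \int[leb]_x (expR (- `|x|) * (1 + cos (x * y))) = 2 * (1 + (1 + y ^+ 2)^-1).
Proof.
have -> : 2 * (1 + (1 + y ^+ 2)^-1) = 2 * (0 - primitive 0).
  rewrite /primitive oppr0 expR0 mul0r sin0 cos0; field; by rewrite gt_eqF.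
apply: ge0_Rintegral_half_line cvg_primitive.
- by move=> x; rewrite mulr_ge0 ?expR_ge0// -lerBlDl sub0r cos_geN1.
- move=> x; apply: cvgM.
    apply: (@continuous_comp _ _ _ (fun x : R => - `|x|) expR); last exact: continuous_expR.
    by apply: cvgN; exact: norm_continuous.
  by apply: cvgD; [exact: cvg_cst|exact: (is_derive_continuous (is_derive_cos_mulr y))].
- by move=> x /=; rewrite normrN mulNr cosN.
- by move=> x x0; rewrite ger0_norm//; exact: is_derive_primitive.
Qed.

End laplace.

Lemma integral_exp_norm :
  leb.-integrable setT (EFin \o (fun x : R => expR (- `|x|))) /\
  \int[leb]_x expR (- `|x|) = 2.
Proof.
have [i e] := integral_exp_norm_cos 0.
have E : (fun x : R => expR (- `|x|)) = (fun x => 2^-1 * (expR (- `|x|) * (1 + cos (x * 0)))).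
  by apply/funext => x; rewrite mulr0 cos0; field.
have i' : leb.-integrable setT (EFin \o (fun x : R => expR (- `|x|))).
  rewrite E; under [EFin \o _]eq_fun do rewrite /= EFinM.
  exact: (integrableZl measurableT _ i).
split => //.
by rewrite E RintegralZl// e expr0n addr0 invr1; field.
Qed.

(** The real part is the difference of the two preceding integrals; the
    imaginary part is the integral of an odd function. *)
Lemma cintegral_laplace (y : R) :
  cintegrable leb (fun u : R => (expR (- `|u|))%:C%C * expi (u * y)) /\
  cintegral leb (fun u : R => (expR (- `|u|))%:C%C * expi (u * y)) =
  (2 * (1 + y ^+ 2)^-1)%:C%C.
Proof.
have [i0 e0] := integral_exp_norm.
have mexp : measurable_fun setT (fun x : R => expR (- `|x|)).
  by have /measurable_EFinP := measurable_int _ i0.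
have ci : cintegrable leb (fun u : R => (expR (- `|u|))%:C%C * expi (u * y)).
  apply: cintegrable_dominated i0 _.
    apply: cmeasurableM; first exact: cmeasurable_real.
    by apply: cmeasurable_expi; apply: measurable_funM.
  by move=> u; rewrite rnormM rnorm_real rnorm_expi mulr1 ger0_norm// expR_ge0.
split=> //; have [ri ii] := ci.
have [i1 e1] := integral_exp_norm_cos y.
apply: complex_ext => /=.
- have -> : 2 * (1 + y ^+ 2)^-1 = 2 * (1 + (1 + y ^+ 2)^-1) - 2 by ring.
  rewrite -e1 -[X in _ - X]e0 -RintegralB//.
  by apply: eq_Rintegral => x _; rewrite mul0r; ring.
- have := transports_Rintegral (@transports_affine R (-1) 0 _) ii.
  rewrite oppr_eq0 oner_neq0 => /(_ isT); rewrite normrN1 mul1r /=.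
  set I := (X in X = _) => H.
  have {H} : I = - I.
    rewrite {1}H -[RHS]mulN1r -RintegralZl//; apply: eq_Rintegral => x _ /=.
    by rewrite addr0 mulN1r normrN mulNr sinN cosN; ring.
  by move/eqP; rewrite -subr_eq0 opprK -mulr2n mulrn_eq0 /= => /eqP.
Qed.

End one_dimensional_integrals.

(** * Countable valued maps, continuous functions and densities *)

Section measurability.
Context (R : realType).

Lemma measurable_fun_Zd dX (X : measurableType dX) d (f : X -> Zd d) :
  (forall l, measurable (f @^-1` [set l])) -> measurable_fun setT f.
Proof.
move=> mf _ B _; rewrite setTI.
have -> : f @^-1` B = \bigcup_(l : Zd d) (if l \in B then f @^-1` [set l] else set0).
  apply/seteqP; split => x /=.
    by move=> Bfx; exists (f x) => //; rewrite mem_set.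
  by move=> [l _]; case: ifPn => // /set_mem Bl /= ->.
apply: countable_bigcupT_measurable; first exact: countableP.
by move=> l; case: ifP.
Qed.

Lemma measurable_forall_ord dX (X : measurableType dX) d (A : 'I_d -> set X) :
  (forall i, measurable (A i)) -> measurable [set y | forall i, A i y].
Proof.
move=> mA; have -> : [set y | forall i, A i y] = \bigcap_(i in [set: 'I_d]) A i.
  by apply/seteqP; split => [y H i _|y H i] //=; exact: H.
by apply: fin_bigcap_measurable => //; exact: finite_finset.
Qed.

Lemma measurable_Zd_preimage dX (X : measurableType dX) d (f : X -> Zd d) (A : set (Zd d)) :
  measurable_fun setT f -> measurable (f @^-1` A).
Proof. by move=> mf; rewrite -[X in measurable X]setTI; exact: mf. Qed.

Lemma cvg_mx (T : Type) (F : set_system T) (FF : Filter F) m n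
    (u : T -> 'M[R]_(m, n)) (M : 'M[R]_(m, n)) :
  (forall i j, u x i j @[x --> F] --> M i j) -> u @ F --> M.
Proof.
move=> H A [P MP sPA]; rewrite /nbhs/=.
have : \forall x \near F, forall i j, P i j (u x i j).
  by apply: filter_forall => i; apply: filter_forall => j; exact: (H i j).
by apply: filterS => x Px; exact: sPA.
Qed.

(** A continuous function is the limit of the functions obtained by rounding
    the coordinates to multiples of [1 / n.+1], which take countably many values. *)
Lemma continuous_measurable_cV d (F : 'cV[R]_d -> R) : continuous F ->
  measurable_fun setT F.
Proof.
move=> cF.
pose fl n (y : 'cV[R]_d) : Zd d := \col_i Num.floor (n.+1%:R * y i ord0).
pose G n (l : Zd d) : R := F (\col_i (((l : 'cV[int]_d) i ord0)%:~R / n.+1%:R)).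
have mfl n : measurable_fun setT (fl n).
  apply: measurable_fun_Zd => l.
  have -> : fl n @^-1` [set l] = [set y | forall i,
      [set y : 'cV[R]_d | (n.+1%:R * y i ord0) \in
        `[((l : 'cV[int]_d) i ord0)%:~R, (((l : 'cV[int]_d) i ord0) + 1)%:~R[] y].
    apply/seteqP; split => y /=.
      by move=> <- i; rewrite in_itv/= mxE floor_itv.
    move=> H; apply/colP => i; rewrite mxE; apply: floor_def.
    by have := H i; rewrite in_itv.
  apply: measurable_forall_ord => i.
  have mc : measurable_fun setT (fun y : 'cV[R]_d => n.+1%:R * y i ord0).
    by apply: measurable_funM => //; exact: measurable_mx_coord.
  rewrite -[X in measurable X]setTI; apply: (mc measurableT _ (measurable_itv _)).
apply: (measurable_fun_cvg (h := fun n y => G n (fl n y))) => //.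
  move=> n; apply: measurableT_comp => //.
move=> y _; pose U n : 'cV[R]_d := \col_i (((fl n y : 'cV[int]_d) i ord0)%:~R / n.+1%:R).
suff cU : U n @[n --> \oo] --> y by exact: (cvg_comp U F cU (cF y)).
apply: cvg_mx => i j; rewrite ord1.
apply/cvgrPdist_le => e e0; near=> n.
rewrite !mxE; have n0 : 0 < n.+1%:R :> R by [].
rewrite -[y i ord0](@mulKf _ n.+1%:R) ?gt_eqF//.
rewrite [_^-1 * _]mulrC -mulrBl normrM (@gtr0_norm _ n.+1%:R^-1)// ?invr_gt0//.
have -> : n.+1%:R * y i ord0 / n.+1%:R = y i ord0.
  by rewrite mulrAC divff ?gt_eqF// mul1r.
have /andP[f1 f2] := floor_itv (n.+1%:R * y i ord0).
apply: (@le_trans _ _ (1 * n.+1%:R^-1)).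
  rewrite ler_wpM2r ?invr_ge0// ger0_norm ?subr_ge0// lerBlDl.
  by move: f2; rewrite intrD => /ltW.
by rewrite mul1r; apply: ltW; near: n; exact: (near_infty_natSinv_lt (PosNum e0)).
Unshelve. all: by end_near. Qed.

End measurability.

Section density.
Context (R : realType) dX (X : measurableType dX).
Variables (nu : {finite_measure set X -> \bar R}).
Variables (m : {sigma_finite_measure set X -> \bar R}) (F : X -> R).
Hypotheses (mF : measurable_fun setT F) (F0 : forall x, 0 <= F x).
Hypothesis H : forall A, measurable A -> nu A = (\int[m]_(x in A) (F x)%:E)%E.

Lemma density_integrable : m.-integrable setT (EFin \o F).
Proof.
apply/integrableP; split; first exact/measurable_EFinP.
under eq_integral do rewrite /= ger0_norm//.
by rewrite -H// -ge0_fin_numE// fin_num_measure.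
Qed.

(** The density agrees almost everywhere with the Radon-Nikodym derivative, and
    the change of variables is known for the latter. *)
Lemma density_change (f : X -> R) : nu.-integrable setT (EFin \o f) ->
  \int[nu]_x f x = \int[m]_x (f x * F x).
Proof.
move=> intf.
have num : nu `<< m.
  apply/null_content_dominatesP => A mA A0; rewrite H// null_set_integral//.
  by apply/measurable_EFinP; exact: measurable_funTS.
have mf := measurable_int _ intf.
have ae : ae_eq m setT (Radon_Nikodym (charge_of_finite_measure nu) m) (EFin \o F).
  apply: integral_ae_eq => //.
  - exact: Radon_Nikodym_integrable.
  - exact/measurable_EFinP.
  - by move=> E _ mE; rewrite -Radon_Nikodym_integral//; exact: H.
rewrite /Rintegral -(Radon_Nikodym_change_of_variables num)//; congr fine.
apply: ae_eq_integral => //.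

- exact: emeasurable_funM.
- by apply/measurable_EFinP; apply: measurable_funM => //; exact/measurable_EFinP.
- by apply: filterS ae => x /= E xT; rewrite E// EFinM.
Qed.

End density.

(** * Fourier inversion at the origin *)

Lemma le_cvg0 (R : realType) (c : R) (u : nat -> R) :
  (forall n, c <= u n) -> u n @[n --> \oo] --> 0 -> c <= 0.
Proof.
move=> cu u0; rewrite -(cvg_lim (@Rhausdorff R) u0).
apply: limr_ge; first by apply/cvg_ex; exists 0.
by apply: nearW => n; exact: cu.
Qed.

Lemma cvg_bigprod (R : realType) (I : Type) (s : seq I) (f : I -> nat -> R) (l : I -> R) :
  (forall i, f i n @[n --> \oo] --> l i) ->
  \prod_(i <- s) f i n @[n --> \oo] --> \prod_(i <- s) l i.
Proof.
move=> fl; elim: s => [|i s IH].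
  rewrite big_nil (_ : (fun n => _) = cst 1); first exact: cvg_cst.
  by apply/funext => n; rewrite big_nil.
rewrite big_cons (_ : (fun n => _) = (fun n => f i n * \prod_(j <- s) f j n)).
  exact: cvgM.
by apply/funext => n; rewrite big_cons.
Qed.

Section dot_product.
Context (R : realType) (d : nat).
Implicit Types (u v w z : 'cV[R]_d).

Lemma dotZl c u v : dot (c *: u) v = c * dot u v.
Proof. by rewrite /dot mulr_sumr; apply: eq_bigr => i _; rewrite mxE mulrA. Qed.

Lemma dotZr c u v : dot u (c *: v) = c * dot u v.
Proof. by rewrite /dot mulr_sumr; apply: eq_bigr => i _; rewrite mxE mulrCA. Qed.

Lemma dotDr u v w : dot u (v + w) = dot u v + dot u w.
Proof. by rewrite /dot -big_split; apply: eq_bigr => i _; rewrite mxE mulrDr. Qed.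

Lemma dotNr u v : dot u (- v) = - dot u v.
Proof. by rewrite -scaleN1r dotZr mulN1r. Qed.

Lemma dot0r u : dot u 0 = 0.
Proof. by rewrite /dot big1// => i _; rewrite mxE mulr0. Qed.

Lemma measurable_dot dX (X : measurableType dX) (f g : X -> 'cV[R]_d) :
  measurable_fun setT f -> measurable_fun setT g ->
  measurable_fun setT (fun x => dot (f x) (g x)).
Proof.
move=> mf mg; apply: measurable_sum => i.
by apply: measurable_funM; exact: (measurableT_comp (measurable_mx_coord _ _)).
Qed.

Lemma cmeasurable_character z : cmeasurable (fun u : 'cV[R]_d => expi (- dot u z)).
Proof.
apply: cmeasurable_expi; apply: measurableT_comp => //.
by apply: measurable_dot => //; exact: measurable_cst.
Qed.

End dot_product.

Section fourier_inversion.
Context (R : realType) (d : nat).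
Local Notation lebd := (@lebesgue_Rd R d).
Local Notation leb := (@lebesgue_measure R : {sigma_finite_measure set (measurableTypeR R) -> \bar R}).

Lemma transports_scale (c : R) : c != 0 ->
  transports lebd lebd `|c ^+ d| (fun u => c *: u).
Proof.
move=> c0; have := @transports_linear R d c%:M.
rewrite unitmxE det_scalar unitfE expf_neq0// => /(_ isT).
by apply: eq_transports => // u; rewrite mul_scalar_mx.
Qed.

(** A summability kernel for Fourier inversion and its Fourier transform: both
    are nonnegative and integrable, and both factor over the coordinates. *)
Definition laplace_Rd (u : 'cV[R]_d) : R := \prod_i expR (- `|u i ord0|).
Definition cauchy_Rd (y : 'cV[R]_d) : R := \prod_i (2 * (1 + y i ord0 ^+ 2)^-1).

Lemma laplace_Rd_fourier (y : 'cV[R]_d) :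
  cintegrable lebd (fun u => (laplace_Rd u)%:C%C * expi (dot u y)) /\
  cintegral lebd (fun u => (laplace_Rd u)%:C%C * expi (dot u y)) =
  (cauchy_Rd y)%:C%C.
Proof.
pose h (i : 'I_d) (s : R) : R[i] := (expR (- `|s|))%:C%C * expi (s * y i ord0).
have [] := @cintegrable_prod_coord R d h (fun i => (cintegral_laplace (y i ord0)).1).
have -> : (fun u : 'cV[R]_d => \prod_i h i (u i ord0)) =
    (fun u => (laplace_Rd u)%:C%C * expi (dot u y)).
  by apply/funext => u; rewrite /h big_split/= -expi_sum rmorph_prod.
move=> ih ->; split=> //; rewrite /cauchy_Rd rmorph_prod; apply: eq_bigr => i _.
by rewrite (cintegral_laplace (y i ord0)).2.
Qed.

Lemma laplace_Rd_ge0 u : 0 <= laplace_Rd u.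
Proof. by apply: prodr_ge0 => i _; exact: expR_ge0. Qed.

Lemma laplace_Rd_le1 u : laplace_Rd u <= 1.
Proof.
by apply: prodr_ile1 => i _; rewrite expR_ge0 expR_le1 oppr_le0 normr_ge0.
Qed.

Lemma measurable_laplace_Rd : measurable_fun setT laplace_Rd.
Proof.
apply: measurable_prod => i _; apply: measurableT_comp => //.
by apply: measurableT_comp => //; apply: measurableT_comp => //; exact: measurable_mx_coord.
Qed.

Lemma laplace_Rd_integrable : lebd.-integrable setT (EFin \o laplace_Rd).
Proof.
have [/integrable_rnorm + _] := laplace_Rd_fourier 0.
under [X in _ (EFin \o X)]eq_fun do
  rewrite rnormM rnorm_real rnorm_expi mulr1 ger0_norm ?laplace_Rd_ge0//.
by [].
Qed.

Lemma cauchy_Rd_ge0 y : 0 <= cauchy_Rd y.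
Proof.
by apply: prodr_ge0 => i _; rewrite mulr_ge0// invr_ge0 addr_ge0// sqr_ge0.
Qed.

Lemma cauchy_Rd_le y : cauchy_Rd y <= 2 ^+ d.
Proof.
rewrite -[d in leRHS]card_ord -prodr_const; apply: ler_prod => i _.
rewrite mulr_ge0 ?invr_ge0 ?addr_ge0 ?sqr_ge0//=.
by rewrite ler_piMr// invf_le1 ?lerDl ?sqr_ge0// ltr_pwDl ?sqr_ge0.
Qed.

Lemma measurable_cauchy_Rd : measurable_fun setT cauchy_Rd.
Proof.
apply: measurable_prod => i _; apply: measurable_funM => //.
apply: (measurableT_comp (f := fun s : R => (1 + s ^+ 2)^-1)); last exact: measurable_mx_coord.
by apply: continuous_measurable_fun; exact: continuous_oneDsqrV.
Qed.

Lemma cauchy_Rd_integral : lebd.-integrable setT (EFin \o cauchy_Rd) /\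
  \int[lebd]_y cauchy_Rd y = (2 * pi) ^+ d.
Proof.
have [ic ec] := integral_cauchy R.
pose h (i : 'I_d) (s : R) : R[i] := (2 * (1 + s ^+ 2)^-1)%:C%C.
have ih i : cintegrable leb (h i).
  by split => //=; exact: integrable0.
have [] := @cintegrable_prod_coord R d h ih.
have -> : (fun u : 'cV[R]_d => \prod_i h i (u i ord0)) =
    (fun u => (cauchy_Rd u)%:C%C).
  by apply/funext => u; rewrite /h -rmorph_prod.
move=> [i1 _] e; split=> //.
have -> : \int[lebd]_y cauchy_Rd y = complex.Re (cintegral lebd (fun u => (cauchy_Rd u)%:C%C)) by [].
rewrite e (_ : \prod_i _ = ((2 * pi) ^+ d)%:C%C)//.
rewrite -[in RHS](card_ord d) -prodr_const rmorph_prod; apply: eq_bigr => i _.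
by apply: complex_ext; rewrite /= ?ec// /Rintegral integral0.
Qed.

Context dO (Omega : measurableType dO) (Q : probability Omega R).
Variables (Y : {mfun Omega >-> 'cV[R]_d}) (a : 'cV[R]_d -> R[i]) (Phi : 'cV[R]_d -> R).
Hypothesis charfun_a : forall u, cintegral Q (fun w => expi (dot u (Y w))) = a u.
Hypothesis integrable_a : cintegrable lebd a.
Hypothesis Phi_continuous : continuous Phi.
Hypothesis Phi_ge0 : forall y, 0 <= Phi y.
Hypothesis Phi_density : forall A, measurable A ->
    distribution Q Y A = (\int[lebd]_(y in A) (Phi y)%:E)%E.

Let mPhi : measurable_fun setT Phi.
Proof. exact: continuous_measurable_cV. Qed.

Section kernel.
Variables (e : R) (z : 'cV[R]_d).
Hypothesis e_gt0 : 0 < e.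

Let k (y : 'cV[R]_d) : R := cauchy_Rd (e^-1 *: (y - z)).

Let mk : measurable_fun setT k.
Proof.
apply: (measurableT_comp measurable_cauchy_Rd).
apply: measurable_cV_scale => //.
by apply: measurable_cV_add => //; exact: measurable_cst.
Qed.

Let kK y : `|k y| <= 2 ^+ d.
Proof. by rewrite ger0_norm ?cauchy_Rd_ge0// cauchy_Rd_le. Qed.

Let kernel_density :
  \int[Q]_w k (Y w) = `|e ^+ d| * \int[lebd]_y (Phi (e *: y + z) * cauchy_Rd y).
Proof.
have ik : (distribution Q Y).-integrable setT (EFin \o k).
  apply: (@integrable_dominated _ _ _ _ (cst (2 ^+ d))) => //.
  exact: finite_measure_integrable_cst.
have ikY : Q.-integrable setT (EFin \o k \o Y).
  apply: (@integrable_dominated _ _ _ _ (cst (2 ^+ d)) (k \o Y)) => //.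
  - exact: measurableT_comp.
  - exact: finite_measure_integrable_cst.
  - by move=> w; exact: kK.
have -> : \int[Q]_w k (Y w) = \int[distribution Q Y]_y k y.
  by rewrite /Rintegral integral_distribution//; exact/measurable_EFinP.
rewrite (density_change (m := lebd) mPhi Phi_density ik).
have iPhi := density_integrable mPhi Phi_ge0 Phi_density.
have T := transports_comp (transports_scale (lt0r_neq0 e_gt0)) (transports_shift z).
rewrite mul1r in T.
rewrite (transports_Rintegral T (f := fun y => k y * Phi y)).
  congr (_ * _); apply: eq_Rintegral => y _ /=.
  by rewrite /k addrK scalerA mulVf ?gt_eqF// scale1r mulrC.
apply: (@integrable_dominated _ _ _ _ (fun y => 2 ^+ d * Phi y)).
- exact: measurable_funM.
- exact: integrable_scaled.
- by move=> y; rewrite normrM (ger0_norm (Phi_ge0 y)) ler_wpM2r.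
Qed.

(** Fubini's theorem moves the Fourier transform from the law of [Y] to the
    kernel. *)
Lemma kernel_parseval :
  (\int[lebd]_y (Phi (e *: y + z) * cauchy_Rd y))%:C%C =
  cintegral lebd (fun u => (laplace_Rd (e *: u))%:C%C * expi (- dot u z) * a u).
Proof.
have e0 : e != 0 by rewrite gt_eqF.
pose F (u : 'cV[R]_d) : R[i] := (laplace_Rd (e *: u))%:C%C * expi (- dot u z) * a u.
have mF0 : cmeasurable (fun u : 'cV[R]_d => (laplace_Rd (e *: u))%:C%C * expi (- dot u z)).
  apply: cmeasurableM.
    apply: cmeasurable_real; apply: (measurableT_comp measurable_laplace_Rd).
    by apply: measurable_cV_scale.
  exact: cmeasurable_character.
have iF : cintegrable lebd F.
  apply: (@cintegrable_bounded_mul _ _ _ _ _ _ 1) => // u.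
  by rewrite rnormM rnorm_expi rnorm_real mulr1 ger0_norm ?laplace_Rd_ge0 ?laplace_Rd_le1.
have einv0 : e^-1 != 0 by rewrite invr_eq0.
rewrite -/F (transports_cintegral (transports_scale einv0) iF).
pose G (p : 'cV[R]_d * Omega) : R[i] :=
  (laplace_Rd p.1)%:C%C * expi (dot p.1 (e^-1 *: (Y p.2 - z))).
have mYz : measurable_fun setT (fun w => e^-1 *: (Y w - z)).
  by apply: measurable_cV_scale => //; apply: measurable_cV_add => //; exact: measurable_cst.
have iG : cintegrable (lebd \x Q)%E G.
  apply: cintegrable_prodP.
    apply: cmeasurableM.
      apply: cmeasurable_real; apply: (measurableT_comp measurable_laplace_Rd).
      exact: measurable_fst.
    apply: cmeasurable_expi; apply: measurable_dot; first exact: measurable_fst.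
    exact: (measurableT_comp mYz measurable_snd).
  rewrite (eq_integral (fun u => `|(laplace_Rd u)%:E|%E)); last first.
    move=> u _; under eq_integral do rewrite rnormM rnorm_expi mulr1 rnorm_real/=.
    by rewrite integral_cst// [X in (_ * X)%E]probability_setT mule1.
  by have /integrableP[] := laplace_Rd_integrable.
have -> : cintegral lebd (fun u => F (e^-1 *: u)) = cintegral (lebd \x Q)%E G.
  rewrite (cfubini1 iG); congr cintegral; apply/funext => u.
  rewrite /F scalerA divff// scale1r -charfun_a -cintegralZ; last first.
    apply: (cintegrable_dominated (h := cst 1)).
    - by apply: cmeasurable_expi; apply: measurable_dot => //; exact: measurable_cst.
    - exact: finite_measure_integrable_cst.
    - by move=> w; rewrite rnorm_expi.
  congr cintegral; apply/funext => w.
  by rewrite /G /= -mulrA -expiD !dotZl dotZr dotDr dotNr mulrDr mulrN addrC.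
rewrite (cfubini2 iG).
have -> : (fun w => cintegral lebd (fun u => G (u, w))) = (fun w => (k (Y w))%:C%C).
  by apply/funext => w; rewrite /G /= (laplace_Rd_fourier _).2.
have -> : cintegral Q (fun w => (k (Y w))%:C%C) = (\int[Q]_w k (Y w))%:C%C.
  by apply: complex_ext => //=; rewrite /Rintegral integral0.
rewrite kernel_density -rmorphM /= mulrA -normrM -exprMn mulVf//.
by rewrite expr1n normr1 mul1r.
Qed.

End kernel.

Let eps n : R := n.+1%:R^-1.
Let eps_gt0 n : 0 < eps n. Proof. by rewrite invr_gt0. Qed.
Let eps_cvg : eps n @[n --> \oo] --> 0. Proof. exact: cvg_harmonic. Qed.

Let cvg_affine (y z : 'cV[R]_d) : (eps n *: y + z) @[n --> \oo] --> z.
Proof.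
apply: cvg_mx => i j.
have -> : (fun n => (eps n *: y + z) i j) = (fun n => eps n * y i j + z i j).
  by apply/funext => n; rewrite !mxE.
rewrite -[X in _ --> X]add0r; apply: cvgD; last exact: cvg_cst.
by rewrite -(mul0r (y i j)); apply: cvgM => //; exact: cvg_cst.
Qed.

Let cvg_Phi (y z : 'cV[R]_d) : Phi (eps n *: y + z) @[n --> \oo] --> Phi z.
Proof.
by apply: continuous_cvg; [exact: Phi_continuous|exact: cvg_affine].
Qed.

Let A : R := \int[lebd]_u rnorm (a u).

Let kernel_le n z : \int[lebd]_y (Phi (eps n *: y + z) * cauchy_Rd y) <= A.
Proof.
set I := Rintegral _ _ _.
have -> : I = complex.Re (I%:C%C) by [].
rewrite /I kernel_parseval//; apply: (le_trans (ler_norm _)).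
apply: (le_trans (Re_le_rnorm _)).
apply: le_rnorm_cintegral_bound.
- apply: cmeasurableM; last exact: cintegrable_measurable integrable_a.
  apply: cmeasurableM.
    apply: cmeasurable_real; apply: (measurableT_comp measurable_laplace_Rd).
    by apply: measurable_cV_scale.
  exact: cmeasurable_character.
- exact: integrable_rnorm.
- move=> u; rewrite !rnormM rnorm_expi rnorm_real mulr1 ger0_norm ?laplace_Rd_ge0//.
  by rewrite ler_piMl ?rnorm_ge0// laplace_Rd_le1.
Qed.

Let mPhi_affine (e : R) (z : 'cV[R]_d) : measurable_fun setT (fun y : 'cV[R]_d => Phi (e *: y + z)).
Proof.
apply: (measurableT_comp mPhi); apply: measurable_cV_add; last exact: measurable_cst.
exact: measurable_cV_scale.
Qed.

(** By [kernel_le] the averages of [Phi] around [z] at the scales [eps n] are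
    bounded uniformly.  As [Phi] is nonnegative, replacing it by its minimum with
    [Phi z] makes the averages smaller, and to these dominated convergence
    applies. *)
Let Phi_bounded z : Phi z <= A / (2 * pi) ^+ d.
Proof.
have [ic ec] := cauchy_Rd_integral.
rewrite ler_pdivlMr ?exprn_gt0 ?mulr_gt0 ?pi_gt0//.
pose mn n (y : 'cV[R]_d) := Num.min (Phi (eps n *: y + z)) (Phi z).
have mn0 n y : 0 <= mn n y by rewrite le_min !Phi_ge0.
have mnz n y : mn n y <= Phi z by rewrite ge_min lexx orbT.
have mmn n : measurable_fun setT (mn n).
  by apply: measurable_minr => //; exact: measurable_cst.
have iz : lebd.-integrable setT (EFin \o (fun y => Phi z * cauchy_Rd y)).
  exact: integrable_scaled.
have im n : lebd.-integrable setT (EFin \o (fun y => mn n y * cauchy_Rd y)).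
  apply: (integrable_dominated _ iz).
    by apply: measurable_funM => //; exact: measurable_cauchy_Rd.
  move=> y; rewrite ger0_norm ?mulr_ge0 ?cauchy_Rd_ge0//.
  by rewrite ler_wpM2r ?cauchy_Rd_ge0.
pose u n (y : 'cV[R]_d) := Phi z * cauchy_Rd y - mn n y * cauchy_Rd y.
have u_ge0 n y : 0 <= u n y by rewrite /u -mulrBl mulr_ge0 ?cauchy_Rd_ge0// subr_ge0.
rewrite -subr_le0; apply: (@le_cvg0 _ _ (fun n => \int[lebd]_y `|u n y|)).
  move=> n; rewrite -ec -RintegralZl//.
  have le1 : \int[lebd]_y (mn n y * cauchy_Rd y) <= A.
    apply: le_trans (kernel_le n z); apply: le_Rintegral => //.
      have T := transports_comp (transports_scale (lt0r_neq0 (eps_gt0 n))) (transports_shift z).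
      have iP := density_integrable mPhi Phi_ge0 Phi_density.
      have iPT := transports_integrable T iP.
      apply: (@integrable_dominated _ _ _ _ (fun y : 'cV[R]_d => 2 ^+ d * Phi (eps n *: y + z))).
      - by apply: measurable_funM => //; exact: measurable_cauchy_Rd.
      - exact: (integrable_scaled _ iPT).
      - move=> y; rewrite ger0_norm ?mulr_ge0 ?cauchy_Rd_ge0//.
        by rewrite mulrC ler_wpM2r// cauchy_Rd_le.
    by move=> y _; rewrite ler_wpM2r ?cauchy_Rd_ge0// ge_min lexx.
  rewrite [leRHS](@eq_Rintegral _ _ _ _ _ (u n)); last by move=> y _; rewrite ger0_norm.
  by rewrite /u RintegralB// lerD2l lerN2.
apply: (@dominated_cvg0 _ _ _ _ u (fun y : 'cV[R]_d => Phi z * cauchy_Rd y)) => //.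
- move=> n; apply: measurable_funB; apply: measurable_funM => //; exact: measurable_cauchy_Rd.
- move=> n y; rewrite ger0_norm// /u gerBl mulr_ge0// cauchy_Rd_ge0//.
- apply: nearW => y; rewrite -(subrr (Phi z * cauchy_Rd y)).
  apply: cvgB; first exact: cvg_cst.
  apply: cvgM; last exact: cvg_cst.
  apply: (@squeeze_cvgr _ _ _ _ (fun n => Phi z - `|Phi (eps n *: y + z) - Phi z|)
    (cst (Phi z))); last exact: cvg_cst.
    apply: nearW => n; rewrite mnz andbT /mn le_min.
    by rewrite gerBl normr_ge0 andbT lerBlDl -lerBlDr distrC ler_norm.
  rewrite -[X in _ --> X]subr0; apply: cvgB; first exact: cvg_cst.
  rewrite -(normr0 R) -(subrr (Phi z)); apply: cvg_norm.
  by apply: cvgB; [exact: cvg_Phi|exact: cvg_cst].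
Qed.

(** In [kernel_parseval], as the scale tends to 0, the kernel tends to 1 on the
    side of [a], where [a] itself dominates, and concentrates at the origin on
    the side of [Phi], where the bound on [Phi] dominates. *)
Lemma fourier_inversion0 : cintegral lebd a = ((2 * pi) ^+ d * Phi 0)%:C%C.
Proof.
have [ic ec] := cauchy_Rd_integral.
set M := A / (2 * pi) ^+ d.
pose I n : R := \int[lebd]_y (Phi (eps n *: y + 0) * cauchy_Rd y).
pose F n (u : 'cV[R]_d) : R[i] := (laplace_Rd (eps n *: u))%:C%C * expi (- dot u 0) * a u.
have iL (c : R) : lebd.-integrable setT (EFin \o (fun y => c * cauchy_Rd y)).
  exact: integrable_scaled.
have iPh n : lebd.-integrable setT (EFin \o (fun y => Phi (eps n *: y + 0) * cauchy_Rd y)).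
  apply: (integrable_dominated _ (iL M)).
    by apply: measurable_funM => //; exact: measurable_cauchy_Rd.
  move=> y; rewrite ger0_norm ?mulr_ge0 ?cauchy_Rd_ge0//.
  by rewrite ler_wpM2r ?cauchy_Rd_ge0//; exact: Phi_bounded.
have cvI : `|I n - (2 * pi) ^+ d * Phi 0| @[n --> \oo] --> 0.
  apply: (@squeeze_cvgr _ _ _ _ (cst 0)
    (fun n => \int[lebd]_y `|Phi (eps n *: y + 0) * cauchy_Rd y - Phi 0 * cauchy_Rd y|)).
  - apply: nearW => n; rewrite normr_ge0/= /I mulrC -ec -RintegralZl// -RintegralB//.
    apply: le_normr_Rintegral => //.
    by have := integrableB measurableT (iPh n) (iL (Phi 0)).
  - exact: cvg_cst.
  - apply: (@dominated_cvg0 _ _ _ _ (fun n (y : 'cV[R]_d) =>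
        Phi (eps n *: y + 0) * cauchy_Rd y - Phi 0 * cauchy_Rd y)
      (fun y : 'cV[R]_d => (M + M) * cauchy_Rd y)) => //.
    + by move=> n; apply: measurable_funB; apply: measurable_funM => //; exact: measurable_cauchy_Rd.
    + move=> n y; rewrite -mulrBl normrM (ger0_norm (cauchy_Rd_ge0 _)).
      rewrite ler_wpM2r ?cauchy_Rd_ge0// (le_trans (ler_normB _ _))//.
      by rewrite !ger0_norm// lerD//; exact: Phi_bounded.
    + apply: nearW => y; rewrite -(subrr (Phi 0 * cauchy_Rd y)).
      apply: cvgB; last exact: cvg_cst.
      apply: cvgM; last exact: cvg_cst.
      exact: cvg_Phi.
have cvF : rnorm (cintegral lebd (F n) - cintegral lebd a) @[n --> \oo] --> 0.
  apply: (@cdominated_convergence _ _ _ _ _ _ (fun u => rnorm (a u))).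
  - move=> n; apply: cmeasurableM; last exact: cintegrable_measurable integrable_a.
    apply: cmeasurableM.
      apply: cmeasurable_real; apply: (measurableT_comp measurable_laplace_Rd).
      by apply: measurable_cV_scale.
    exact: cmeasurable_character.
  - exact: cintegrable_measurable integrable_a.
  - exact: integrable_rnorm.
  - move=> n u; rewrite !rnormM rnorm_expi rnorm_real mulr1 ger0_norm ?laplace_Rd_ge0//.
    by rewrite ler_piMl ?rnorm_ge0// laplace_Rd_le1.
  - by [].
  - apply: nearW => u.
    have -> : (fun n => rnorm (F n u - a u)) =
        (fun n => `|laplace_Rd (eps n *: u) - 1| * rnorm (a u)).
      apply/funext => n; rewrite /F dot0r oppr0 expi0 mulr1 -{2}[a u]mul1r -mulrBl.
      by rewrite rnormM -rnorm_real rmorphB.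
    rewrite -[X in _ --> X](mul0r (rnorm (a u))); apply: cvgM; last exact: cvg_cst.
    rewrite -(normr0 R) -(subrr 1); apply: cvg_norm; apply: cvgB; last exact: cvg_cst.
    have -> : (1 : R) = \prod_(i < d) 1 by rewrite big1.
    rewrite /laplace_Rd; apply: cvg_bigprod => i.
    rewrite -[X in _ --> X](expR0).
    apply: continuous_cvg; first exact: continuous_expR.
    rewrite -[X in _ --> X]oppr0; apply: cvgN; rewrite -(normr0 R); apply: cvg_norm.
    have -> : (fun n => (eps n *: u) i ord0) = (fun n => eps n * u i ord0).
      by apply/funext => n; rewrite !mxE.
    rewrite -(mul0r (u i ord0)); apply: cvgM => //; exact: cvg_cst.
have IF n : (I n)%:C%C = cintegral lebd (F n) by rewrite /I kernel_parseval.
apply/eqP; rewrite -subr_eq0; apply/eqP/rnorm_eq0/le_anti.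
rewrite rnorm_ge0 andbT.
apply: (@le_cvg0 _ _ (fun n => rnorm (cintegral lebd (F n) - cintegral lebd a) +
  `|I n - (2 * pi) ^+ d * Phi 0|)).
  move=> n; rewrite -(subrKA (cintegral lebd (F n))) (le_trans (rnormD _ _))//.
  by rewrite [X in X + _]rnormBC lerD2l -IF -rmorphB rnorm_real.
by rewrite -[X in _ --> X](addr0 0); apply: cvgD.
Qed.

End fourier_inversion.

(** * Convergence in complex normed spaces *)

Section complex_convergence.
Context (R : realType).

Lemma realC_gt0 (e : R[i]) : 0 < e -> exists2 r : R, 0 < r & e = r%:C%C.
Proof.
move=> e0; exists (complex.Re e); first by move: e0; rewrite ltcE => /andP[].
by have := ger0_Im (ltW e0); case: (e) => a b /= ->.
Qed.

(** In a complex normed space distances are elements of [R[i]]; this brings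
    convergence back to real sequences. *)
Lemma cvg_rnorm0 (V : normedModType R[i]) (T : Type) (F : set_system T)
    (FF : Filter F) (u : T -> V) (l : V) :
  u @ F --> l <-> rnorm (u x - l) @[x --> F] --> 0.
Proof.
split=> [/cvgrPdist_lt H|H].
- apply/cvgr0Pnorm_lt => e e0; have e0' : 0 < e%:C%C :> R[i] by rewrite ltcR.
  apply: filterS (H _ e0') => x.
  by rewrite normE_rnorm ltcR rnormBC ger0_norm ?rnorm_ge0.
- apply/cvgrPdist_lt => e /realC_gt0[r r0 ->].
  move/cvgr0Pnorm_lt : H => /(_ r r0); apply: filterS => x.
  by rewrite normE_rnorm ltcR rnormBC ger0_norm ?rnorm_ge0.
Qed.

Lemma cauchy_rnorm (V : completeNormedModType R[i]) (u : nat -> V) (r : nat -> R) :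
  (forall n m, (n <= m)%N -> rnorm (u m - u n) <= r n) -> r n @[n --> \oo] --> 0 ->
  exists l, forall n, rnorm (l - u n) <= r n.
Proof.
move=> ur r0.
have cu : cvg (u @ \oo).
  apply: cauchy_cvg; apply: cauchy_exP => e /realC_gt0[s s0 ->].
  move/cvgr0Pnorm_lt : r0 => /(_ s s0) [N _ HN].
  exists (u N), N => // m /= Nm; rewrite -ball_normE /= normE_rnorm ltcR rnormBC.
  rewrite (le_lt_trans (ur _ _ Nm))// (le_lt_trans (ler_norm _))//.
  by apply: HN => /=.
have [l ul] := (cvg_ex _).1 cu; exists l => n.
have {}ul := (cvg_rnorm0 _ _ _).1 ul.
rewrite -subr_le0; apply: (@le_cvg0 _ _ (fun m => rnorm (u (m + n)%N - l))).
  move=> m; rewrite lerBlDr -(subrKA (u (m + n)%N)) (le_trans (rnormD _ _))//.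
  by rewrite rnormBC lerD2l ur// leq_addl.
by rewrite (cvg_shiftn n (fun m => rnorm (u m - l))); exact: ul.
Qed.

End complex_convergence.

Section uniform_boundedness.
Context (R : realType) (V : completeNormedModType R[i]).
Variables (p : nat -> V -> R) (c : nat -> R).
Hypothesis pD : forall N x y, p N (x + y) <= p N x + p N y.
Hypothesis pZ : forall N (a : R) x, 0 <= a -> p N (a%:C%C *: x) = a * p N x.
Hypothesis pN : forall N x, p N (- x) = p N x.
Hypothesis p_le : forall N x, p N x <= c N * rnorm x.
Hypothesis c_gt0 : forall N, 0 < c N.
Hypothesis p_bounded : forall x, exists K, forall N, p N x <= K.

(** Nested balls: were the seminorms not uniformly bounded, every ball would
    contain a smaller one on which one of them is as large as desired; a point
    common to such nested balls violates pointwise boundedness. *)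
Lemma uniform_boundedness : exists K, forall N x, p N x <= K * rnorm x.
Proof.
apply: contrapT => unb.
have big K : 0 <= K -> exists N x, K * rnorm x < p N x.
  move=> K0; apply: contrapT => H; apply: unb; exists K => N x.
  by rewrite leNgt; apply/negP => ?; apply: H; exists N, x.
have step (s : nat * (V * R)) : exists s' : V * R, 0 < s.2.2 ->
    [/\ 0 < s'.2, s'.2 <= s.2.2 / 2, rnorm (s'.1 - s.2.1) <= s.2.2 / 2 &
      exists N, forall z, rnorm (z - s'.1) <= s'.2 -> s.1%:R <= p N z].
  case: s => m [x r] /=.
  have [r0|] := ltP 0 r; last by exists (x, r).
  have K0 : 0 <= 2 * m.+1%:R / r by rewrite divr_ge0 ?mulr_ge0 ?ltW.
  have [N [y Ky]] := big _ K0.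
  have y0 : 0 < rnorm y.
    rewrite lt_neqAle rnorm_ge0 andbT; apply/eqP => /esym y0.
    by move: Ky; rewrite ltNge (le_trans (p_le _ _))// y0 !mulr0.
  (* one of x + xi and x - xi has a large seminorm, since their difference has *)
  pose xi := (r / 2 / rnorm y)%:C%C *: y.
  have xir : rnorm xi = r / 2.
    by rewrite rnormZ rnorm_real ger0_norm ?divfK ?gt_eqF// !divr_ge0// ltW.
  have pxi : m.+1%:R <= p N xi.
    rewrite pZ; last by rewrite !divr_ge0// ltW.
    have -> : m.+1%:R = r / 2 / rnorm y * (2 * m.+1%:R / r * rnorm y).
      by field; rewrite !gt_eqF.
    by rewrite ler_wpM2l ?ltW// !divr_gt0.
  have [x' x'r px'] : exists2 x', rnorm (x' - x) <= r / 2 & m.+1%:R <= p N x'.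
    have [?|H1] := leP m.+1%:R (p N (x + xi)).
      by exists (x + xi); rewrite ?[x + xi]addrC ?addrK ?xir// addrC.
    have [?|H2] := leP m.+1%:R (p N (x - xi)).
      by exists (x - xi); rewrite // addrAC subrr add0r rnormN xir.
    have : p N (2%:C%C *: xi) <= p N (x + xi) + p N (x - xi).
      rewrite -[X in _ + X]pN (_ : 2%:C%C *: xi = (x + xi) + - (x - xi))//.
      by rewrite opprB addrA addrAC [x + xi]addrC addrK rmorph_nat scaler_nat mulr2n.
    by rewrite pZ//; lra.
  exists (x', Num.min (r / 2) (c N)^-1) => _ /=; split => //.
  - by rewrite lt_min divr_gt0//= invr_gt0.
  - by rewrite ge_min lexx.
  - exists N => z; rewrite le_min/= => /andP[_ zx].
    have : p N x' <= p N z + p N (x' - z) by rewrite -{1}(subrK z x') addrC pD.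
    have : p N (x' - z) <= 1.
      rewrite (le_trans (p_le _ _))// rnormBC.
      by rewrite -(@mulfV _ (c N)) ?gt_eqF// ler_wpM2l// ltW.
    move: px'; rewrite -natr1; lra.
have [f Pf] := choice step.
pose fix a n : V * R := if n is k.+1 then f (k, a k) else (0, 1).
have a0 n : 0 < (a n).2.
  by elim: n => //= k IH; have [] := Pf (k, a k) IH.
have aP n := Pf (n, a n) (a0 n).
have ar n k : (a (n + k)%N).2 <= (a n).2 / 2 ^+ k.
  elim: k => [|k IH]; first by rewrite addn0 expr0 divr1.
  rewrite addnS; have [_ h _ _] := aP (n + k)%N; rewrite (le_trans h)//=.
  by rewrite exprSr invfM mulrA ler_wpM2r.
have near_ n k : rnorm ((a (n + k)%N).1 - (a n).1) <= (a n).2 - (a (n + k)%N).2.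
  elim: k => [|k IH]; first by rewrite addn0 !subrr rnorm0.
  rewrite addnS -(subrKA (a (n + k)%N).1) (le_trans (rnormD _ _))//.
  have [_ h1 h2 _] := aP (n + k)%N.
  move: h1 h2 IH => /= h1 h2; lra.
have near' n m : (n <= m)%N -> rnorm ((a m).1 - (a n).1) <= (a n).2.
  by move=> /subnKC <-; rewrite (le_trans (near_ _ _))// gerBl ltW.
have a_cvg : (a n).2 @[n --> \oo] --> 0.
  apply: (@squeeze_cvgr _ _ _ _ (cst 0) (fun n => 2^-1 ^+ n)).
  - apply: nearW => n; rewrite (ltW (a0 n))/= (le_trans (ar 0%N n))//=.
    by rewrite mul1r exprVn.
  - exact: cvg_cst.
  - by apply: cvg_expr; rewrite ger0_norm// invf_lt1// ltr1n.
have [l al] := @cauchy_rnorm R V (fun n => (a n).1) (fun n => (a n).2) near' a_cvg.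
have [K pK] := p_bounded l.
set k := Num.trunc K.
have [_ _ _ [N HN]] := aP k.+1.
have {}HN : k.+1%:R <= p N l by apply: HN; exact: (al k.+2).
have := le_trans HN (pK N).
by rewrite leNgt truncnS_gt.
Qed.

End uniform_boundedness.

(** * Norms of classes of functions *)

(** Indicators of measurable sets are enough test functions.  Functions that are
    known only through duality, such as the iterates of the twisted transfer
    operators, are identified in this way. *)
Lemma ae_eq_tests (R : realType) dX (X : measurableType dX)
    (mu : {finite_measure set X -> \bar R}) (f g : X -> R[i]) :
  cintegrable mu f -> cintegrable mu g ->
  (forall phi : X -> R[i], cmeasurable phi -> (exists K : R, forall x, rnorm (phi x) <= K) ->
    cintegral mu (fun x => f x * phi x) = cintegral mu (fun x => g x * phi x)) ->
  ae_eq mu setT f g.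
Proof.
move=> cf cg H; have [fr fi] := cf; have [gr gi] := cg.
have HE E : measurable E -> cintegral mu (fun x => f x * (\1_E x)%:C%C) =
    cintegral mu (fun x => g x * (\1_E x)%:C%C).
  move=> mE; apply: H; first exact: cmeasurable_indic.
  by exists 1 => x; rewrite rnorm_real ger0_norm// indicE; case: (_ \in _).
have set_int (h : X -> R) E : measurable E -> mu.-integrable setT (EFin \o h) ->
    (\int[mu]_(x in E) (h x)%:E = (\int[mu]_x (h x * \1_E x))%:E)%E.
  move=> mE ih; rewrite /Rintegral [LHS]integral_mkcond.
  rewrite (eq_integral (fun x => (h x * \1_E x)%:E)).
    rewrite fineK//; apply: integrable_fin_num => //.
    apply: (@integrable_dominated _ _ _ _ (fun x => `|h x|)).
    - by apply: measurable_funM => //; have /measurable_EFinP := measurable_int _ ih.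
    - exact: (integrable_norm ih).
    - by move=> x; rewrite normrM ler_piMr// ger0_norm// indicE; case: (_ \in _).
  by move=> x _; rewrite patchE indicE; case: (_ \in _); rewrite ?mulr1 ?mulr0.
have eR : ae_eq mu setT (fun x => (complex.Re (f x))%:E) (fun x => (complex.Re (g x))%:E).
  apply: integral_ae_eq => //; first exact: measurable_int gr.
  move=> E _ mE; rewrite (set_int (fun x => complex.Re (f x)))//.
  rewrite (set_int (fun x => complex.Re (g x)))//; congr EFin.
  have /(congr1 (@complex.Re R)) /= := HE E mE.
  rewrite (@eq_Rintegral _ _ _ _ _ (fun x => complex.Re (f x) * \1_E x)).
    rewrite [RHS](@eq_Rintegral _ _ _ _ _ (fun x => complex.Re (g x) * \1_E x))//.
    by move=> x _; rewrite ReM /= mulr0 subr0.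
  by move=> x _; rewrite ReM /= mulr0 subr0.
have eI : ae_eq mu setT (fun x => (complex.Im (f x))%:E) (fun x => (complex.Im (g x))%:E).
  apply: integral_ae_eq => //; first exact: measurable_int gi.
  move=> E _ mE; rewrite (set_int (fun x => complex.Im (f x)))//.
  rewrite (set_int (fun x => complex.Im (g x)))//; congr EFin.
  have /(congr1 (@complex.Im R)) /= := HE E mE.
  rewrite (@eq_Rintegral _ _ _ _ _ (fun x => complex.Im (f x) * \1_E x)).
    rewrite [RHS](@eq_Rintegral _ _ _ _ _ (fun x => complex.Im (g x) * \1_E x))//.
    by move=> x _; rewrite ImM /= mulr0 add0r.
  by move=> x _; rewrite ImM /= mulr0 add0r.
apply: filterS2 eR eI => x /= + + xT; move=> /(_ xT) [] eR /(_ xT) [] eI.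
exact: complex_ext.
Qed.

Section norms.
Context (R : realType) dX (X : measurableType dX) (mu : probability X R).
Variables (V : completeNormedModType R[i]) (e : V -> X -> R[i]).
Hypothesis emb : L1_embedding mu e.

Lemma embZ (a : R[i]) v : ae_eq mu setT (e (a *: v)) (fun x => a * e v x).
Proof.
have e0 : ae_eq mu setT (e 0) (fun=> 0).
  have := L1_emb_linear emb 1 0 0; rewrite scaler0 addr0.
  apply: filterS => x /= + xT => /(_ xT); rewrite mul1r => /eqP.
  by rewrite -subr_eq0 opprD addNKr oppr_eq0 => /eqP.
have := L1_emb_linear emb a v 0; rewrite addr0 => H.
by apply: filterS2 H e0 => x /= + + xT; move=> /(_ xT) -> /(_ xT) ->; rewrite addr0.
Qed.

Lemma embD v w : ae_eq mu setT (e (v + w)) (fun x => e v x + e w x).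
Proof.
have := L1_emb_linear emb 1 v w; rewrite scale1r.
by apply: filterS => x /= + xT => /(_ xT) ->; rewrite mul1r.
Qed.

Lemma emb_inj v w (f : X -> R[i]) :
  ae_eq mu setT (e v) f -> ae_eq mu setT (e w) f -> v = w.
Proof.
move=> vf wf; apply/eqP; rewrite -subr_eq0; apply/eqP/(L1_emb_injective emb).
have := L1_emb_linear emb (-1) w v; rewrite scaleN1r addrC => H.
apply: filterS3 H vf wf => x /= + + + xT.
by move=> /(_ xT) -> /(_ xT) -> /(_ xT) ->; rewrite mulN1r addNr.
Qed.

(** The infimum defining [space_norm] is infinite when [f] represents no element,
    so a finite bound provides a representative. *)
Lemma space_norm_le (K : R) (f : X -> R[i]) : (space_norm mu e f <= K%:E)%E ->
  exists2 w, ae_eq mu setT (e w) f & rnorm w <= K.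
Proof.
rewrite /space_norm; set S := [set _ | _ in _] => SK.
have [w wf] : exists w, ae_eq mu setT (e w) f.
  apply: contrapT => H; move: SK; rewrite (_ : S = set0) ?ereal_inf0//.
  by apply/seteqP; split => // t [v vf _]; apply: H; exists v.
exists w => //; rewrite -lee_fin (le_trans _ SK)//.
apply/ereal_infP => _ [v vf <-]; rewrite lee_fin.
by rewrite (emb_inj wf vf).
Qed.

(** Homogeneity up to null sets is enough to extend the bound from the unit
    ball. *)
Lemma op_norm_le (U : completeNormedModType R[i]) (A : U -> X -> R[i]) (K : R) :
  (forall c v, ae_eq mu setT (A (c *: v)) (fun x => c * A v x)) ->
  (op_norm mu e A <= K%:E)%E ->
  forall v, exists2 w, ae_eq mu setT (e w) (A v) & rnorm w <= K * rnorm v.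
Proof.
move=> AZ AK v.
have unit_ball u : rnorm u <= 1 -> exists2 w, ae_eq mu setT (e w) (A u) & rnorm w <= K.
  move=> u1; apply: space_norm_le; apply: le_trans AK.
  by apply: ereal_sup_ubound; exists u.
have [v0|v0] := eqVneq (rnorm v) 0.
  exists 0; last by rewrite v0 mulr0 rnorm0.
  have := AZ 0 v; rewrite (rnorm_eq0 v0) scaler0 => A0.
  have := embZ 0 0; rewrite scale0r => E0.
  by apply: filterS2 E0 A0 => x /= + + xT; move=> /(_ xT) -> /(_ xT) ->; rewrite !mul0r.
have v1 : rnorm ((rnorm v)^-1%:C%C *: v) <= 1.
  by rewrite rnormZ rnorm_real ger0_norm ?invr_ge0 ?rnorm_ge0// mulVf.
have [w wA wK] := unit_ball _ v1.
exists ((rnorm v)%:C%C *: w).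
  apply: filterS3 (embZ (rnorm v)%:C%C w) wA (AZ (rnorm v)^-1%:C%C v) => x /= + + + xT.
  move=> /(_ xT) -> /(_ xT) -> /(_ xT) ->.
  by rewrite mulrA -rmorphM mulfV// mul1r.
by rewrite rnormZ rnorm_real ger0_norm ?rnorm_ge0// mulrC ler_wpM2r ?rnorm_ge0.
Qed.

Lemma ae_eqM (f g k : X -> R[i]) : ae_eq mu setT f g ->
  ae_eq mu setT (fun x => k x * f x) (fun x => k x * g x).
Proof. by apply: filterS => x /= + xT => /(_ xT) ->. Qed.

Section dual.
Variable g : X -> R[i].
Hypothesis mg : cmeasurable g.
Hypothesis ge : forall h, cintegrable mu (fun x => g x * e h x).

Lemma cintegral_dual w (f : X -> R[i]) : cmeasurable f -> ae_eq mu setT (e w) f ->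
  cintegral mu (fun x => g x * f x) = cintegral mu (fun x => g x * e w x).
Proof.
move=> mf wf; apply: ae_eq_cintegral.
- exact: cmeasurableM.
- exact: cintegrable_measurable (ge w).
- by apply: ae_eq_sym; exact: ae_eqM.
Qed.

Lemma cintegral_dualZ (a : R[i]) h : cintegral mu (fun x => g x * e (a *: h) x) =
  a * cintegral mu (fun x => g x * e h x).
Proof.
rewrite -cintegralZ//; apply: ae_eq_cintegral.
- exact: cintegrable_measurable (ge _).
- by apply: cmeasurableM; [exact: cmeasurable_cst|exact: cintegrable_measurable (ge _)].
- by apply: filterS (embZ a h) => x /= + xT => /(_ xT) ->; rewrite mulrCA.
Qed.

Lemma cintegral_dualD h k : cintegral mu (fun x => g x * e (h + k) x) =
  cintegral mu (fun x => g x * e h x) + cintegral mu (fun x => g x * e k x).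
Proof.
rewrite -cintegralD//; apply: ae_eq_cintegral.
- exact: cintegrable_measurable (ge _).
- by apply: cmeasurableD; exact: cintegrable_measurable (ge _).
- by apply: filterS (embD h k) => x /= + xT => /(_ xT) ->; rewrite mulrDr.
Qed.

Lemma dual_norm_le (D : R) : (dual_norm mu e g <= D%:E)%E ->
  forall h, rnorm (cintegral mu (fun x => g x * e h x)) <= D * rnorm h.
Proof.
move=> gD h.
have unit_ball u : rnorm u <= 1 -> rnorm (cintegral mu (fun x => g x * e u x)) <= D.
  move=> u1; rewrite -lee_fin (le_trans _ gD)//.
  by apply: ereal_sup_ubound; exists u.
have [h0|h0] := eqVneq (rnorm h) 0.
  have := cintegral_dualZ 0 h; rewrite (rnorm_eq0 h0) scaler0 mul0r => ->.
  by rewrite !rnorm0 mulr0.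
have h1 : rnorm ((rnorm h)^-1%:C%C *: h) <= 1.
  by rewrite rnormZ rnorm_real ger0_norm ?invr_ge0 ?rnorm_ge0// mulVf.
have := unit_ball _ h1.
rewrite cintegral_dualZ rnormM rnorm_real ger0_norm ?invr_ge0 ?rnorm_ge0//.
by rewrite ler_pdivrMl ?lt_neqAle ?rnorm_ge0 ?andbT 1?eq_sym// mulrC.
Qed.

(** Pairing with [g] maps the Banach space into the integrable functions, and
    is bounded as the supremum of the bounded pairings with the truncations
    of [g]. *)
Lemma pairing_bounded : exists K, forall h,
  \int[mu]_x rnorm (g x * e h x) <= K * rnorm h.
Proof.
have [L eL] := L1_emb_bounded emb.
pose trunc N x : R := \1_[set x | rnorm (g x) <= N%:R] x.
have mtrunc N : measurable_fun setT (trunc N).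
  apply: measurable_indic; rewrite -[X in measurable X]setTI.
  by apply: measurable_fun_le => //; exact: measurable_rnorm.
have trunc01 N x : 0 <= trunc N x <= 1.
  by rewrite /trunc indicE; case: (_ \in _); rewrite /= ?lexx ?ler01.
pose p N h := \int[mu]_x (trunc N x * rnorm (g x * e h x)).
have ip N h : mu.-integrable setT (EFin \o (fun x => trunc N x * rnorm (g x * e h x))).
  apply: (integrable_dominated _ (integrable_rnorm (ge h))).
    apply: measurable_funM => //; apply: measurable_rnorm.
    exact: cintegrable_measurable (ge h).
  move=> x; have /andP[t0 t1] := trunc01 N x.
  by rewrite ger0_norm ?mulr_ge0 ?rnorm_ge0// ler_piMl ?rnorm_ge0.
have p_ae N h (F : X -> R[i]) : cmeasurable F -> ae_eq mu setT (e h) F ->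
    p N h = \int[mu]_x (trunc N x * rnorm (g x * F x)).
  move=> mF hF; congr fine; apply: ae_eq_integral => //.
  - by have := measurable_int _ (ip N h).
  - apply/measurable_EFinP; apply: measurable_funM => //.
    by apply: measurable_rnorm; exact: cmeasurableM.
  - by apply: filterS hF => x /= + xT => /(_ xT) ->.
have me h : cmeasurable (e h) by exact: cintegrable_measurable (L1_emb_integrable emb h).
have pZ N (a : R[i]) h : p N (a *: h) = rnorm a * p N h.
  rewrite (p_ae _ _ _ _ (embZ a h)); last by apply: cmeasurableM => //; exact: cmeasurable_cst.
  rewrite -RintegralZl//; apply: eq_Rintegral => x _.
  by rewrite (mulrCA (g x)) (rnormM a) (mulrCA (trunc N x)).
have [K HK] : exists K, forall N h, p N h <= K * rnorm h.
  apply: (@uniform_boundedness R V p (fun N => N%:R * `|L| + 1)).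
  - move=> N h k; rewrite (p_ae _ _ _ _ (embD h k)); last exact: cmeasurableD.
    rewrite -RintegralD//; apply: le_Rintegral => //.
    + apply: (integrable_dominated _ (integrable_rnorm (cintegrableD (ge h) (ge k)))).
        apply: measurable_funM => //; apply: measurable_rnorm.
        by apply: cmeasurableM => //; exact: cmeasurableD.
      move=> x; have /andP[t0 t1] := trunc01 N x.
      rewrite ger0_norm ?mulr_ge0 ?rnorm_ge0// mulrDr.
      by rewrite ler_piMl ?rnorm_ge0.
    + by have := integrableD measurableT (ip N h) (ip N k).
    + move=> x _; have /andP[t0 t1] := trunc01 N x.
      by rewrite -mulrDr ler_wpM2l// mulrDr rnormD.
  - by move=> N a h a0; rewrite pZ rnorm_real ger0_norm.
  - by move=> N h; rewrite -scaleN1r pZ rnormN rnorm1 mul1r.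
  - move=> N h.
    have ieh := integrable_rnorm (L1_emb_integrable emb h).
    apply: (@le_trans _ _ (\int[mu]_x (N%:R * rnorm (e h x)))).
      apply: le_Rintegral => //.
        exact: integrable_scaled.
      move=> x _; rewrite /trunc indicE.
      have [/set_mem/= gN|_] := boolP (x \in [set x | rnorm (g x) <= N%:R]).
        by rewrite mul1r rnormM ler_wpM2r// rnorm_ge0.
      by rewrite mul0r mulr_ge0// rnorm_ge0.
    rewrite RintegralZl// mulrDl mul1r -mulrA.
    apply: (@le_trans _ _ (N%:R * (`|L| * rnorm h))); last by rewrite lerDl rnorm_ge0.
    rewrite ler_wpM2l//; apply: (@le_trans _ _ (L * rnorm h)).
      by rewrite -lee_fin /Rintegral fineK ?eL// integrable_fin_num.
    by rewrite ler_wpM2r ?rnorm_ge0// ler_norm.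
  - by move=> N; rewrite ltr_wpDl// mulr_ge0.
  - move=> h; exists (\int[mu]_x rnorm (g x * e h x)) => N.
    apply: le_Rintegral => //; first exact: integrable_rnorm.
    move=> x _; have /andP[t0 t1] := trunc01 N x.
    by rewrite ler_piMl ?rnorm_ge0.
exists K => h; rewrite -subr_le0.
apply: (@le_cvg0 _ _ (fun N => \int[mu]_x `|(1 - trunc N x) * rnorm (g x * e h x)|)).
  move=> N; rewrite lerBlDr.
  have -> : \int[mu]_x `|(1 - trunc N x) * rnorm (g x * e h x)| =
      \int[mu]_x rnorm (g x * e h x) - p N h.
    rewrite -RintegralB//; last exact: integrable_rnorm.
    apply: eq_Rintegral => x _; have /andP[t0 t1] := trunc01 N x.
    by rewrite ger0_norm ?mulr_ge0 ?rnorm_ge0 ?subr_ge0// mulrBl mul1r.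
  by rewrite addrAC -addrA lerDl subr_ge0.
apply: (@dominated_cvg0 _ _ _ _ (fun N x => (1 - trunc N x) * rnorm (g x * e h x))
  (fun x => rnorm (g x * e h x))).
- move=> N; apply: measurable_funM; first exact: measurable_funB.
  by apply: measurable_rnorm; exact: cintegrable_measurable (ge h).
- exact: integrable_rnorm.
- move=> N x; have /andP[t0 t1] := trunc01 N x.
  rewrite ger0_norm ?mulr_ge0 ?rnorm_ge0 ?subr_ge0//.
  by rewrite ler_piMl ?rnorm_ge0// gerBl.
- apply: nearW => x; apply: cvg_near_cst; near=> N.
  rewrite /trunc indicE mem_set ?subrr ?mul0r//=.
  by near: N; exact: nbhs_infty_ger.
Unshelve. all: by end_near. Qed.

End dual.
End norms.

(** * Orthogonality of the characters of the torus *)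

Lemma ccvg_unique (R : realType) (u : nat -> R[i]) (a b : R[i]) :
  rnorm (u n - a) @[n --> \oo] --> 0 -> rnorm (u n - b) @[n --> \oo] --> 0 -> a = b.
Proof.
move=> ua ub; apply/eqP; rewrite -subr_eq0; apply/eqP/rnorm_eq0/le_anti.
rewrite rnorm_ge0 andbT.
apply: (@le_cvg0 _ _ (fun n => rnorm (u n - a) + rnorm (u n - b))).
  by move=> n; rewrite [rnorm (u n - a)]rnormBC -(subrKA (u n) a) rnormD.
by rewrite -[X in _ --> X](addr0 0); apply: cvgD.
Qed.

Lemma cmeasurable_cvg (R : realType) dX (X : measurableType dX) (u : nat -> X -> R[i])
    (v : X -> R[i]) :
  (forall n, cmeasurable (u n)) ->
  (forall x, rnorm (u n x - v x) @[n --> \oo] --> 0) -> cmeasurable v.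
Proof.
move=> mu_ uv; split.
  apply: (measurable_fun_cvg (h := fun n x => complex.Re (u n x))).
    by move=> n; case: (mu_ n).
  move=> x _; apply/cvgrPdist_lt => e e0.
  have := uv x; move=> /cvgr0Pnorm_lt /(_ e e0); apply: filterS => n.
  rewrite (ger0_norm (rnorm_ge0 _)); apply: le_lt_trans.
  by rewrite -ReN -ReD rnormBC Re_le_rnorm.
apply: (measurable_fun_cvg (h := fun n x => complex.Im (u n x))).
  by move=> n; case: (mu_ n).
move=> x _; apply/cvgrPdist_lt => e e0.
have := uv x; move=> /cvgr0Pnorm_lt /(_ e e0); apply: filterS => n.
rewrite (ger0_norm (rnorm_ge0 _)); apply: le_lt_trans.
by rewrite -ImN -ImD rnormBC Im_le_rnorm.
Qed.

Lemma integrable_indic_lty (R : realType) dX (X : measurableType dX)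
    (mu : {measure set X -> \bar R}) (A : set X) : measurable A -> (mu A < +oo)%E ->
  mu.-integrable setT (EFin \o (\1_A : X -> R)).
Proof.
move=> mA Aoo; apply/integrableP; split.
  by apply/measurable_EFinP; exact: measurable_indic.
under eq_integral do rewrite /= ger0_norm//.
by rewrite integral_indic// setIT.
Qed.

Section boxes.
Context (R : realType) (d : nat).
Local Notation lebd := (@lebesgue_Rd R d).
Local Notation leb := (@lebesgue_measure R : {sigma_finite_measure set (measurableTypeR R) -> \bar R}).

Lemma indic_box (A : set R) (u : 'cV[R]_d) :
  (\1_[set u : 'cV[R]_d | forall i, A (u i ord0)] u)%:C%C =
  \prod_i (\1_A (u i ord0))%:C%C :> R[i].
Proof.
rewrite -rmorph_prod; congr (_%:C%C); rewrite indicE.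
have [/set_mem/= uA|/negP uA] := boolP (u \in _).
  by rewrite big1// => i _; rewrite indicE mem_set.
have [i iA] : exists i, ~ A (u i ord0).
  by apply/existsNP => H; apply: uA; exact: mem_set.
by rewrite (bigD1 i)//= indicE memNset// mul0r.
Qed.

Lemma measurable_box (A : set R) : measurable A ->
  measurable [set u : 'cV[R]_d | forall i, A (u i ord0)].
Proof.
move=> mA; apply: measurable_forall_ord => i.
rewrite -[X in measurable X]setTI; exact: (measurable_mx_coord i ord0 measurableT mA).
Qed.

Lemma lebesgue_box (A : set (measurableTypeR R)) (c : R) : measurable A -> leb A = c%:E ->
  lebd.-integrable setT (EFin \o (\1_[set u : 'cV[R]_d | forall i, A (u i ord0)] : _ -> R)) /\
  \int[lebd]_u (\1_[set u : 'cV[R]_d | forall i, A (u i ord0)] u) = c ^+ d.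
Proof.
move=> mA Ac; pose h (i : 'I_d) (s : R) : R[i] := (\1_A s)%:C%C.
have ih i : cintegrable leb (h i).
  split; last exact: integrable0.
  by apply: integrable_indic_lty => //; apply: (eq_ind_r (fun z => z < +oo)%E _ Ac); exact: ltry.
have [] := @cintegrable_prod_coord R d h ih.
under eq_fun do rewrite -indic_box.
move=> [ir _] e; split=> //.
have -> : \int[lebd]_u (\1_[set u : 'cV[R]_d | forall i, A (u i ord0)] u) =
  complex.Re (cintegral lebd (fun u => (\1_[set u : 'cV[R]_d | forall i, A (u i ord0)] u)%:C%C)) by [].
rewrite e (_ : \prod_i _ = (c ^+ d)%:C%C)//.
rewrite -[in RHS](card_ord d) -prodr_const rmorph_prod; apply: eq_bigr => i _.
apply: complex_ext => /=; last by rewrite /Rintegral integral0.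
rewrite /Rintegral integral_indic// setIT.
by apply: (eq_ind_r (fun z => fine z = c) _ Ac).
Qed.

Lemma cubeE (r : R) : cube r = [set u : 'cV[R]_d | forall i, `[- r, r]%classic (u i ord0)].
Proof.
by apply/seteqP; split => u H i; have := H i; rewrite /= in_itv/= ler_norml.
Qed.

Lemma measurable_cube (r : R) : measurable (cube r : set 'cV[R]_d).
Proof. by rewrite cubeE; exact: measurable_box. Qed.

Lemma lebesgue_cube (r : R) : 0 <= r ->
  lebd.-integrable setT (EFin \o (\1_(cube r) : 'cV[R]_d -> R)) /\
  \int[lebd]_u (\1_(cube r) u) = (2 * r) ^+ d.
Proof.
move=> r0; rewrite cubeE; apply: lebesgue_box => //.
apply: (eq_trans (lebesgue_measure_itv _)); rewrite /= lte_fin.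
have [_|] := ltP (- r) r; first by rewrite -EFinD opprK mulrDl mul1r.
move=> rN; rewrite (_ : r = 0) ?mulr0//; apply/le_anti/andP; split => //; lra.
Qed.

Lemma negligible_origin : (0 < d)%N -> lebd.-negligible [set 0].
Proof.
move=> d0; have [|i e] := @lebesgue_box [set 0] 0 _ (lebesgue_measure_set1 0).
  exact: measurable_set1.
have mS := measurable_box (measurable_set1 (0 : R)).
have S0 : [set u : 'cV[R]_d | forall i, [set 0] (u i ord0)] = [set 0].
  apply/seteqP; split => u /=; first by move=> H; apply/colP => j; rewrite mxE.
  by move=> -> j; rewrite mxE.
rewrite S0 in i e mS.
have : (\int[lebd]_u (\1_[set 0] u)%:E = 0)%E.
  rewrite -[LHS]fineK; last exact: integrable_fin_num.
  by rewrite [fine _]e expr0n gtn_eqF.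
by rewrite integral_indic// setIT => l0; exists [set 0]; split.
Qed.

Lemma Zd_to_RdB (l m : Zd d) : Zd_to_Rd R (l - m) = Zd_to_Rd R l - Zd_to_Rd R m.
Proof. by apply/colP => i; rewrite !mxE intrB. Qed.

Lemma torus_character (l : Zd d) :
  cintegrable lebd (fun t => (\1_(cube pi) t)%:C%C * expi (dot t (Zd_to_Rd R l))) /\
  cintegral lebd (fun t => (\1_(cube pi) t)%:C%C * expi (dot t (Zd_to_Rd R l))) =
  ((if l == 0 then 1 else 0) * (2 * pi) ^+ d)%:C%C.
Proof.
pose h (i : 'I_d) (s : R) : R[i] :=
  (\1_(`[- pi, pi] : set R) s)%:C%C * expi (s * ((l : 'cV[int]_d) i ord0)%:~R).
have ih i : cintegrable leb (h i).
  apply: (@cintegrable_dominated _ _ _ _ _ (\1_(`[- pi, pi] : set (measurableTypeR R)))).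
  - apply: cmeasurableM; first exact: cmeasurable_indic.
    by apply: cmeasurable_expi; exact: measurable_funM.
  - apply: integrable_indic_lty => //.
    apply: (eq_ind_r (fun z => z < +oo)%E _ (lebesgue_measure_itv _)) => /=.
    by case: ifP => _; rewrite ?ltry// -EFinB ltry.
  - by move=> s; rewrite rnormM rnorm_expi rnorm_real mulr1 ger0_norm.
have [] := @cintegrable_prod_coord R d h ih.
have -> : (fun u : 'cV[R]_d => \prod_i h i (u i ord0)) =
    (fun t => (\1_(cube pi) t)%:C%C * expi (dot t (Zd_to_Rd R l))).
  apply/funext => u; rewrite big_split/= cubeE indic_box -expi_sum; congr (_ * expi _).
  by apply: eq_bigr => i _; rewrite mxE.
move=> ? ->; split=> //.
under eq_bigr do rewrite /h cintegral_character.
have [->|l0] := eqVneq l 0.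
  under eq_bigr do rewrite mxE eqxx.
  by rewrite prodr_const card_ord mul1r rmorphXn.
have [i li] : exists i, (l : 'cV[int]_d) i ord0 != 0.
  apply: contrapT => /forallNP H; move/eqP : l0; apply.
  by apply/colP => i; rewrite [RHS]mxE; apply/eqP/negPn/negP; exact: H.
by rewrite (bigD1 i)//= (negbTE li) mul0r mul0r.
Qed.

End boxes.

(** * The transfer operator and Birkhoff sums *)

Section transfer.
Context (R : realType) dX (X : measurableType dX) (mu : probability X R) (d : nat).
Variables (T : X -> X) (kappa : X -> Zd d) (P : (X -> R[i]) -> X -> R[i]).
Hypothesis mu_T : preserves mu T.
Hypothesis mkappa : measurable_fun setT kappa.
Hypothesis PT : transfer_operator mu T P.

Let mT : measurable_fun setT T. Proof. by case: mu_T. Qed.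

Lemma measurable_iter n : measurable_fun setT (iter n T).
Proof.
by elim: n => [|n IH]; [exact: measurable_id|exact: (measurableT_comp mT IH)].
Qed.

Definition birkhoff n (x : X) : Zd d := \sum_(k < n) kappa (iter k T x).

Lemma birkhoffS n x : birkhoff n.+1 x = birkhoff n x + kappa (iter n T x).
Proof. by rewrite /birkhoff big_ord_recr. Qed.

Lemma iter_extension n p :
  iter n (extension_map T kappa) p = (iter n T p.1, p.2 + birkhoff n p.1).
Proof.
elim: n => [|n IH]; first by rewrite /birkhoff big_ord0 addr0; case: p.
by rewrite iterS IH /extension_map /= birkhoffS addrA.
Qed.

Lemma measurable_Zd_add (f g : X -> Zd d) : measurable_fun setT f -> measurable_fun setT g ->
  measurable_fun setT (fun x => f x + g x).
Proof.
move=> mf mg; apply: measurable_fun_Zd => l.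
rewrite (_ : _ @^-1` _ = \bigcup_(m : Zd d) (f @^-1` [set m] `&` g @^-1` [set l - m])).
  apply: countable_bigcupT_measurable; first exact: countableP.
  by move=> m; apply: measurableI; exact: measurable_Zd_preimage.
apply/seteqP; split => x /=.
  by move=> <-; exists (f x) => //; split=> //=; rewrite addrC addKr.
by move=> [m _ [/= -> ->]]; rewrite addrC subrK.
Qed.

Lemma measurable_birkhoff n : measurable_fun setT (birkhoff n).
Proof.
elim: n => [|n IH].
  rewrite (_ : birkhoff 0 = cst 0); first exact: measurable_cst.
  by apply/funext => x; rewrite /birkhoff big_ord0.
rewrite (_ : birkhoff n.+1 = (fun x => birkhoff n x + kappa (iter n T x))).
  by apply: measurable_Zd_add => //; exact: measurableT_comp (measurable_iter n).
by apply/funext => x; rewrite birkhoffS.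
Qed.

Lemma measurable_Zd_to_Rd : measurable_fun [set: Zd d] (fun l => Zd_to_Rd R l).
Proof. by []. Qed.

Let phase n (t : 'cV[R]_d) x := expi (dot t (Zd_to_Rd R (birkhoff n x))).

Lemma cmeasurable_phase n t : cmeasurable (phase n t).
Proof.
apply: cmeasurable_expi; apply: measurable_dot; first exact: measurable_cst.
exact: (measurableT_comp measurable_Zd_to_Rd (measurable_birkhoff n)).
Qed.

Lemma cmeasurable_phase2 n : cmeasurable (fun p : 'cV[R]_d * X => phase n p.1 p.2).
Proof.
apply: cmeasurable_expi; apply: measurable_dot; first exact: measurable_fst.
apply: (measurableT_comp measurable_Zd_to_Rd).
exact: (measurableT_comp (measurable_birkhoff n) measurable_snd).
Qed.

Local Notation tw := (twisted P kappa).

Lemma twisted_integrable t f : cintegrable mu f -> cintegrable mu (tw t f).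
Proof.
move=> cf; have [] // := PT (f := fun x => expi (dot t (Zd_to_Rd R (kappa x))) * f x).
apply: (@cintegrable_bounded_mul _ _ _ _ _ _ 1) => //; last by move=> x; rewrite rnorm_expi.
have := cmeasurable_phase 1 t; rewrite /phase.
by under [X in cmeasurable X]eq_fun do rewrite birkhoffS /birkhoff big_ord0 add0r.
Qed.

Lemma twisted_iter_integrable n t f : cintegrable mu f -> cintegrable mu (iter n (tw t) f).
Proof. by move=> cf; elim: n => //= n IH; exact: twisted_integrable. Qed.

(** Iterating duality turns the twists into the phase of the Birkhoff sum. *)
Lemma twisted_iter_dual n t f phi : cintegrable mu f -> cmeasurable phi ->
  (exists K : R, forall x, rnorm (phi x) <= K) ->
  cintegral mu (fun x => iter n (tw t) f x * phi x) =
  cintegral mu (fun x => f x * (phase n t x * phi (iter n T x))).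
Proof.
move=> cf; elim: n phi => [|n IH] phi mphi [K phiK].
  congr cintegral; apply/funext => x.
  by rewrite /phase /birkhoff big_ord0 (_ : Zd_to_Rd R 0 = 0) ?dot0r ?expi0 ?mul1r//;
    apply/colP => i; rewrite !mxE.
have cfn := twisted_iter_integrable n t cf.
have mk : cmeasurable (fun x => expi (dot t (Zd_to_Rd R (kappa x)))).
  have := cmeasurable_phase 1 t; rewrite /phase.
  by under [X in cmeasurable X]eq_fun do rewrite birkhoffS /birkhoff big_ord0 add0r.
have cfn' : cintegrable mu (fun x => expi (dot t (Zd_to_Rd R (kappa x))) * iter n (tw t) f x).
  by apply: (@cintegrable_bounded_mul _ _ _ _ _ _ 1) => // x; rewrite rnorm_expi.
have [_ dual] := PT cfn'; rewrite [LHS]dual//; last by exists K.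
under [X in cintegral _ X]eq_fun do rewrite -mulrA mulrCA.
rewrite (IH (fun x => expi (dot t (Zd_to_Rd R (kappa x))) * phi (T x))).
- congr cintegral; apply/funext => x; congr (_ * _); rewrite mulrA; congr (_ * _).
  rewrite /phase birkhoffS -expiD -dotDr; congr (expi (dot t _)).
  by apply/colP => i; rewrite !mxE intrD.
- by apply: cmeasurableM => //; exact: cmeasurable_comp mT mphi.
- by exists K => x; rewrite rnormM rnorm_expi mul1r.
Qed.

Lemma twisted_iter_test_integrable n t f phi : cintegrable mu f -> cmeasurable phi ->
  (exists K : R, forall x, rnorm (phi x) <= K) ->
  cintegrable mu (fun x => f x * (phase n t x * phi (iter n T x))).
Proof.
move=> cf mphi [K phiK]; under eq_fun do rewrite mulrC.
apply: (@cintegrable_bounded_mul _ _ _ _ _ _ K) => //.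
  apply: cmeasurableM; first exact: cmeasurable_phase.
  exact: cmeasurable_comp (measurable_iter n) mphi.
by move=> x; rewrite rnormM rnorm_expi mul1r.
Qed.

(** The operators are given by duality only, so their linearity is recovered by
    testing. *)
Lemma twisted_iterZ n t (c : R[i]) f f' : cintegrable mu f -> cintegrable mu f' ->
  ae_eq mu setT f' (fun x => c * f x) ->
  ae_eq mu setT (iter n (tw t) f') (fun x => c * iter n (tw t) f x).
Proof.
move=> cf cf' ff'; apply: ae_eq_tests.
- exact: twisted_iter_integrable.
- by apply: cintegrableZ; exact: twisted_iter_integrable.
move=> phi mphi bphi; rewrite twisted_iter_dual//.
have -> : cintegral mu (fun x => c * iter n (tw t) f x * phi x) =
    c * cintegral mu (fun x => iter n (tw t) f x * phi x).
  rewrite -cintegralZ; first by congr cintegral; apply/funext => x; rewrite mulrA.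
  under eq_fun do rewrite mulrC; case: bphi => K phiK.
  exact: (cintegrable_bounded_mul _ (twisted_iter_integrable n t cf)).
have cfp := twisted_iter_test_integrable n t cf mphi bphi.
rewrite twisted_iter_dual// -cintegralZ//; apply: ae_eq_cintegral.
- exact: cintegrable_measurable (twisted_iter_test_integrable n t cf' mphi bphi).
- by apply: cmeasurableM; [exact: cmeasurable_cst|exact: cintegrable_measurable cfp].
- by apply: filterS ff' => x /= + xT => /(_ xT) ->; rewrite -mulrA.
Qed.

Section coefficient.
Variables (f g : X -> R[i]) (n : nat).
Hypothesis cf : cintegrable mu f.
Hypothesis mg : cmeasurable g.
Hypothesis cfg : forall t, cube pi t -> cintegrable mu (fun x => g x * iter n (tw t) f x).
Variable W : R.
Hypothesis cfgW : forall t, cube pi t -> \int[mu]_x rnorm (g x * iter n (tw t) f x) <= W.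

Definition pairing t : R[i] := cintegral mu (fun x => g x * iter n (tw t) f x).

Let tr N x : R := \1_[set x | rnorm (g x) <= N%:R] x.
Let gN N x : R[i] := (tr N x)%:C%C * g x.

Let mtr N : measurable_fun setT (tr N).
Proof.
apply: measurable_indic; rewrite -[X in measurable X]setTI.
by apply: measurable_fun_le => //; exact: measurable_rnorm.
Qed.

Let tr01 N x : 0 <= tr N x <= 1.
Proof. by rewrite /tr indicE; case: (_ \in _); rewrite /= ?lexx ?ler01. Qed.

Let gN_bound N x : rnorm (gN N x) <= N%:R.
Proof.
rewrite rnormM rnorm_real ger0_norm; last by case/andP: (tr01 N x).
rewrite /tr indicE.
have [/set_mem/= gxN|_] := boolP (x \in [set x | rnorm (g x) <= N%:R]).
  by rewrite mul1r.
by rewrite mul0r.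
Qed.

Let gN_le N x : rnorm (gN N x) <= rnorm (g x).
Proof.
have /andP[t0 t1] := tr01 N x.
by rewrite rnormM rnorm_real ger0_norm// ler_piMl ?rnorm_ge0.
Qed.

Let mgN N : cmeasurable (gN N).
Proof. by apply: cmeasurableM => //; exact: cmeasurable_real. Qed.

Let gN_cvg x (c : R[i]) : rnorm (gN N x * c - g x * c) @[N --> \oo] --> 0.
Proof.
apply: cvg_near_cst; near=> N.
rewrite /gN /tr indicE mem_set ?mul1r ?subrr ?rnorm0//=.
by near: N; exact: nbhs_infty_ger.
Unshelve. all: by end_near. Qed.

Let FN N t : R[i] := cintegral mu (fun x => iter n (tw t) f x * gN N x).

Let FN_cvg t : cube pi t -> rnorm (FN N t - pairing t) @[N --> \oo] --> 0.
Proof.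
move=> ct; apply: (cdominated_convergence (h := fun x => rnorm (g x * iter n (tw t) f x))).
- move=> N; apply: cmeasurableM => //.
  exact: cintegrable_measurable (twisted_iter_integrable n t cf).
- exact: cintegrable_measurable (cfg ct).
- exact: integrable_rnorm (cfg ct).
- by move=> N x; rewrite (mulrC _ (gN _ _)) [leLHS]rnormM [leRHS]rnormM ler_wpM2r ?rnorm_ge0.
- by [].
- apply: nearW => x; have := gN_cvg x (iter n (tw t) f x).
  by under eq_fun do rewrite (mulrC (gN _ x)).
Qed.

Let FN_bound N t : cube pi t -> rnorm (FN N t) <= W.
Proof.
move=> ct; apply: le_trans (cfgW ct); apply: le_rnorm_cintegral_bound.
- apply: cmeasurableM => //.
  exact: cintegrable_measurable (twisted_iter_integrable n t cf).
- exact: integrable_rnorm (cfg ct).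
- by move=> x; rewrite (mulrC _ (gN _ _)) [leLHS]rnormM [leRHS]rnormM ler_wpM2r ?rnorm_ge0.
Qed.

Let icube : (@lebesgue_Rd R d).-integrable setT (EFin \o (\1_(cube pi) : 'cV[R]_d -> R)).
Proof. by have [] := @lebesgue_cube R d pi (pi_ge0 R). Qed.

Let mcube : measurable (cube pi : set 'cV[R]_d).
Proof. exact: measurable_cube. Qed.

Let HN (m : Zd d) N (p : 'cV[R]_d * X) : R[i] :=
  ((\1_(cube pi) p.1)%:C%C * expi (- dot p.1 (Zd_to_Rd R m))) *
  (f p.2 * (phase n p.1 p.2 * gN N (iter n T p.2))).

Let cHN m N : cintegrable (@lebesgue_Rd R d \x mu)%E (HN m N).
Proof.
have c1 : cintegrable (@lebesgue_Rd R d) (fun t => (\1_(cube pi) t)%:C%C).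
  by apply: cintegrable_dominated icube _;
    [exact: cmeasurable_indic|move=> t; rewrite rnorm_real ger0_norm].
have c2 := cintegrable_prod c1 (cintegrableZ N%:R cf).
apply: cintegrable_dominated (integrable_rnorm c2) _.
- apply: cmeasurableM.
    have m1 : cmeasurable (fun t : 'cV[R]_d =>
        (\1_(cube pi) t)%:C%C * expi (- dot t (Zd_to_Rd R m))).
      apply: cmeasurableM; first exact: cmeasurable_indic.
      exact: cmeasurable_character.
    exact: (cmeasurable_comp measurable_fst m1).
  apply: cmeasurableM.
    exact: cmeasurable_comp measurable_snd (cintegrable_measurable cf).
  apply: cmeasurableM; first exact: cmeasurable_phase2.
  apply: (cmeasurable_comp _ (mgN N)).
  exact: (measurableT_comp (measurable_iter n) measurable_snd).
- move=> p; have gb := gN_bound N (iter n T p.2).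
  move: gb; rewrite /HN; move: (gN _ _) => z gb.
  rewrite !rnormM !rnorm_expi mulr1 mul1r ler_wpM2l ?rnorm_ge0//.
  rewrite mulrC ler_wpM2r ?rnorm_ge0// (le_trans gb)//.
  by rewrite -(rmorph_nat (real_complex R)) rnorm_real ger0_norm.
Qed.

Let gN_bounded N : exists K : R, forall x, rnorm (gN N x) <= K.
Proof. by exists N%:R; exact: gN_bound. Qed.

Let HN1 m N t : cintegral mu (fun x => HN m N (t, x)) =
  (\1_(cube pi) t)%:C%C * expi (- dot t (Zd_to_Rd R m)) * FN N t.
Proof.
rewrite /FN twisted_iter_dual// -cintegralZ//.
exact: twisted_iter_test_integrable.
Qed.

Let char_set m x : R := \1_[set x | birkhoff n x = m] x.

Let HN2 m N x : cintegral (@lebesgue_Rd R d) (fun t => HN m N (t, x)) =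
  ((2 * pi) ^+ d)%:C%C * ((char_set m x)%:C%C * (f x * gN N (iter n T x))).
Proof.
have [ct et] := @torus_character R d (birkhoff n x - m).
have -> : (fun t => HN m N (t, x)) = (fun t => (f x * gN N (iter n T x)) *
    ((\1_(cube pi) t)%:C%C * expi (dot t (Zd_to_Rd R (birkhoff n x - m))))).
  apply/funext => t; rewrite /HN /= /phase Zd_to_RdB dotDr dotNr expiD.
  by move: (expi _) (expi _) (_%:C%C) => e1 e2 e3; ring.
rewrite cintegralZ// et /char_set indicE subr_eq0.
have [xm|xm] := eqVneq (birkhoff n x) m.
  by rewrite mem_set// mul1r mul1r mulrC.
by rewrite memNset ?mul0r ?mulr0//; exact/eqP.
Qed.

Lemma pairing_measurable : cmeasurable (fun t => (\1_(cube pi) t)%:C%C * pairing t).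
Proof.
apply: (cmeasurable_cvg (u := fun N t => (\1_(cube pi) t)%:C%C * FN N t)).
  move=> N; have := cintegrable_measurable (cfubini1_integrable (cHN 0 N)).
  under [X in cmeasurable X]eq_fun do rewrite HN1.
  rewrite (_ : Zd_to_Rd R 0 = 0); last by apply/colP => i; rewrite !mxE.
  by under [X in cmeasurable X]eq_fun do rewrite dot0r oppr0 expi0 mulr1.
move=> t; have [ct|tc] := boolP (t \in cube pi); rewrite indicE.
  by rewrite ct/=; under eq_fun do rewrite !mul1r; exact/FN_cvg/set_mem.
by rewrite (negbTE tc)/=; under eq_fun do rewrite !mul0r subrr rnorm0; exact: cvg_cst.
Qed.

(** The distribution of the Birkhoff sum is recovered from the twisted operators
    by Fourier inversion on the torus.  Fubini's theorem is applied to bounded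
    truncations [gN] of [g], as [f * (g \o T ^ n)] need not be integrable away from
    the event that the Birkhoff sum is [m]; the truncation is then removed by
    dominated convergence, the bound [W] being uniform in the twist. *)
Lemma pairing_fourier (m : Zd d) :
  cintegrable mu (fun x => (\1_[set x | birkhoff n x = m] x)%:C%C * (f x * g (iter n T x))) ->
  cintegral (@lebesgue_Rd R d)
    (fun t => (\1_(cube pi) t)%:C%C * expi (- dot t (Zd_to_Rd R m)) * pairing t) =
  ((2 * pi) ^+ d)%:C%C *
    cintegral mu (fun x => (\1_[set x | birkhoff n x = m] x)%:C%C * (f x * g (iter n T x))).
Proof.
move=> cm.
have mbirk : measurable [set x | birkhoff n x = m].
  exact: (measurable_Zd_preimage [set m] (measurable_birkhoff n)).
have mchar : cmeasurable (fun t => (\1_(cube pi) t)%:C%C * expi (- dot t (Zd_to_Rd R m))).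
  apply: cmeasurableM; first exact: cmeasurable_indic.
  exact: cmeasurable_character.
apply: (@ccvg_unique R (fun N => cintegral (@lebesgue_Rd R d \x mu)%E (HN m N))).
  under eq_fun do rewrite (cfubini1 (cHN m _)).
  apply: (cdominated_convergence (h := fun t => W * \1_(cube pi) t)).
  - by move=> N; exact: cintegrable_measurable (cfubini1_integrable (cHN m N)).
  - rewrite (_ : (fun t => _) = (fun t => expi (- dot t (Zd_to_Rd R m)) *
      ((\1_(cube pi) t)%:C%C * pairing t))).
      apply: cmeasurableM; last exact: pairing_measurable.
      exact: cmeasurable_character.
    by apply/funext => t; rewrite mulrCA mulrA.
  - exact: (integrable_scaled _ icube).
  - move=> N t; rewrite HN1 !rnormM rnorm_expi mulr1 rnorm_real ger0_norm// mulrC.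
    have [ct|ct] := boolP (t \in cube pi); rewrite indicE.
      by rewrite ct/= !mulr1 FN_bound//; exact/set_mem.
    by rewrite (negbTE ct)/= !mulr0.
  - move=> t; rewrite !rnormM rnorm_expi mulr1 rnorm_real ger0_norm// mulrC.
    have [ct|ct] := boolP (t \in cube pi); rewrite indicE.
      rewrite ct/= !mulr1 (le_trans _ (cfgW (set_mem ct)))//.
      exact: le_rnorm_cintegral (cfg (set_mem ct)).
    by rewrite (negbTE ct)/= !mulr0.
  - apply: nearW => t; under eq_fun do rewrite HN1 -mulrBr rnormM.
    have [/set_mem ct|ct] := boolP (t \in cube pi).
      rewrite -(mulr0 (rnorm ((\1_(cube pi) t)%:C%C * expi (- dot t (Zd_to_Rd R m))))).
      by apply: cvgM; [exact: cvg_cst|exact: FN_cvg].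
    under eq_fun do rewrite indicE (negbTE ct) mul0r rnorm0 mul0r.
    exact: cvg_cst.
under eq_fun do rewrite (cfubini2 (cHN m _)).
under eq_fun do under [X in cintegral _ X]eq_fun do rewrite HN2.
rewrite -cintegralZ//.
apply: (cdominated_convergence (h := fun x => ((2 * pi) ^+ d) *
  rnorm ((\1_[set x | birkhoff n x = m] x)%:C%C * (f x * g (iter n T x))))).
- move=> N; apply: cmeasurableM; first exact: cmeasurable_cst.
  apply: cmeasurableM; first exact: cmeasurable_indic.
  apply: cmeasurableM; first exact: cintegrable_measurable cf.
  exact: cmeasurable_comp (measurable_iter n) (mgN N).
- by apply: cmeasurableM; [exact: cmeasurable_cst|exact: cintegrable_measurable cm].
- exact: (integrable_scaled _ (integrable_rnorm cm)).
- move=> N x; have := gN_le N (iter n T x); move: (gN _ _) => z zg.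
  rewrite !rnormM rnorm_real ger0_norm ?exprn_ge0 ?mulr_ge0 ?pi_ge0//.
  rewrite ler_wpM2l ?exprn_ge0 ?mulr_ge0 ?pi_ge0// ler_wpM2l ?rnorm_ge0//.
  by rewrite ler_wpM2l ?rnorm_ge0.
- by move=> x; rewrite rnormM rnorm_real ger0_norm ?exprn_ge0 ?mulr_ge0 ?pi_ge0.
- apply: nearW => x.
  have := gN_cvg (iter n T x) (((2 * pi) ^+ d)%:C%C * ((\1_[set x | birkhoff n x = m] x)%:C%C * f x)).
  have E (z : R[i]) : z * (((2 * pi) ^+ d)%:C%C * ((\1_[set x | birkhoff n x = m] x)%:C%C * f x)) =
    ((2 * pi) ^+ d)%:C%C * ((\1_[set x | birkhoff n x = m] x)%:C%C * (f x * z)).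
    by move: (_%:C%C) (_%:C%C) => e1 e2; ring.
  by under [X in X @ _ --> _]eq_fun do rewrite !E.
Qed.

End coefficient.
End transfer.

(** * Growth of the determinants *)

Section growth.
Context (R : realType) (d : nat) (b theta : R).
Variables (lam a : 'cV[R]_d -> R[i]) (Theta : nat -> 'M[R]_d).
Local Notation lebd := (@lebesgue_Rd R d).
Hypothesis b_gt0 : 0 < b.
Hypothesis theta_range : 0 < theta < 1.
Hypothesis lam_cvg : (lam : 'cV[R]_d -> R[i]^o) @ (0 : 'cV[R]_d)^' --> (1 : R[i]^o).
Hypothesis a0 : a 0 = 1.
Hypothesis ca : cintegrable lebd a.
Hypothesis Theta_unit : forall n, (0 < n)%N -> Theta n \in unitmx.
Hypothesis lam_bound : forall n u, (0 < n)%N -> cube b u ->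
  rnorm (lam u ^+ n) <= 2 * rnorm (a ((Theta n)^T *m u)).

Lemma dnbhs0_cube (P : 'cV[R]_d -> Prop) : (\forall t \near (0 : 'cV[R]_d)^', P t) ->
  exists2 r, 0 < r & forall t, cube r t -> t != 0 -> P t.
Proof.
rewrite /dnbhs/= => /nbhs_ballP[e /= e0 He]; exists (e / 2); first by rewrite divr_gt0.
move=> t ct t0; apply: He => //; split => // i j; rewrite /ball/= mxE sub0r normrN.
by rewrite ord1 (le_lt_trans (ct i))// ltr_pdivrMr// ltr_pMr// ltr1n.
Qed.

Lemma lam_lower : exists2 r, 0 < r <= b &
  forall t, cube r t -> t != 0 -> (1 + theta) / 2 <= rnorm (lam t).
Proof.
have /andP[t0 t1] := theta_range.
have e0 : 0 < (1 - theta) / 2 by lra.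
have H := (cvgr0Pnorm_lt _).1 ((cvg_rnorm0 _ _ _).1 lam_cvg).
have [r r0 Hr] := dnbhs0_cube (H _ _ _ e0).
exists (Num.min r b); first by rewrite lt_min r0 b_gt0 ge_min lexx orbT.
move=> t ct tn0.
have /Hr/(_ tn0) : cube r t by move=> i; rewrite (le_trans (ct i))// ge_min lexx.
rewrite ger0_norm ?rnorm_ge0// => H1.
have := rnorm_dist (1 : R[i]) (lam t); rewrite rnorm1 rnormBC; lra.
Qed.

(** By the lower bound on [lam] near the origin, [a] composed with the
    transpose of [Theta n] is at least [((1 + theta) / 2) ^+ n / 2] on a fixed
    cube; as its integral is that of [a] divided by the determinant, the
    determinant grows more slowly than [theta ^- n]. *)
Lemma det_bound : exists Q q, [/\ 0 <= Q, 0 <= q < 1 &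
  forall n, (0 < n)%N -> `|\det (Theta n)| * theta ^+ n <= Q * q ^+ n].
Proof.
have /andP[t0 t1] := theta_range.
have [r /andP[r0 rb] Hr] := lam_lower.
set th := (1 + theta) / 2 in Hr; have th0 : 0 < th by rewrite /th; lra.
pose A := \int[lebd]_u rnorm (a u).
have A0 : 0 <= A by apply: Rintegral_ge0 => u _; exact: rnorm_ge0.
have r2 : 0 < (2 * r) ^+ d by rewrite exprn_gt0// mulr_gt0.
exists (2 * A / (2 * r) ^+ d), (theta / th); split.
- by apply: divr_ge0; [exact: mulr_ge0|exact: ltW].
- by rewrite divr_ge0 ?ltW//= ltr_pdivrMr// mul1r /th; lra.
move=> n n0.
have tr : transports lebd lebd `|\det (Theta n)| (mulmx (Theta n)^T).
  by rewrite -det_tr; apply: transports_linear; rewrite unitmx_tr Theta_unit.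
have ia := integrable_rnorm ca.
have low t : cube r t -> th ^+ n <= 2 * rnorm (a ((Theta n)^T *m t)).
  move=> ct; have [->|tn0] := eqVneq t 0.
    rewrite mulmx0 a0 rnorm1 mulr1 (@le_trans _ _ 1)// ?ler1n//.
    by rewrite exprn_ile1 ?ltW// /th; lra.
  rewrite (le_trans _ (lam_bound n0 _))//; last first.
    by move=> i; rewrite (le_trans (ct i)).
  by rewrite rnormX lerXn2r ?nnegrE ?rnorm_ge0 ?Hr// ltW.
have [ir er] := lebesgue_cube d (ltW r0).
have H : th ^+ n * (2 * r) ^+ d <= 2 * \int[lebd]_t rnorm (a ((Theta n)^T *m t)).
  have i2 := transports_integrable tr ia.
  rewrite -er -!RintegralZl//; apply: le_Rintegral => //.
  - exact: integrable_scaled.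
  - exact: (integrable_scaled _ i2).
  move=> t _; rewrite indicE; have [/set_mem ct|_] := boolP (t \in _).
    by rewrite mulr1 low.
  by rewrite mulr0 mulr_ge0 ?rnorm_ge0.
have eA : A = `|\det (Theta n)| * \int[lebd]_t rnorm (a ((Theta n)^T *m t)).
  exact: (transports_Rintegral tr ia).
have -> : `|\det (Theta n)| * theta ^+ n = `|\det (Theta n)| * th ^+ n * (theta / th) ^+ n.
  by rewrite -mulrA -exprMn [th * _]mulrC divfK ?gt_eqF.
apply: ler_wpM2r; first by rewrite exprn_ge0// divr_ge0// ltW.
by rewrite ler_pdivlMr// eA mulrCA -mulrA ler_wpM2l.
Qed.

End growth.

(** * Dominated convergence up to a vanishing remainder *)

Section remainder.
Context (R : realType) dX (X : measurableType dX) (m : {measure set X -> \bar R}).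

(** The functions [r n] need not be dominated by an integrable function, but
    their integrals vanish in the limit; ordinary dominated convergence applies
    to the positive part of [rnorm (F n - f) - r n]. *)
Lemma cdominated_remainder (F : nat -> X -> R[i]) f (h : X -> R) (r : nat -> X -> R) :
  (forall n, cmeasurable (F n)) -> cmeasurable f ->
  m.-integrable setT (EFin \o h) -> (forall n, m.-integrable setT (EFin \o r n)) ->
  (forall n x, 0 <= r n x) -> \int[m]_x r n x @[n --> \oo] --> 0 ->
  (forall n x, rnorm (F n x) <= h x + r n x) -> (forall x, rnorm (f x) <= h x) ->
  {ae m, forall x, rnorm (F n x - f x) @[n --> \oo] --> 0} ->
  rnorm (cintegral m (F n) - cintegral m f) @[n --> \oo] --> 0.
Proof.
move=> mF mf ih ir r0 ir0 Fh fh Ff.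
have ihr n : m.-integrable setT (EFin \o (fun x => h x + r n x)).
  by have := integrableD measurableT ih (ir n).
have cF n := cintegrable_dominated (mF n) (ihr n) (Fh n).
have cf := cintegrable_dominated mf ih fh.
have iD n := integrable_rnorm (cintegrableB (cF n) cf).
pose u n x := Num.max 0 (rnorm (F n x - f x) - r n x).
have u0 n x : 0 <= u n x by rewrite le_max lexx.
have mr n : measurable_fun setT (r n) by apply/measurable_EFinP; exact: measurable_int (ir n).
have mD n : measurable_fun setT (fun x => rnorm (F n x - f x)).
  by apply: measurable_rnorm; exact: cmeasurableB.
have mu_ n : measurable_fun setT (u n).
  by apply: measurable_maxr; [exact: measurable_cst|exact: measurable_funB].
have uh n x : `|u n x| <= h x + h x.
  rewrite ger0_norm// ge_max addr_ge0 ?(le_trans (rnorm_ge0 _) (fh x))//=.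
  have := rnormB_le (F n x) (f x); have := Fh n x; have := fh x; lra.
have i2h : m.-integrable setT (EFin \o (fun x => h x + h x)).
  by have := integrableD measurableT ih ih.
have iu n : m.-integrable setT (EFin \o u n) by exact: integrable_dominated (uh n).
have uc : \int[m]_x `|u n x| @[n --> \oo] --> 0.
  apply: (@dominated_cvg0 _ _ _ _ u (fun x => h x + h x)) => //.
  apply: filterS Ff => x; apply: squeeze_cvgr (cvg_cst 0).
  apply: nearW => n; rewrite u0 ge_max rnorm_ge0/=.
  by have := r0 n x; lra.
apply: (@squeeze_cvgr _ _ _ _ (cst 0)
  (fun n => \int[m]_x `|u n x| + \int[m]_x r n x)); [|exact: cvg_cst|]; last first.
  by rewrite -[X in _ --> X](addr0 0); apply: cvgD.
apply: nearW => n; rewrite rnorm_ge0/= -cintegralB//.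
apply: (le_trans (le_rnorm_cintegral (cintegrableB (cF n) cf))).
rewrite -RintegralD//; last exact: (integrable_norm (iu n)).
apply: le_Rintegral => //.
  by have := integrableD measurableT (integrable_norm (iu n)) (ir n).
move=> x _; rewrite ger0_norm// -lerBlDr /u le_max lexx orbT//.
Qed.

End remainder.

Section complex_limits.
Context (R : realType).
Implicit Types u v : nat -> R[i].

Lemma rcvgD u v a b : rnorm (u n - a) @[n --> \oo] --> 0 -> rnorm (v n - b) @[n --> \oo] --> 0 ->
  rnorm (u n + v n - (a + b)) @[n --> \oo] --> 0.
Proof.
move=> /(cvg_rnorm0 (V := R[i]^o) _ _ _) ua /(cvg_rnorm0 (V := R[i]^o) _ _ _) vb.
by apply/(cvg_rnorm0 (V := R[i]^o) _ _ _); exact: cvgD ua vb.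
Qed.

Lemma rcvgM u v a b : rnorm (u n - a) @[n --> \oo] --> 0 -> rnorm (v n - b) @[n --> \oo] --> 0 ->
  rnorm (u n * v n - a * b) @[n --> \oo] --> 0.
Proof.
move=> /(cvg_rnorm0 (V := R[i]^o) _ _ _) ua /(cvg_rnorm0 (V := R[i]^o) _ _ _) vb.
by apply/(cvg_rnorm0 (V := R[i]^o) _ _ _); exact: (@cvgM _ _ _ _ u v a b ua vb).
Qed.

Lemma expi_cvg (s : nat -> R) (l : R) : s n @[n --> \oo] --> l ->
  rnorm (expi (s n) - expi l) @[n --> \oo] --> 0.
Proof.
move=> sl; apply: (@squeeze_cvgr _ _ _ _ (cst 0)
  (fun n => `|cos (s n) - cos l| + `|sin (s n) - sin l|)); [|exact: cvg_cst|].
  by apply: nearW => n; rewrite rnorm_ge0 rnorm_le_ReIm.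
have c : cos (s n) - cos l @[n --> \oo] --> 0.
  by apply/subr_cvg0; apply: continuous_cvg; [exact: continuous_cos|exact: sl].
have c' : sin (s n) - sin l @[n --> \oo] --> 0.
  by apply/subr_cvg0; apply: continuous_cvg; [exact: continuous_sin|exact: sl].
rewrite -[X in _ --> X](addr0 0); apply: cvgD.
  by rewrite -[X in _ --> X](@normr0 _ R); exact: cvg_norm.
by rewrite -[X in _ --> X](@normr0 _ R); exact: cvg_norm.
Qed.

End complex_limits.

(** * Local limit theorem for a pair of observables *)

Section spectral.
Context (R : realType) (d : nat) (dX : measure_display) (X : measurableType dX).
Context (mu : probability X R) (T : X -> X) (mu_T : preserves mu T).
Context (kappa : X -> Zd d) (kappa_meas : measurable_fun setT kappa).
Context (P : (X -> R[i]) -> X -> R[i]) (P_transfer : transfer_operator mu T P).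
Context (B B0 : completeNormedModType R[i]) (inc : {linear B -> B0}).
Context (emb : B0 -> X -> R[i]) (b C theta : R).
Context (lam : 'cV[R]_d -> R[i]) (Pi Rem : 'cV[R]_d -> {linear B -> B}).
Hypothesis hypA : spectral_hypotheses mu P kappa inc emb b C theta lam Pi Rem.
Variables K Qd q : R.
Hypothesis d_gt0 : (0 < d)%N.
Hypothesis K_ge0 : 0 <= K.
Hypothesis Pi_K : forall u, cube b u ->
  (op_norm mu emb (fun h : B => emb (inc (Pi u h))) <= K%:E)%E.
Context (dO : measure_display) (Omega : measurableType dO) (Q : probability Omega R).
Context (Y : {mfun Omega >-> 'cV[R]_d}) (psi : 'cV[R]_d -> R[i]).
Context (Phi : 'cV[R]_d -> R) (Theta : nat -> 'M[R]_d).
Hypothesis hypB : asymptotic_hypotheses b lam Q Y psi Phi Theta.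

Hypothesis Qd_ge0 : 0 <= Qd.
Hypothesis q_range : 0 <= q < 1.
Hypothesis det_Qd : forall n, (0 < n)%N -> `|\det (Theta n)| * theta ^+ n <= Qd * q ^+ n.

Local Notation lebd := (@lebesgue_Rd R d).
Local Notation tw := (twisted P kappa).
Let a u := cexp (- psi u).

Lemma integral_probability1 : \int[Q]_w (1 : R) = 1.
Proof.
by rewrite /Rintegral integral_cst// mul1e; exact: (congr1 fine (probability_setT Q)).
Qed.

Lemma charfun0 : cexp (- psi 0) = 1 :> R[i].
Proof.
rewrite -(charfun hypB).
have -> : (fun w => expi (dot 0 (Y w))) = (fun=> 1 : R[i]).
  by apply/funext => w; rewrite /dot big1 ?expi0// => i _; rewrite mxE mul0r.
by apply: complex_ext; rewrite /= ?integral_probability1// /Rintegral integral0.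
Qed.

Lemma charfun_le1 u : rnorm (cexp (- psi u)) <= 1.
Proof.
rewrite -(charfun hypB).
rewrite -integral_probability1; apply: le_rnorm_cintegral_bound.
- apply: cmeasurable_expi; apply: measurable_dot; first exact: measurable_cst.
  exact: measurable_funP.
- exact: finite_measure_integrable_cst.
- by move=> w; rewrite rnorm_expi.
Qed.

Let L1 := emb_L1 hypA.

Lemma emb_inc_integrable v : cintegrable mu (emb (inc v)).
Proof. exact: (L1_emb_integrable L1). Qed.

Lemma emb_incZ (c : R[i]) v :
  ae_eq mu setT (emb (inc (c *: v))) (fun x => c * emb (inc v) x).
Proof. by rewrite linearZ; exact: (embZ L1). Qed.

Lemma twisted_ae u (f f' : X -> R[i]) : cintegrable mu f -> cintegrable mu f' ->
  ae_eq mu setT f' f -> ae_eq mu setT (tw u f') (tw u f).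
Proof.
move=> cf cf' ff'.
have := twisted_iterZ mu_T kappa_meas P_transfer 1 u (c := 1) cf cf'.
rewrite /= => H; have {}H : ae_eq mu setT (tw u f') (fun x => 1 * tw u f x).
  by apply: H; apply: filterS ff' => x /= + xT => /(_ xT) ->; rewrite mul1r.
by apply: filterS H => x /= + xT => /(_ xT) ->; rewrite mul1r.
Qed.

(** The cross terms vanish because [Pi u] and [Rem u] annihilate each other. *)
Lemma twisted_decomposition u n v : cube b u -> (0 < n)%N ->
  ae_eq mu setT (iter n (tw u) (emb (inc v)))
    (emb (inc (lam u ^+ n *: Pi u v + iter n (Rem u) v))).
Proof.
move=> cu; case: n => // n _; elim: n => [|n IH].
  by rewrite expr1; exact: (spectral_decomposition hypA cu v).
rewrite iterS.
have cn := twisted_iter_integrable mu_T kappa_meas P_transfer n.+1 u (emb_inc_integrable v).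
apply: ae_eq_trans (twisted_ae u (emb_inc_integrable _) cn IH) _.
apply: ae_eq_trans (spectral_decomposition hypA cu _) _.
set w := _ *: _ + iter _ _ _.
have -> : lam u *: Pi u w + Rem u w = lam u ^+ n.+2 *: Pi u v + iter n.+2 (Rem u) v.
  rewrite /w !linearD !linearZ/= (Pi_idempotent hypA cu) (Pi_Rem hypA cu) (Rem_Pi hypA cu).
  by rewrite !scaler0 addr0 add0r scalerA -exprSr.
exact: ae_eq_refl.
Qed.

Lemma Rem_le n u v : cube b u -> rnorm (inc (iter n (Rem u) v)) <= C * theta ^+ n * rnorm v.
Proof.
move=> cu; have lin (c : R[i]) w : iter n (Rem u) (c *: w) = c *: iter n (Rem u) w.
  by elim: n => //= n ->; rewrite linearZ.
have [|w ew wK] := op_norm_le L1 _ (Rem_bound hypA n cu) v.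
  by move=> c h; rewrite lin; exact: emb_incZ.
by rewrite -(emb_inj L1 ew (ae_eq_refl _ _ _)).
Qed.

Lemma Pi_le u v : cube b u -> rnorm (inc (Pi u v)) <= K * rnorm v.
Proof.
move=> cu; have [|w ew wK] := op_norm_le L1 _ (Pi_K cu) v.
  by move=> c h; rewrite linearZ; exact: emb_incZ.
by rewrite -(emb_inj L1 ew (ae_eq_refl _ _ _)).
Qed.

Lemma theta_ge0 n : 0 <= C * theta ^+ n.
Proof.
have /andP[t0 _] := theta_range hypA.
by rewrite mulr_ge0 ?exprn_ge0 ?ltW// (C_gt0 hypA).
Qed.

Lemma theta_le n : C * theta ^+ n <= C.
Proof.
have /andP[t0 t1] := theta_range hypA.
apply: ler_piMr; first exact/ltW/(C_gt0 hypA).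
by rewrite exprn_ile1// ltW.
Qed.

Lemma twisted_outside n u v : cube pi u -> ~ cube b u ->
  exists2 w, ae_eq mu setT (emb w) (iter n (tw u) (emb (inc v))) &
    rnorm w <= C * theta ^+ n * rnorm v.
Proof.
move=> cu cbu; apply: (op_norm_le L1 _ (twisted_bound hypA n (conj cu cbu))) => c h.
apply: (twisted_iterZ mu_T kappa_meas P_transfer); [exact: emb_inc_integrable..|].
exact: emb_incZ.
Qed.

Lemma twisted_rep n u v : (0 < n)%N -> cube pi u ->
  exists2 w, ae_eq mu setT (emb w) (iter n (tw u) (emb (inc v))) &
    rnorm w <= (2 * K + C) * rnorm v.
Proof.
move=> n0 cu; have [cb|cb] := pselect (cube b u); last first.
  have [w ew wC] := twisted_outside n v cu cb; exists w => //.
  rewrite (le_trans wC)// ler_wpM2r ?rnorm_ge0// (le_trans (theta_le n))//.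
  by rewrite lerDr mulr_ge0.
exists (inc (lam u ^+ n *: Pi u v + iter n (Rem u) v)).
  by apply: ae_eq_sym; exact: twisted_decomposition.
rewrite linearD (le_trans (rnormD _ _))// mulrDl lerD//.
  rewrite linearZ rnormZ -mulrA ler_pM ?rnorm_ge0 ?Pi_le//.
  rewrite (le_trans (lam_bound hypB n0 cb))// -[leRHS]mulr1 ler_wpM2l//.
  exact: charfun_le1.
by rewrite (le_trans (Rem_le n v cb))// ler_wpM2r ?rnorm_ge0// theta_le.
Qed.

Section pair.
Variables (g : X -> R[i]) (D : R).
Hypothesis mg : cmeasurable g.
Hypothesis cg : forall h, cintegrable mu (fun x => g x * emb h x).
Hypothesis D_ge0 : 0 <= D.
Hypothesis gD : (dual_norm mu emb g <= D%:E)%E.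
Variable v : B.

Let pt n t := pairing mu kappa P (emb (inc v)) g n t.
Let dual h := cintegral mu (fun x => g x * emb h x).

Let dual_le h : rnorm (dual h) <= D * rnorm h.
Proof. by rewrite /dual; exact: (dual_norm_le L1). Qed.

Let citer n t : cintegrable mu (iter n (tw t) (emb (inc v))).
Proof.
exact: (twisted_iter_integrable mu_T kappa_meas P_transfer n t (emb_inc_integrable v)).
Qed.

Let pt_dual n t w : ae_eq mu setT (emb w) (iter n (tw t) (emb (inc v))) -> pt n t = dual w.
Proof. exact: (cintegral_dual mg cg (cintegrable_measurable (citer n t))). Qed.

Lemma pairing_inside n t : (0 < n)%N -> cube b t ->
  pt n t = lam t ^+ n * dual (inc (Pi t v)) + dual (inc (iter n (Rem t) v)).
Proof.
move=> n0 ct; have := twisted_decomposition v ct n0 => /ae_eq_sym/pt_dual ->.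
by rewrite linearD linearZ /dual (cintegral_dualD L1 cg) (cintegral_dualZ L1 cg).
Qed.

(** Inside the cube of radius [b] the leading term carries the characteristic
    function; the remainder there and the whole pairing outside are of order
    [theta ^+ n]. *)
Lemma pairing_le n t : (0 < n)%N -> cube pi t ->
  rnorm (pt n t) <= D * rnorm v *
    (2 * K * rnorm (cexp (- psi ((Theta n)^T *m t))) + C * theta ^+ n).
Proof.
move=> n0 cu; have [cb|cb] := pselect (cube b t); last first.
  have [w ew wC] := twisted_outside n v cu cb; rewrite (pt_dual ew) (le_trans (dual_le _))//.
  rewrite -mulrA ler_wpM2l// (le_trans wC)// mulrC ler_wpM2l ?rnorm_ge0// lerDr.
  by rewrite !mulr_ge0// rnorm_ge0.
rewrite pairing_inside// (le_trans (rnormD _ _))// mulrDr lerD//.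
  rewrite rnormM; set z := rnorm (cexp _).
  have -> : D * rnorm v * (2 * K * z) = (2 * z) * (D * (K * rnorm v)) by ring.
  rewrite ler_pM ?rnorm_ge0// ?(lam_bound hypB)//.
  by rewrite (le_trans (dual_le _))// ler_wpM2l// Pi_le.
by rewrite (le_trans (dual_le _))// -mulrA ler_wpM2l// [leRHS]mulrC Rem_le.
Qed.

Let cpairing n t : (0 < n)%N -> cube pi t ->
  cintegrable mu (fun x => g x * iter n (tw t) (emb (inc v)) x).
Proof.
move=> n0 ct; have [w ew _] := twisted_rep v n0 ct.
apply: ae_eq_cintegrable (cg w); last exact: ae_eqM.
by apply: cmeasurableM => //; exact: cintegrable_measurable.
Qed.

Let pairing_Rintegral : exists W : R, forall n t, (0 < n)%N -> cube pi t ->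
  \int[mu]_x rnorm (g x * iter n (tw t) (emb (inc v)) x) <= W.
Proof.
have [Kp HKp] := pairing_bounded L1 mg cg.
exists (`|Kp| * ((2 * K + C) * rnorm v)) => n t n0 ct.
have [w ew wK] := twisted_rep v n0 ct.
have -> : \int[mu]_x rnorm (g x * iter n (tw t) (emb (inc v)) x) =
    \int[mu]_x rnorm (g x * emb w x).
  congr fine; apply: ae_eq_integral => //.
  - apply/measurable_EFinP; apply: measurable_rnorm.
    exact: cintegrable_measurable (cpairing n0 ct).
  - by apply/measurable_EFinP; apply: measurable_rnorm; exact: cintegrable_measurable (cg w).
  - by apply: filterS ew => x /= + xT => /(_ xT) ->.
rewrite (le_trans (HKp w))// (@le_trans _ _ (`|Kp| * rnorm w))//.
  by rewrite ler_wpM2r ?rnorm_ge0// ler_norm.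
by rewrite ler_wpM2l.
Qed.

Let kernel n (m : Zd d) (t : 'cV[R]_d) : R[i] :=
  (\1_(cube pi) t)%:C%C * expi (- dot t (Zd_to_Rd R m)) * pt n t.

Let coefficient n (m : Zd d) : R[i] :=
  cintegral mu (fun x => (\1_[set x | birkhoff T kappa n x = m] x)%:C%C *
    (emb (inc v) x * g (iter n T x))).

Let mkernel n m : (0 < n)%N -> cmeasurable (kernel n m).
Proof.
move=> n0.
have H : cmeasurable (fun t : 'cV[R]_d => (\1_(cube pi) t)%:C%C * pt n t).
  apply: (pairing_measurable mu_T kappa_meas P_transfer (emb_inc_integrable v) mg).
  by move=> t ct; exact: cpairing.
have -> : kernel n m = (fun t => expi (- dot t (Zd_to_Rd R m)) *
    ((\1_(cube pi) t)%:C%C * pt n t)).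
  by apply/funext => t; rewrite /kernel mulrCA mulrA.
apply: cmeasurableM => //; exact: cmeasurable_character.
Qed.

Let kernel_le n m t : (0 < n)%N -> rnorm (kernel n m t) <=
  D * rnorm v * (2 * K) * rnorm (cexp (- psi ((Theta n)^T *m t))) +
  D * rnorm v * (C * theta ^+ n) * \1_(cube pi) t.
Proof.
move=> n0.
have -> : rnorm (kernel n m t) = \1_(cube pi) t * rnorm (pt n t).
  by rewrite /kernel !rnormM rnorm_expi mulr1 rnorm_real ger0_norm.
have [ct|ct] := boolP (t \in cube pi); rewrite indicE.
  rewrite ct/= mul1r mulr1 (le_trans (pairing_le n0 (set_mem ct)))//.
  by rewrite mulrDr mulrA.
by rewrite (negbTE ct)/= mul0r mulr0 addr0 !mulr_ge0 ?rnorm_ge0.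
Qed.

Let iA (u : 'cV[R]_d) n : (0 < n)%N -> (Theta n)^T *m ((invmx (Theta n))^T *m u) = u.
Proof.
by move=> n0; rewrite mulmxA -trmx_mul mulVmx ?(Theta_unit hypB)// trmx1 mul1mx.
Qed.

Let trA n : (0 < n)%N ->
  transports lebd lebd `|\det (Theta n)|^-1 (mulmx (invmx (Theta n))^T).
Proof.
move=> n0; rewrite -normfV -det_inv -det_tr; apply: transports_linear.
by rewrite unitmx_tr unitmx_inv (Theta_unit hypB).
Qed.

Let det_gt0 n : (0 < n)%N -> 0 < `|\det (Theta n)|.
Proof. by move=> n0; rewrite normr_gt0 -unitfE -unitmxE (Theta_unit hypB). Qed.

Let icube : lebd.-integrable setT (EFin \o (\1_(cube pi) : 'cV[R]_d -> R)).
Proof. by have [] := lebesgue_cube d (pi_ge0 R). Qed.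

Let ia : lebd.-integrable setT (EFin \o (fun u : 'cV[R]_d => rnorm (cexp (- psi u)))).
Proof. exact: integrable_rnorm (charfun_integrable hypB). Qed.

Let scale n m (u : 'cV[R]_d) := kernel n m ((invmx (Theta n))^T *m u).
Let bound (u : 'cV[R]_d) := D * rnorm v * (2 * K) * rnorm (cexp (- psi u)).
Let remainder n (u : 'cV[R]_d) : R :=
  D * rnorm v * (C * theta ^+ n) * \1_(cube pi) ((invmx (Theta n))^T *m u).

Let ibound : lebd.-integrable setT (EFin \o bound).
Proof. exact: integrable_scaled. Qed.

Let scale_le n m u : (0 < n)%N -> rnorm (scale n m u) <= bound u + remainder n u.
Proof. by move=> n0; rewrite /scale (le_trans (kernel_le _ _ n0))// iA. Qed.

Let iremainder n : (0 < n)%N -> lebd.-integrable setT (EFin \o remainder n).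
Proof.
move=> n0; have := transports_integrable (trA n0) icube => i1.
exact: (integrable_scaled _ i1).
Qed.

Let remainder_ge0 n u : 0 <= remainder n u.
Proof.
apply: mulr_ge0 => //; apply: mulr_ge0; last exact: theta_ge0.
by rewrite mulr_ge0 ?rnorm_ge0.
Qed.

Let remainder_integral n : (0 < n)%N ->
  \int[lebd]_u remainder n u <= D * rnorm v * (C * (2 * pi) ^+ d * Qd) * q ^+ n.
Proof.
move=> n0; have i1 := transports_integrable (trA n0) icube.
rewrite RintegralZl//.
have [_ ec] := lebesgue_cube d (pi_ge0 R).
have := transports_Rintegral (trA n0) icube; rewrite ec => H.
have -> : \int[lebd]_x (\1_(cube pi) \o mulmx (invmx (Theta n))^T) x =
    `|\det (Theta n)| * (2 * pi) ^+ d.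
  by rewrite H mulrA mulfV ?mul1r// gt_eqF// det_gt0.
have -> : D * rnorm v * (C * theta ^+ n) * (`|\det (Theta n)| * (2 * pi) ^+ d) =
  D * rnorm v * (C * (2 * pi) ^+ d) * (`|\det (Theta n)| * theta ^+ n) by ring.
have -> : D * rnorm v * (C * (2 * pi) ^+ d * Qd) * q ^+ n =
  D * rnorm v * (C * (2 * pi) ^+ d) * (Qd * q ^+ n) by ring.
apply: ler_wpM2l; last exact: det_Qd.
by rewrite !mulr_ge0 ?rnorm_ge0 ?exprn_ge0 ?mulr_ge0 ?pi_ge0// ltW// (C_gt0 hypA).
Qed.

Let mscale n m : (0 < n)%N -> cmeasurable (scale n m).
Proof. by move=> n0; have [_ mA _] := trA n0; exact: cmeasurable_comp mA (mkernel m n0). Qed.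

Let ihr n : (0 < n)%N -> lebd.-integrable setT (EFin \o (fun u => bound u + remainder n u)).
Proof. by move=> n0; have := integrableD measurableT ibound (iremainder n0). Qed.

Let ckernel n m : (0 < n)%N -> cintegrable lebd (kernel n m).
Proof.
move=> n0; apply: cintegrable_dominated (mkernel m n0) _ (fun t => kernel_le m t n0).
have trT : transports lebd lebd `|\det (Theta n)| (mulmx (Theta n)^T).
  by rewrite -det_tr; apply: transports_linear; rewrite unitmx_tr (Theta_unit hypB).
have i1 := transports_integrable trT ibound.
have i2 : lebd.-integrable setT
    (EFin \o (fun t : 'cV[R]_d => D * rnorm v * (C * theta ^+ n) * \1_(cube pi) t)).
  exact: (integrable_scaled _ icube).
by have := integrableD measurableT i1 i2.
Qed.

(** The substitution of the inverse transpose of [Theta n] multiplies Lebesgue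
    measure by the determinant and turns the bound by the characteristic function
    into a bound that does not depend on [n]. *)
Lemma coefficient_scale n m : (0 < n)%N ->
  cintegrable mu (fun x => (\1_[set x | birkhoff T kappa n x = m] x)%:C%C *
    (emb (inc v) x * g (iter n T x))) ->
  (`|\det (Theta n)| * (2 * pi) ^+ d)%:C%C * coefficient n m = cintegral lebd (scale n m).
Proof.
move=> n0 cm; have [W HW] := pairing_Rintegral.
have := transports_cintegral (trA n0) (ckernel m n0).
rewrite (pairing_fourier mu_T kappa_meas P_transfer (emb_inc_integrable v) mg
  (fun t => @cpairing n t n0) (fun t => @HW n t n0) cm) => H.
rewrite rmorphM -mulrA H mulrA -rmorphM mulfV ?mul1r// gt_eqF//.
exact: det_gt0.
Qed.

(** The bound is uniform in [n] and in the jump [m], and bilinear in the norms, so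
    that it can be summed over pairs of fibres. *)
Lemma coefficient_le n m : (0 < n)%N ->
  cintegrable mu (fun x => (\1_[set x | birkhoff T kappa n x = m] x)%:C%C *
    (emb (inc v) x * g (iter n T x))) ->
  `|\det (Theta n)| * rnorm (coefficient n m) <=
  (2 * K * \int[lebd]_u rnorm (cexp (- psi u)) + C * (2 * pi) ^+ d * Qd) / (2 * pi) ^+ d *
    (D * rnorm v).
Proof.
move=> n0 cm.
have p0 : 0 < (2 * pi) ^+ d :> R by rewrite exprn_gt0// mulr_gt0// pi_gt0.
rewrite mulrAC ler_pdivlMr//.
have -> : `|\det (Theta n)| * rnorm (coefficient n m) * (2 * pi) ^+ d =
    rnorm ((`|\det (Theta n)| * (2 * pi) ^+ d)%:C%C * coefficient n m).
  rewrite [RHS]rnormM rnorm_real [in RHS]ger0_norm; first by rewrite mulrAC.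
  by rewrite mulr_ge0 ?(ltW p0).
rewrite coefficient_scale//.
apply: (le_trans (le_rnorm_cintegral_bound (mscale m n0) (ihr n0) (fun u => scale_le m u n0))).
rewrite RintegralD//; last exact: iremainder.
have -> : \int[lebd]_x bound x =
    D * rnorm v * (2 * K) * \int[lebd]_u rnorm (cexp (- psi u)) by exact: RintegralZl.
rewrite [leRHS]mulrDl; apply: lerD.
  by rewrite le_eqVlt; apply/orP; left; apply/eqP; ring.
rewrite (le_trans (remainder_integral n0))//.
rewrite [leRHS]mulrC -[leRHS]mulr1; apply: ler_wpM2l.
  by rewrite !mulr_ge0 ?rnorm_ge0 ?exprn_ge0 ?mulr_ge0 ?pi_ge0// ltW// (C_gt0 hypA).
by have /andP[q0 q1] := q_range; rewrite exprn_ile1// ltW.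
Qed.

(** * Limit of the rescaled coefficient *)

Let t_ n (u : 'cV[R]_d) : 'cV[R]_d := (invmx (Theta n))^T *m u.

Let t_cube u (r : R) : 0 < r -> \forall n \near \oo, cube r (t_ n u).
Proof.
move=> r0; apply: filter_forall => i.
have : t_ n u i ord0 @[n --> \oo] --> 0.
  rewrite (_ : (fun n => t_ n u i ord0) =
      (fun n => \sum_(j < d) invmx (Theta n) j i * u j ord0)); last first.
    by apply/funext => n; rewrite mxE; apply: eq_bigr => j _; rewrite mxE.
  rewrite -[X in _ --> X](big1 (I := 'I_d) (op := +%R) (index_enum _) xpredT (fun=> 0))//.
  apply: cvg_big => [|j _]; first exact: add_continuous.
  rewrite -(mul0r (u j ord0)); apply: cvgMl.
  have := cvg_comp _ _ (Theta_inv_cvg hypB) (@coord_continuous R d d j i 0).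
  by rewrite mxE.
move/cvgr0Pnorm_lt => /(_ r r0); apply: filterS => n /ltW.
by [].
Qed.

Let t_neq0 n u : (0 < n)%N -> u != 0 -> t_ n u != 0.
Proof.
move=> n0; apply: contra => /eqP tu.
by rewrite -(iA u n0) -/(t_ n u) tu mulmx0.
Qed.

Let t_near (S : 'cV[R]_d -> Prop) u : u != 0 -> (\forall t \near (0 : 'cV[R]_d)^', S t) ->
  \forall n \near \oo, S (t_ n u).
Proof.
move=> u0 /dnbhs0_cube[r r0 Sr]; near=> n; apply: Sr.
  by near: n; exact: t_cube.
by apply: t_neq0 => //; near: n; exact: nbhs_infty_gt.
Unshelve. all: by end_near. Qed.

Lemma dual_integrable : cintegrable mu g.
Proof.
have [h1 eh1] := one_in_B hypA.
apply: ae_eq_cintegrable (cg (inc h1)) => //.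
by apply: filterS eh1 => x /= + xT => /(_ xT) ->; rewrite mulr1.
Qed.

Let Ef := cintegral mu (emb (inc v)).
Let Eg := cintegral mu g.

(** The difference is the pairing of [g] with the function whose norm is measured
    by the operator norm of [Pi t] minus the expectation. *)
Lemma projection_le (e : R) t : cube b t ->
  (op_norm mu emb (fun (h : B) x =>
      (emb (inc (Pi t h)) x - cintegral mu (emb (inc h)))%R) <= e%:E)%E ->
  rnorm (dual (inc (Pi t v)) - Ef * Eg) <= D * (e * rnorm v).
Proof.
move=> ct te; have [|w ew we] := op_norm_le L1 _ te v.
  move=> c h; have Eh : cintegral mu (emb (inc (c *: h))) = c * cintegral mu (emb (inc h)).
    rewrite -cintegralZ; last exact: emb_inc_integrable.
    apply: ae_eq_cintegral (emb_incZ c h).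
      exact: cintegrable_measurable (emb_inc_integrable _).
    exact: cintegrable_measurable (cintegrableZ _ (emb_inc_integrable _)).
  have := emb_incZ c (Pi t h); rewrite -linearZ/= => H.
  by apply: filterS H => x /= + xT => /(_ xT) ->; rewrite Eh mulrBr.
have -> : dual (inc (Pi t v)) - Ef * Eg = dual w.
  have cEg := cintegrableZ Ef dual_integrable.
  rewrite -cintegralZ; last exact: dual_integrable.
  rewrite -cintegralB//; apply: ae_eq_cintegral.
  - exact: cintegrable_measurable (cintegrableB (cg _) cEg).
  - exact: cintegrable_measurable (cg w).
  - apply: filterS ew => x /= + xT => /(_ xT) ->.
    by rewrite mulrBr [Ef * _]mulrC.
by rewrite (le_trans (dual_le w))// ler_wpM2l.
Qed.

Let b_gt0 : 0 < b. Proof. by have /andP[] := b_range hypA. Qed.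

Let projection_cvg u : u != 0 ->
  rnorm (dual (inc (Pi (t_ n u) v)) - Ef * Eg) @[n --> \oo] --> 0.
Proof.
move=> u0; apply/cvgr0Pnorm_lt => e e0.
pose e' := e / (D * rnorm v + 1).
have Dv0 : 0 <= D * rnorm v by rewrite mulr_ge0 ?rnorm_ge0.
have Dv1 : 0 < D * rnorm v + 1 by rewrite ltr_wpDl.
have e'0 : 0 < e' by rewrite divr_gt0.
have := Pi_cvg hypA (nbhs_open_ereal_lt (f := fun=> e') e'0).
move=> /(t_near u0) H; near=> n.
rewrite ger0_norm ?rnorm_ge0//.
have : rnorm (dual (inc (Pi (t_ n u) v)) - Ef * Eg) <= D * (e' * rnorm v).
  apply: projection_le; first by near: n; exact: t_cube.
  by apply: ltW; near: n; exact: H.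
move/le_lt_trans; apply.
have -> : D * (e' * rnorm v) = e * (D * rnorm v) / (D * rnorm v + 1).
  by rewrite /e'; field; rewrite gt_eqF.
by rewrite ltr_pdivrMr// ltr_pM2l// ltrDl.
Unshelve. all: by end_near. Qed.

Let theta_cvg0 : C * theta ^+ n @[n --> \oo] --> 0.
Proof.
have /andP[t0 t1] := theta_range hypA.
rewrite -(mulr0 C); apply: cvgMr.
by apply: cvg_expr; rewrite ger0_norm ?ltW.
Qed.

Let lam_cvg_charfun u : rnorm (lam (t_ n u) ^+ n - cexp (- psi u)) @[n --> \oo] --> 0.
Proof.
have /eqaddoP H := lam_equiv hypB u.
apply/cvgr0Pnorm_lt => e e0.
have e2 : 0 < (e / 2)%:C%C :> R[i] by rewrite ltcR divr_gt0.
have := H _ e2; apply: filterS => n.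
rewrite /= !fctE normE_rnorm [X in _ * X]normE_rnorm -rmorphM lecR => le2.
rewrite ger0_norm ?rnorm_ge0// (le_lt_trans le2)//.
rewrite (@le_lt_trans _ _ (e / 2 * 1))//; last by rewrite mulr1 ltr_pdivrMr// ltr_pMr// ltr1n.
by rewrite ler_wpM2l ?charfun_le1// divr_ge0// ltW.
Qed.

Let scale_cvg m u : u != 0 ->
  rnorm (scale n m u - cexp (- psi u) * (Ef * Eg)) @[n --> \oo] --> 0.
Proof.
move=> u0.
pose z n := expi (- dot (t_ n u) (Zd_to_Rd R m)) *
  (lam (t_ n u) ^+ n * dual (inc (Pi (t_ n u) v)) + dual (inc (iter n (Rem (t_ n u)) v))).
have dot_cvg : - dot (t_ n u) (Zd_to_Rd R m) @[n --> \oo] --> 0.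
  rewrite -oppr0; apply: cvgN.
  pose s := \sum_(i < d) `|Zd_to_Rd R m i ord0|.
  have s0 : 0 <= s by apply: sumr_ge0.
  apply/cvgr0Pnorm_lt => e e0; near=> n.
  have : cube (e / (s + 1)) (t_ n u).
    by near: n; apply: t_cube; rewrite divr_gt0// ltr_wpDl.
  move=> ct; apply: (@le_lt_trans _ _ (e / (s + 1) * s)).
    rewrite mulr_sumr (le_trans (ler_norm_sum _ _ _))//; apply: ler_sum => i _.
    by rewrite normrM ler_wpM2r.
  by rewrite mulrAC ltr_pdivrMr ?ltr_wpDl// ltr_pM2l// ltrDl.
have Rem_cvg : rnorm (dual (inc (iter n (Rem (t_ n u)) v)) - 0) @[n --> \oo] --> 0.
  apply: (@squeeze_cvgr _ _ _ _ (cst 0) (fun n => D * rnorm v * (C * theta ^+ n))).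
  - near=> n; rewrite rnorm_ge0 subr0/= (le_trans (dual_le _))// -mulrA ler_wpM2l//.
    by rewrite [leRHS]mulrC Rem_le//; near: n; exact: t_cube.
  - exact: cvg_cst.
  - by rewrite -(mulr0 (D * rnorm v)); apply: cvgMr.
have zc : rnorm (z n - cexp (- psi u) * (Ef * Eg)) @[n --> \oo] --> 0.
  have := rcvgM (expi_cvg dot_cvg)
    (rcvgD (rcvgM (lam_cvg_charfun u) (projection_cvg u0)) Rem_cvg).
  by rewrite expi0 mul1r addr0.
apply: (@squeeze_cvgr _ _ _ _ (cst 0)
  (fun n => rnorm (z n - cexp (- psi u) * (Ef * Eg)))); [|exact: cvg_cst|exact: zc].
near=> n; rewrite rnorm_ge0/=.
have ct : cube b (t_ n u) by near: n; exact: t_cube.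
have ctpi : t_ n u \in cube pi.
  apply: mem_set => i; have /andP[_ bpi] := b_range hypA.
  exact: le_trans (ct i) bpi.
rewrite /scale /kernel indicE ctpi/= mul1r pairing_inside//.
by near: n; exact: nbhs_infty_gt.
Unshelve. all: by end_near. Qed.

(** For each [u] other than the origin the rescaled twist tends to 0 without
    reaching it, so the spectral asymptotics apply.  The limit integrates to
    [(2 * pi) ^+ d * Phi 0] times the product of expectations by Fourier
    inversion. *)
Lemma coefficient_cvg m :
  (forall n, cintegrable mu (fun x => (\1_[set x | birkhoff T kappa n.+1 x = m] x)%:C%C *
    (emb (inc v) x * g (iter n.+1 T x)))) ->
  rnorm ((`|\det (Theta n.+1)|)%:C%C * coefficient n.+1 m - (Phi 0)%:C%C * (Ef * Eg))
    @[n --> \oo] --> 0.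
Proof.
move=> cm; set L := Ef * Eg.
have p0 : 0 < (2 * pi) ^+ d :> R by rewrite exprn_gt0// mulr_gt0// pi_gt0.
have H : rnorm (cintegral lebd (scale n.+1 m) -
    cintegral lebd (fun u => L * cexp (- psi u))) @[n --> \oo] --> 0.
  apply: (cdominated_remainder
    (h := fun u => (D * rnorm v * (2 * K) + rnorm L) * rnorm (cexp (- psi u)))
    (r := fun n => remainder n.+1)).
  - by move=> n; exact: mscale.
  - exact: cintegrable_measurable (cintegrableZ _ (charfun_integrable hypB)).
  - exact: integrable_scaled.
  - by move=> n; exact: iremainder.
  - by move=> n u; exact: remainder_ge0.
  - apply: (@squeeze_cvgr _ _ _ _ (cst 0)
      (fun n => D * rnorm v * (C * (2 * pi) ^+ d * Qd) * q ^+ n.+1)).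
    + apply: nearW => n; rewrite remainder_integral// andbT.
      by apply: Rintegral_ge0 => u _; exact: remainder_ge0.
    + exact: cvg_cst.
    + rewrite -[X in _ --> X](mulr0 (D * rnorm v * (C * (2 * pi) ^+ d * Qd))).
      apply: cvgMr; have /andP[q0 q1] := q_range.
      have := @cvg_expr R q; rewrite ger0_norm// => /(_ q1).
      by rewrite -(cvg_shiftS (fun n => q ^+ n)).
  - move=> n u; rewrite (le_trans (scale_le m u (ltn0Sn n)))// lerD2r.
    by rewrite mulrDl lerDl mulr_ge0 ?rnorm_ge0.
  - by move=> u; rewrite [leLHS]rnormM ler_wpM2r ?rnorm_ge0// lerDr !mulr_ge0 ?rnorm_ge0.
  - apply: negligibleS (negligible_origin R d_gt0) => u /=.
    apply: contra_notP => /eqP u0.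
    have := scale_cvg m u0; rewrite -(cvg_shiftS (fun n => rnorm (scale n m u - _))).
    by rewrite /= [cexp _ * _]mulrC.
have E n : (`|\det (Theta n.+1)|)%:C%C * coefficient n.+1 m - (Phi 0)%:C%C * L =
    ((2 * pi) ^+ d)^-1%:C%C * (cintegral lebd (scale n.+1 m) -
    cintegral lebd (fun u => L * cexp (- psi u))).
  rewrite cintegralZ; last exact: charfun_integrable hypB.
  rewrite (fourier_inversion0 (charfun hypB) (charfun_integrable hypB)
    (Phi_continuous hypB) (Phi_ge0 hypB) (Phi_density hypB)).
  rewrite -coefficient_scale//.
  have pC : ((2 * pi) ^+ d)^-1%:C%C * ((2 * pi) ^+ d)%:C%C = 1 :> R[i].
    by rewrite -rmorphM mulVf ?gt_eqF.
  rewrite !rmorphM mulrBr; congr (_ - _).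
    by rewrite [X in _ * (X * _)]mulrC !mulrA pC mul1r.
  by rewrite -[LHS]mul1r -pC; ring.
rewrite (_ : (fun n => _) = (fun n => ((2 * pi) ^+ d)^-1 *
    rnorm (cintegral lebd (scale n.+1 m) - cintegral lebd (fun u => L * cexp (- psi u))))).
  by rewrite -(mulr0 ((2 * pi) ^+ d)^-1); apply: cvgMr.
apply/funext => n; rewrite E [LHS]rnormM rnorm_real ger0_norm//.
by rewrite invr_ge0 ltW.
Qed.

End pair.
End spectral.

(** * Sums over the lattice *)

Section lattice_sums.
Context (R : realType) (d : nat).
Local Notation cnt := (@counting_Zd R d).

Lemma counting_Zd_set1 (l : Zd d) :
  (cnt : {measure set (Zd d) -> \bar R}) [set l] = 1%E.
Proof.
transitivity (@counting_Zd R d [set l]) => //.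
by rewrite /counting_Zd /counting asboolT// fset_set1 finmap.cardfs1.
Qed.

Lemma counting_Zd_ae (S : Zd d -> Prop) : {ae cnt, forall l, S l} -> forall l, S l.
Proof.
move=> [N [mN N0 HN]] l; apply: contrapT => Sl.
have : (cnt [set l] <= cnt N)%E.
  by apply: le_measure; rewrite ?inE// => _ ->; exact: HN.
by rewrite N0 counting_Zd_set1 lee_fin ler10.
Qed.

Lemma counting_Zd_point (l : Zd d) (a : Zd d -> R) :
  (\int[cnt]_m (\1_[set l] m * a m)%:E = (a l)%:E)%E.
Proof.
rewrite (eq_integral (fun m => (a l)%:E * (\1_[set l] m)%:E)%E).
  have i1 : cnt.-integrable setT (EFin \o (\1_[set l] : Zd d -> R)).
    by apply: integrable_indic_lty => //; rewrite counting_Zd_set1 ltry.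
  by rewrite (integralZl measurableT i1) integral_indic// setIT counting_Zd_set1 mule1.
move=> m _; rewrite indicE -EFinM; congr EFin.
have [/set_mem ->|_] := boolP (m \in [set l]); first by rewrite mul1r mulr1.
by rewrite mul0r mulr0.
Qed.

Lemma counting_Zd_cpoint (l : Zd d) (a : Zd d -> R[i]) :
  cintegral cnt (fun m => (\1_[set l] m)%:C%C * a m) = a l.
Proof.
apply: complex_ext => /=; rewrite /Rintegral.
  have := counting_Zd_point l (fun m => complex.Re (a m)) => /(congr1 fine) /= <-.
  by congr fine; apply: eq_integral => m _; rewrite ReM /= mul0r subr0.
have := counting_Zd_point l (fun m => complex.Im (a m)) => /(congr1 fine) /= <-.
by congr fine; apply: eq_integral => m _; rewrite ImM /= mul0r addr0.
Qed.

(** The encoding of the lattice by natural numbers reduces the integral to a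
    series whose terms run over sets with at most one point. *)
Lemma integral_counting_Zd (a : Zd d -> \bar R) : (forall l, 0 <= a l)%E ->
  (\int[cnt]_l a l = \esum_(l in [set: Zd d]) a l)%E.
Proof.
move=> a0; pose F (k : nat) : set (Zd d) := [set l | pickle l = k].
have FT : \bigcup_k F k = [set: Zd d] by apply/seteqP; split => // l _; exists (pickle l).
have tF : trivIset setT F by move=> i j _ _ [l [/= <- <-]].
rewrite -FT ge0_integral_bigcup// esum_bigcup//; last exact: sub_trivIset tF.
rewrite nneseries_esumT; last by move=> k; exact: integral_ge0.
apply: eq_esum => k _.
have [[l Fl]|F0] := pselect (exists l, F k l); last first.
  have -> : F k = set0 by apply/seteqP; split => // l Fl; apply: F0; exists l.
  by rewrite integral_set0 esum_set0.
have -> : F k = [set l].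
  apply/seteqP; split => [m Fm|_ -> //]; apply: (pcan_inj pickleK).
  by rewrite Fl Fm.
rewrite esum_set1// integral_mkcond.
rewrite (eq_integral (fun m => a l * (\1_[set l] m)%:E)%E).
  rewrite ge0_integralZl//.
  by rewrite integral_indic// setIT counting_Zd_set1 mule1.
move=> m _; rewrite patchE indicE; have [/set_mem ->|_] := boolP (m \in [set l]).
  by rewrite mule1.
by rewrite mule0.
Qed.

Lemma measurable_Zd_prod (A : set (Zd d * Zd d)) : measurable A.
Proof.
have -> : A = \bigcup_(p : Zd d * Zd d) (A `&` ([set p.1] `*` [set p.2])).
  apply/seteqP; split => [p Ap|p [q _ [] //]].
  by exists p.
apply: countable_bigcupT_measurable; first exact: countableP.
move=> p; have [Ap|Ap] := pselect (A p).
  rewrite (_ : _ `&` _ = [set p.1] `*` [set p.2]); first exact: measurableX.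
  apply/seteqP; split => [q [] //|q [/= q1 q2]]; split => //.
  by rewrite (_ : q = p)//; case: (q) (p) q1 q2 => ? ? [? ?] /= -> ->.
rewrite (_ : _ `&` _ = set0)//; apply/seteqP; split => // q [Aq [/= q1 q2]].
by apply: Ap; rewrite (_ : p = q)//; case: (q) (p) q1 q2 => ? ? [? ?] /= -> ->.
Qed.

Lemma esum_lty_each (a : Zd d -> \bar R) : (forall l, 0 <= a l)%E ->
  (\esum_(l in [set: Zd d]) a l < +oo)%E -> forall l, (a l < +oo)%E.
Proof.
move=> a0 aoo l; apply: le_lt_trans aoo; apply: esum_ge.
by exists [set l]; rewrite ?fsbig_set1//; split.
Qed.

Lemma esum_integrable (a : Zd d -> R) : (forall l, 0 <= a l) ->
  (\esum_(l in [set: Zd d]) (a l)%:E < +oo)%E ->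
  cnt.-integrable setT (EFin \o a).
Proof.
move=> a0 aoo; apply/integrableP; split => //.
rewrite (eq_integral (fun l => (a l)%:E)); last by move=> l _; rewrite /= ger0_norm.
by rewrite integral_counting_Zd// => l; rewrite lee_fin.
Qed.

End lattice_sums.

(** * Norms of the fibres *)

Section fibre_norms.
Context (R : realType) dX (X : measurableType dX) (mu : probability X R).
Context (B B0 : completeNormedModType R[i]) (inc : {linear B -> B0}).
Context (emb : B0 -> X -> R[i]).
Hypothesis L1 : L1_embedding mu emb.

(** A ball on which the map stays below 1 gives the bound by homogeneity. *)
Lemma continuous_linear_le : continuous inc ->
  exists2 K : R, 0 <= K & forall v, rnorm (inc v) <= K * rnorm v.
Proof.
move=> ci; have H := (cvgr0Pnorm_lt _).1 ((cvg_rnorm0 _ _ _).1 (ci 0)).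
have [_ /realC_gt0[r r0 ->] Hr] := (nbhs_ballP _ _).1 (H _ _ _ ltr01).
exists (2 / r); first by rewrite divr_ge0 ?ltW.
move=> v; have [v0|v0] := eqVneq (rnorm v) 0.
  by rewrite (rnorm_eq0 v0) linear0 !rnorm0 mulr0.
have v1 : 0 < rnorm v by rewrite lt_neqAle rnorm_ge0 andbT eq_sym.
pose c := r / 2 / rnorm v; have c0 : 0 < c by rewrite !divr_gt0.
have : ball 0 r%:C%C (c%:C%C *: v).
  rewrite -ball_normE /= sub0r normrN normE_rnorm ltcR rnormZ rnorm_real ger0_norm ?ltW//.
  by rewrite /c divfK// ltr_pdivrMr// ltr_pMr// ltr1n.
move=> /Hr /=; rewrite linear0 subr0 ger0_norm ?rnorm_ge0//.
rewrite linearZ rnormZ rnorm_real ger0_norm ?(ltW c0)// [X in X < _]mulrC -ltr_pdivlMr// => /ltW/le_trans; apply.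
by rewrite le_eqVlt; apply/orP; left; apply/eqP; rewrite /c; field; rewrite !gt_eqF.
Qed.

Lemma space_norm_ge0 (f : X -> R[i]) : (0 <= space_norm mu (fun h => emb (inc h)) f)%E.
Proof. by apply/ereal_infP => _ [v _ <-]; rewrite lee_fin rnorm_ge0. Qed.

Lemma space_norm_lty (f : X -> R[i]) : injective inc ->
  (space_norm mu (fun h => emb (inc h)) f < +oo)%E ->
  exists2 v, ae_eq mu setT (emb (inc v)) f &
    space_norm mu (fun h => emb (inc h)) f = (rnorm v)%:E.
Proof.
move=> inj; rewrite /space_norm; set S := [set _ | _ in _] => Soo.
have [v vf] : exists v, ae_eq mu setT (emb (inc v)) f.
  apply: contrapT => H; move: Soo; rewrite (_ : S = set0) ?ereal_inf0//.
  by apply/seteqP; split => // t [v vf _]; apply: H; exists v.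
exists v => //; apply/le_anti/andP; split.
  by apply: ereal_inf_lbound; exists v.
by apply/ereal_infP => _ [w wf <-]; rewrite lee_fin (inj _ _ (emb_inj L1 wf vf)).
Qed.

Lemma dual_norm_ge0 (g : X -> R[i]) : (0 <= dual_norm mu emb g)%E.
Proof.
apply: (@le_trans _ _ (rnorm (cintegral mu (fun x => g x * emb 0 x)))%:E).
  by rewrite lee_fin rnorm_ge0.
by apply: ereal_sup_ubound; exists 0 => //=; rewrite rnorm0.
Qed.

(** The fibres are bounded in L^1 by their norms, and the norms are summable. *)
Lemma fibrewise_integrable d (f : X * Zd d -> R[i]) (v : Zd d -> B) :
  continuous inc -> cmeasurable f ->
  (forall l, ae_eq mu setT (emb (inc (v l))) (fun x => f (x, l))) ->
  (@counting_Zd R d).-integrable setT (EFin \o (fun l => rnorm (v l))) ->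
  cintegrable (mu \x @counting_Zd R d)%E f.
Proof.
move=> ci mf vf iv.
have [Ki Ki_ge0 HKi] := continuous_linear_le ci.
have [L HL] := L1_emb_bounded L1.
apply: (cintegrable_dominated mf (h := fun p => rnorm (f p))) => //.
apply/integrable21ltyP; first exact/measurable_EFinP/measurable_rnorm.
apply: (@le_lt_trans _ _ (\int[@counting_Zd R d]_l (`|L| * Ki * rnorm (v l))%:E)%E).
  apply: ge0_le_integral => //; first by move=> l _; exact: integral_ge0.
  move=> l _; rewrite (ae_eq_integral (fun x => (rnorm (emb (inc (v l)) x))%:E))//.
  - apply: le_trans (HL _) _; rewrite lee_fin -mulrA.
    apply: (@le_trans _ _ (`|L| * rnorm (inc (v l)))); last by rewrite ler_wpM2l.
    by rewrite ler_wpM2r ?rnorm_ge0// ler_norm.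
  - apply: measurableT_comp => //; apply/measurable_EFinP; apply: measurable_rnorm.
    exact: cmeasurable_comp (pair2_measurable l) mf.
  - apply/measurable_EFinP; apply: measurable_rnorm.
    exact: cintegrable_measurable (L1_emb_integrable L1 _).
  - apply: filterS (vf l) => x /= + xT => /(_ xT) ->.
    by rewrite ger0_norm ?rnorm_ge0.
have /integrableP[_] := integrable_scaled (`|L| * Ki) iv.
rewrite (eq_integral (fun l => (`|L| * Ki * rnorm (v l))%:E))//.
by move=> l _; rewrite /= ger0_norm ?mulr_ge0 ?rnorm_ge0.
Qed.

End fibre_norms.

(** * Correlations as sums over pairs of fibres *)

Section correlations.
Context (R : realType) dX (X : measurableType dX) (mu : probability X R) (d : nat).
Variables (T : X -> X) (kappa : X -> Zd d).
Hypothesis mu_T : preserves mu T.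
Hypothesis mkappa : measurable_fun setT kappa.
Variables (f g : X * Zd d -> R[i]) (n : nat).
Hypothesis mf : cmeasurable f.
Hypothesis mg : cmeasurable g.
Hypothesis cfg : cintegrable (mu \x @counting_Zd R d)%E
  (fun p => f p * g (iter n (extension_map T kappa) p)).
Local Notation cnt := (@counting_Zd R d).
Local Notation S := (birkhoff T kappa n).

Let mS : measurable_fun setT S := measurable_birkhoff mu_T mkappa n.
Let mT := measurable_iter mu_T n.

Lemma cmeasurable_fibre (h : X * Zd d -> R[i]) l : cmeasurable h ->
  cmeasurable (fun x => h (x, l)).
Proof. exact: cmeasurable_comp (pair2_measurable l). Qed.

Definition jump_coefficient l l' : R[i] :=
  cintegral mu (fun x => (\1_[set x | S x = l' - l] x)%:C%C * (f (x, l) * g (iter n T x, l'))).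

Let J l l' x : R[i] :=
  (\1_[set x | S x = l' - l] x)%:C%C * (f (x, l) * g (iter n T x, l')).

(** Fubini's theorem gives integrability on almost every fibre, that is on every
    fibre since points have positive counting measure. *)
Let fibre_integrable l : cintegrable mu (fun x => f (x, l) * g (iter n T x, l + S x)).
Proof.
move: l; apply: (@counting_Zd_ae R).
have := cfubini_ae2 cfg; apply: filterS => l.
by under eq_fun do rewrite iter_extension.
Qed.

Lemma jump_integrable l l' : cintegrable mu
  (fun x => (\1_[set x | S x = l' - l] x)%:C%C * (f (x, l) * g (iter n T x, l'))).
Proof.
have mJ : cmeasurable (fun x => f (x, l) * g (iter n T x, l')).
  apply: cmeasurableM; first exact: cmeasurable_fibre.
  exact: cmeasurable_comp mT (cmeasurable_fibre l' mg).
apply: cintegrable_dominated (integrable_rnorm (fibre_integrable l)) _.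
  apply: cmeasurableM => //; apply: cmeasurable_indic.
  exact: (measurable_Zd_preimage [set l' - l] mS).
move=> x; rewrite [leLHS]rnormM rnorm_real indicE.
have [/set_mem/= ->|_] := boolP (x \in _); last by rewrite normr0 mul0r rnorm_ge0.
by rewrite normr1 mul1r [l + _]addrC subrK.
Qed.

Let J_point l x : (fun l' => J l l' x) = (fun l' =>
  (\1_[set l + S x] l')%:C%C * (f (x, l) * g (iter n T x, l'))).
Proof.
apply/funext => l'; rewrite /J !indicE; congr ((nat_of_bool _)%:R%:C%C * _).
apply/idP/idP => /set_mem/= H; apply/mem_set => /=.
  by rewrite H addrC subrK.
by rewrite H addrAC subrr add0r.
Qed.

(** For given [l] and [x] only one [l'] contributes, so that the moduli sum over
    [l'] to the modulus treated in [fibre_integrable]. *)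
Let J_integrable_prod l : cintegrable (mu \x cnt)%E (fun p => J l p.2 p.1).
Proof.
apply: cintegrable_prodP.
  apply: cmeasurableM.
    apply: cmeasurable_real; rewrite (_ : (fun p : X * Zd d => _) =
      \1_[set p : X * Zd d | S p.1 = p.2 - l]); last first.
      by apply/funext => p; rewrite !indicE; congr (nat_of_bool _)%:R;
        apply/idP/idP => /set_mem/= H; apply/mem_set.
    apply: measurable_indic.
    rewrite (_ : [set p | _] = (fun p : X * Zd d => S p.1 + (l - p.2)) @^-1` [set 0]).
      apply: measurable_Zd_preimage; apply: measurable_Zd_add.
        exact: measurableT_comp mS measurable_fst.
      exact: (measurableT_comp (f := fun l' : Zd d => l - l') _ measurable_snd).
    apply/seteqP; split => p /= H; first by rewrite H addrA subrK subrr.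
    by apply/eqP; rewrite -subr_eq0 opprB H.
  apply: cmeasurableM.
    by apply: (cmeasurable_comp _ mf); exact: measurable_fun_pair.
  apply: (cmeasurable_comp _ mg); apply: measurable_fun_pair.
    exact: measurableT_comp mT measurable_fst.
  exact: measurable_snd.
have /integrableP[_] := integrable_rnorm (fibre_integrable l).
rewrite (eq_integral (fun x => \int[cnt]_l' (rnorm (J l l' x))%:E)%E)//.
move=> x _; have := counting_Zd_point (l + S x)
  (fun l' => rnorm (f (x, l) * g (iter n T x, l'))).
rewrite /= ger0_norm ?rnorm_ge0// => <-; apply: eq_integral => l' _.
have -> : J l l' x = (\1_[set l + S x] l')%:C%C * (f (x, l) * g (iter n T x, l')).
  exact: (congr1 (@^~ l') (J_point l x)).
by rewrite [in RHS]rnormM [in RHS]rnorm_real ger0_norm.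
Qed.

Lemma correlation_sum :
  cintegral (mu \x cnt)%E (fun p => f p * g (iter n (extension_map T kappa) p)) =
  cintegral cnt (fun l => cintegral cnt (fun l' => jump_coefficient l l')).
Proof.
rewrite (cfubini2 cfg); congr cintegral; apply/funext => l.
rewrite /jump_coefficient -(cfubini2 (J_integrable_prod l)) (cfubini1 (J_integrable_prod l)).
by congr cintegral; apply/funext => x /=; rewrite J_point counting_Zd_cpoint iter_extension.
Qed.

End correlations.

Local Notation cnt2 R d := (@counting_Zd R d \x @counting_Zd R d)%E.

Theorem theorem2p3 (R : realType) (d : nat) (d_gt0 : (0 < d)%N)
  (dX : measure_display) (X : measurableType dX) (mu : probability X R)
  (T : X -> X) (mu_T : preserves mu T)
  (kappa : X -> Zd d) (kappa_meas : measurable_fun setT kappa)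
  (P : (X -> R[i]) -> X -> R[i]) (P_transfer : transfer_operator mu T P)
  (B B0 : completeNormedModType R[i]) (inc : {linear B -> B0})
  (emb : B0 -> X -> R[i]) (b C theta : R)
  (lam : 'cV[R]_d -> R[i]) (Pi Rem : 'cV[R]_d -> {linear B -> B})
  (hypA : spectral_hypotheses mu P kappa inc emb b C theta lam Pi Rem)
  (Pi_bounded : exists K : R, forall u, cube b u ->
    (op_norm mu emb (fun h : B => emb (inc (Pi u h))) <= K%:E)%E)
  (dO : measure_display) (Omega : measurableType dO) (Q : probability Omega R)
  (Y : {mfun Omega >-> 'cV[R]_d}) (psi : 'cV[R]_d -> R[i])
  (Phi : 'cV[R]_d -> R) (Theta : nat -> 'M[R]_d)
  (hypB : asymptotic_hypotheses b lam Q Y psi Phi Theta)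
  (f g : X * Zd d -> R[i])
  (f_meas : cmeasurable f) (g_meas : cmeasurable g)
  (f_summable :
    (\esum_(l in [set: Zd d])
       space_norm mu (fun h : B => emb (inc h)) (fun x => f (x, l)) < +oo)%E)
  (g_pairing : forall (l : Zd d) (h : B0),
    cintegrable mu (fun x => g (x, l) * emb h x))
  (g_summable :
    (\esum_(l in [set: Zd d]) dual_norm mu emb (fun x => g (x, l)) < +oo)%E)
  (g_integrable : cintegrable (extension_measure d mu) g)
  (fg_integrable : forall n : nat, (0 < n)%N ->
    cintegrable (extension_measure d mu)
      (fun p => f p * g (iter n (extension_map T kappa) p))) :
  let nu := extension_measure d mu in
  let I n := cintegral nu (fun p => f p * g (iter n (extension_map T kappa) p)) in
  (Phi 0 != 0 -> exists2 eps : nat -> R[i]^o, eps @ \oo --> (0 : R[i]^o) &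
     forall n, (0 < n)%N ->
       I n = (Phi 0 / `|\det (Theta n)|)%:C%C
             * (cintegral nu f * cintegral nu g + eps n)) /\
  (Phi 0 = 0 -> (fun n => (`|\det (Theta n)|)%:C%C * I n : R[i]^o) @ \oo
     --> (0 : R[i]^o)).
Proof.
move=> nu I.
have [K0 HK0] := Pi_bounded.
pose K := `|K0|; have K_ge0 : 0 <= K := normr_ge0 K0.
have Pi_K u : cube b u -> (op_norm mu emb (fun h : B => emb (inc (Pi u h))) <= K%:E)%E.
  by move=> cu; rewrite (le_trans (HK0 u cu))// lee_fin ler_norm.
have L1 := emb_L1 hypA.
have b_gt0 : 0 < b by have /andP[] := b_range hypA.
have [Qd [q [Qd_ge0 q_range det_Qd]]] := det_bound b_gt0 (theta_range hypA) (lam_cvg hypA)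
  (charfun0 hypB) (charfun_integrable hypB) (Theta_unit hypB) (lam_bound hypB).
have mf l : cmeasurable (fun x => f (x, l)) := cmeasurable_comp (pair2_measurable l) f_meas.
have mg l : cmeasurable (fun x => g (x, l)) := cmeasurable_comp (pair2_measurable l) g_meas.
have F_lty := esum_lty_each (fun l => space_norm_ge0 mu inc emb (fun x => f (x, l))) f_summable.
have /choice[v Hv] l : exists v : B, ae_eq mu setT (emb (inc v)) (fun x => f (x, l)) /\
    space_norm mu (fun h : B => emb (inc h)) (fun x => f (x, l)) = (rnorm v)%:E.
  by have [w ? ?] := space_norm_lty L1 (inc_injective hypA) (F_lty l); exists w.
have iF : (@counting_Zd R d).-integrable setT (EFin \o (fun l => rnorm (v l))).
  apply: esum_integrable => [l|]; first exact: rnorm_ge0.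
  by under eq_esum do rewrite -(Hv _).2.
pose G l := fine (dual_norm mu emb (fun x => g (x, l))).
have G_lty := esum_lty_each (fun l => dual_norm_ge0 mu emb (fun x => g (x, l))) g_summable.
have GE l : (G l)%:E = dual_norm mu emb (fun x => g (x, l)).
  by rewrite fineK// ge0_fin_numE ?G_lty// dual_norm_ge0.
have G_ge0 l : 0 <= G l by rewrite fine_ge0// dual_norm_ge0.
have iG : (@counting_Zd R d).-integrable setT (EFin \o G).
  by apply: esum_integrable => //; under eq_esum do rewrite GE.
have GD l : (dual_norm mu emb (fun x => g (x, l)) <= (G l)%:E)%E by rewrite GE.
have f_integrable := fibrewise_integrable L1 (inc_continuous hypA) f_meas (fun l => (Hv l).1) iF.
have fgP n : (0 < n)%N -> cintegrable (mu \x @counting_Zd R d)%E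
    (fun p : X * Zd d => f p * g (iter n (extension_map T kappa) p)).
  by move=> n0; exact: fg_integrable n n0.
have g_integrable' : cintegrable (mu \x @counting_Zd R d)%E g := g_integrable.
pose Ef l := cintegral mu (fun x => f (x, l)).
pose Eg l := cintegral mu (fun x => g (x, l)).
have EfE l : Ef l = cintegral mu (emb (inc (v l))).
  apply: ae_eq_cintegral => //; last by apply: ae_eq_sym; exact: (Hv l).1.
  exact: cintegrable_measurable (emb_inc_integrable hypA _).
have cEf : cintegrable (@counting_Zd R d) Ef := cfubini2_integrable f_integrable.
have cEg : cintegrable (@counting_Zd R d) Eg := cfubini2_integrable g_integrable'.
pose J n l l' := jump_coefficient mu T kappa f g n l l'.
pose jump n l l' x := (\1_[set x | birkhoff T kappa n x = l' - l] x)%:C%C *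
  (emb (inc (v l)) x * g (iter n T x, l')).
have jump_ae n l l' : ae_eq mu setT
    (fun x => (\1_[set x | birkhoff T kappa n x = l' - l] x)%:C%C *
      (f (x, l) * g (iter n T x, l')))
    (jump n l l').
  by apply: filterS (Hv l).1 => x /= + xT => /(_ xT); rewrite /jump => ->.
have jump_cm n l l' : (0 < n)%N -> cintegrable mu (jump n l l').
  move=> n0; apply: ae_eq_cintegrable (jump_ae n l l') _.
    apply: cmeasurableM.
      apply: cmeasurable_indic.
      exact: (measurable_Zd_preimage [set l' - l] (measurable_birkhoff mu_T kappa_meas n)).
    apply: cmeasurableM.
      exact: cintegrable_measurable (emb_inc_integrable hypA _).
    exact: cmeasurable_comp (measurable_iter mu_T n) (mg l').
  exact: (jump_integrable mu_T kappa_meas f_meas g_meas (fgP n n0)).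
have JE n l l' : (0 < n)%N -> J n l l' = cintegral mu (jump n l l').
  move=> n0; apply: ae_eq_cintegral (jump_ae n l l').
    apply: cintegrable_measurable.
    exact: (jump_integrable mu_T kappa_meas f_meas g_meas (fgP n n0)).
  exact: cintegrable_measurable (jump_cm n l l' n0).
pose M := (2 * K * \int[@lebesgue_Rd R d]_u rnorm (cexp (- psi u)) +
  C * (2 * pi) ^+ d * Qd) / (2 * pi) ^+ d.
have J_le n l l' : (0 < n)%N ->
    `|\det (Theta n)| * rnorm (J n l l') <= M * (G l' * rnorm (v l)).
  move=> n0; rewrite JE//.
  exact: (coefficient_le mu_T kappa_meas P_transfer hypA K_ge0 Pi_K hypB Qd_ge0 q_range
    det_Qd (mg l') (g_pairing l') (G_ge0 l') (GD l') n0 (jump_cm n l l' n0)).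
have J_cvg l l' : rnorm ((`|\det (Theta n.+1)|)%:C%C * J n.+1 l l' -
    (Phi 0)%:C%C * (Ef l * Eg l')) @[n --> \oo] --> 0.
  rewrite (_ : (fun n => _) = (fun n => rnorm ((`|\det (Theta n.+1)|)%:C%C *
      cintegral mu (jump n.+1 l l') -
      (Phi 0)%:C%C * (cintegral mu (emb (inc (v l))) * Eg l')))); last first.
    by apply/funext => n; rewrite JE// EfE.
  exact: (coefficient_cvg mu_T kappa_meas P_transfer hypA d_gt0 K_ge0 Pi_K hypB q_range
    det_Qd (mg l') (g_pairing l') (G_ge0 l') (GD l') (fun n => jump_cm n.+1 l l' isT)).
have det_gt0 n : (0 < n)%N -> 0 < `|\det (Theta n)|.
  by move=> n0; rewrite normr_gt0 -unitfE -unitmxE (Theta_unit hypB).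
(* the lattice is countable, so every function of a pair of fibres is measurable *)
have m2 (h : Zd d * Zd d -> R[i]) : cmeasurable h.
  by split=> _ A _; rewrite setTI; exact: measurable_Zd_prod.
(* the dominating function is the sum of a bound for the terms and the modulus of
   their limit *)
pose FG (p : Zd d * Zd d) : R[i] := (rnorm (v p.1))%:C%C * (G p.2)%:C%C.
have FGE p : rnorm (FG p) = G p.2 * rnorm (v p.1).
  by rewrite rnormM !rnorm_real !ger0_norm ?rnorm_ge0// mulrC.
pose Z n (p : Zd d * Zd d) := (`|\det (Theta n.+1)|)%:C%C * J n.+1 p.1 p.2.
pose h (p : Zd d * Zd d) := M * rnorm (FG p) + Phi 0 * rnorm (Ef p.1 * Eg p.2).
have ih : (cnt2 R d).-integrable setT (EFin \o h).
  have i1 : (cnt2 R d).-integrable setT (EFin \o (fun p => M * rnorm (FG p))).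
    apply: integrable_scaled; apply: integrable_rnorm.
    apply: (cintegrable_prod (a := fun l => (rnorm (v l))%:C%C)
      (b := fun l => (G l)%:C%C)); by split => //; exact: integrable0.
  have i2 : (cnt2 R d).-integrable setT (EFin \o (fun p => Phi 0 * rnorm (Ef p.1 * Eg p.2))).
    by apply: integrable_scaled; apply: integrable_rnorm; exact: cintegrable_prod.
  by have := integrableD measurableT i1 i2.
have Phi0 := Phi_ge0 hypB 0.
have Zh n p : rnorm (Z n p) <= h p.
  rewrite [leLHS]rnormM rnorm_real normr_id (le_trans (J_le n.+1 _ _ isT))//.
  by rewrite /h FGE lerDl mulr_ge0 ?rnorm_ge0.
have limh p : rnorm ((Phi 0)%:C%C * (Ef p.1 * Eg p.2)) <= h p.
  rewrite [leLHS]rnormM rnorm_real ger0_norm// /h FGE lerDr.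
  by rewrite (le_trans _ (J_le 1%N p.1 p.2 isT))// mulr_ge0 ?rnorm_ge0.
have cJ n : cintegrable (cnt2 R d) (fun p => J n.+1 p.1 p.2).
  have := cintegrableZ (`|\det (Theta n.+1)|^-1)%:C%C (cintegrable_dominated (m2 (Z n)) ih (Zh n)).
  congr cintegrable; apply/funext => p.
  by rewrite /Z mulrA -rmorphM mulVf ?mul1r// gt_eqF// det_gt0.
have IE n : (`|\det (Theta n.+1)|)%:C%C * I n.+1 = cintegral (cnt2 R d) (Z n).
  rewrite cintegralZ// (cfubini1 (cJ n)); congr (_ * _).
  exact: (correlation_sum mu_T kappa_meas f_meas g_meas (fgP _ (ltn0Sn n))).
have LE : (Phi 0)%:C%C * (cintegral nu f * cintegral nu g) =
    cintegral (cnt2 R d) (fun p => (Phi 0)%:C%C * (Ef p.1 * Eg p.2)).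
  rewrite cintegralZ; last exact: cintegrable_prod.
  rewrite cintegral_prod//; congr (_ * (_ * _)).
    exact: (cfubini2 f_integrable).
  exact: (cfubini2 g_integrable').
have main : rnorm ((`|\det (Theta n)|)%:C%C * I n -
    (Phi 0)%:C%C * (cintegral nu f * cintegral nu g)) @[n --> \oo] --> 0.
  rewrite -(cvg_shiftS (fun n => rnorm ((`|\det (Theta n)|)%:C%C * I n - _))).
  rewrite (_ : (fun n => _) = (fun n => rnorm
      (cintegral (cnt2 R d) (Z n) -
       cintegral (cnt2 R d) (fun p => (Phi 0)%:C%C * (Ef p.1 * Eg p.2))))); last first.
    by apply/funext => n; rewrite /= IE LE.
  by apply: cdominated_convergence ih Zh limh _ => //; apply: nearW => p; exact: J_cvg.
split=> [Phi_neq0|Phi_eq0]; last first.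
  apply/(cvg_rnorm0 (V := R[i]^o)); move: main.
  by rewrite Phi_eq0 rmorph0 mul0r.
exists (fun n => (`|\det (Theta n)| / Phi 0)%:C%C * I n - cintegral nu f * cintegral nu g).
  apply/(cvg_rnorm0 (V := R[i]^o)).
  rewrite (_ : (fun n => _) = (fun n => (Phi 0)^-1 * rnorm ((`|\det (Theta n)|)%:C%C * I n -
    (Phi 0)%:C%C * (cintegral nu f * cintegral nu g)))).
    by rewrite -(mulr0 (Phi 0)^-1); apply: cvgMr.
  apply/funext => n; transitivity (rnorm ((Phi 0)^-1%:C%C * ((`|\det (Theta n)|)%:C%C * I n -
      (Phi 0)%:C%C * (cintegral nu f * cintegral nu g)))); last first.
    by rewrite [LHS]rnormM rnorm_real ger0_norm ?invr_ge0.
  rewrite subr0 mulrBr !(mulrA ((Phi 0)^-1)%:C%C) -!rmorphM.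
  by rewrite mulVf// mul1r [(Phi 0)^-1 * _]mulrC.
move=> n n0; rewrite addrC subrK mulrA -rmorphM.
rewrite (_ : _ * (_ / _) = 1) ?mul1r//; field.
by rewrite Phi_neq0 gt_eqF// det_gt0.
Qed.
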